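(* Let $\kappa \in (0,1)$ and $\lambda = \sqrt{1-\kappa^2}$. For $\mu \in (0,1)$ let $p_{\mu} = \wp(\,\cdot\,; g_2, g_3)$ be the Weierstrass $\wp$ function with invariants $$g_2 = \tfrac43 - \mu^2, \qquad g_3 = \tfrac{8}{27} - \tfrac13 \mu^2,$$ and let $(2\omega_{\mu}, 2\omega_{\mu}')$ be the fundamental pair of periods of $p_{\mu}$ for which $\omega_{\mu}$ and $-i\,\omega_{\mu}'$ are strictly positive. Let $q_{\kappa} = \wp(\,\cdot\,; \omega_{\kappa}, \tfrac{1}{2}\omega_{\kappa}')$ be the Weierstrass $\wp$ function with fundamental half-periods $\omega_{\kappa}$ and $\tfrac12 \omega_{\kappa}'$. Then for all $z \in \mathbb{C}$, $$q_{\kappa}(z) = -2\, p_{\lambda}(\sqrt{2}\, i\, z).$$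
   Context: $\wp(\,\cdot\,; g_2, g_3)$ denotes the Weierstrass elliptic function with invariants $g_2, g_3$, and $\wp(\,\cdot\,; \omega, \omega')$ denotes the Weierstrass elliptic function whose period lattice is generated by $2\omega$ and $2\omega'$. *)

(* Defs.v *)
From Stdlib Require Export Reals ZArith List ClassicalEpsilon.
From Coquelicot Require Export Coquelicot.

Open Scope C_scope.

(** Unordered sums: limits of the finite partial sums along the directed
    family of finite subsets of [D], which are represented by
    duplicate-free lists. *)

Definition finite_subsets {T : Type} (D : T -> Prop)
    (P : list T -> Prop) : Prop :=
  exists A : list T, List.Forall D A /\
    forall B : list T, NoDup B -> List.Forall D B -> incl A B -> P B.

Global Instance finite_subsets_filter {T : Type} (D : T -> Prop) :
  ProperFilter (finite_subsets D).
Proof.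
assert (dec : forall x y : T, {x = y} + {x <> y})
  by (intros x y; apply excluded_middle_informative).
constructor.
- intros P [A [HA HP]]; exists (nodup dec A); apply HP.
  + apply NoDup_nodup.
  + rewrite Forall_forall in *; intros x Hx; apply HA.
    now apply nodup_In in Hx.
  + intros x Hx; now apply nodup_In.
- constructor.
  + exists nil; split; [constructor | trivial].
  + intros P Q [A [HA HP]] [B [HB HQ]]; exists (A ++ B)%list; split.
    * now apply Forall_app.
    * intros E HE HD Hi; split.
      -- apply HP; auto; intros x Hx; apply Hi, in_or_app; now left.
      -- apply HQ; auto; intros x Hx; apply Hi, in_or_app; now right.
  + intros P Q HPQ [A [HA HP]]; exists A; split; auto.
Qed.

Definition list_sum (f : C -> C) (A : list C) : C :=
  fold_right (fun w s => f w + s) 0 A.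

Definition unordered_sum (D : C -> Prop) (f : C -> C) : C :=
  @iota C_CompleteNormedModule
    (fun l => filterlim (list_sum f) (finite_subsets D) (locally l)).

Definition lattice (w1 w2 : C) (w : C) : Prop :=
  exists m n : Z, w = RtoC (IZR m) * w1 + RtoC (IZR n) * w2.

Definition R_independent (w1 w2 : C) : Prop :=
  forall a b : R, RtoC a * w1 + RtoC b * w2 = 0 -> a = 0%R /\ b = 0%R.

Definition nonzero_points (L : C -> Prop) (w : C) : Prop := L w /\ w <> 0.

(** Meromorphic functions are modelled with values in the Riemann sphere
    [option C], where [None] is the point at infinity (the value at a
    pole). *)

Definition wp_lattice (L : C -> Prop) (z : C) : option C :=
  if excluded_middle_informative (L z) then None
  else Some (/ z ^ 2 +
             unordered_sum (nonzero_points L)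
               (fun w => / (z - w) ^ 2 - / w ^ 2)).

Definition invariant_g2 (L : C -> Prop) : C :=
  60 * unordered_sum (nonzero_points L) (fun w => / w ^ 4).

Definition invariant_g3 (L : C -> Prop) : C :=
  140 * unordered_sum (nonzero_points L) (fun w => / w ^ 6).

(** The arguments are half-periods. *)
Definition wp_half_periods (om om' : C) : C -> option C :=
  wp_lattice (lattice (2 * om) (2 * om')).

(** [p] is the Weierstrass function with invariants [g2] and [g3].  The
    invariants determine the lattice, hence [p]; a lattice exists exactly
    when [g2 ^ 3 <> 27 * g3 ^ 2]. *)
Definition is_wp_invariants (g2 g3 : C) (p : C -> option C) : Prop :=
  exists w1 w2 : C,
    R_independent w1 w2 /\
    invariant_g2 (lattice w1 w2) = g2 /\
    invariant_g3 (lattice w1 w2) = g3 /\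
    forall z : C, p z = wp_lattice (lattice w1 w2) z.

Definition is_period (p : C -> option C) (w : C) : Prop :=
  forall z : C, p (z + w) = p z.

Definition fundamental_periods (p : C -> option C) (w1 w2 : C) : Prop :=
  R_independent w1 w2 /\ forall w : C, is_period p w <-> lattice w1 w2 w.

Definition strictly_positive (z : C) : Prop := Im z = 0%R /\ (0 < Re z)%R.

(** Multiplication by [c] on the Riemann sphere, for [c <> 0]. *)
Definition sphere_scale (c : C) : option C -> option C := option_map (Cmult c).

(* Main.v *)
(* Write [wp] for the Weierstrass function of [L = <2 omega, 2 omega'>] and
   [eis n z] for the sum of [(z - w) ^ -n] over [L].  The lattice of [q_kappa]
   is [L] together with its translate by [omega'], so its invariants exceed
   those of [L] by [60 eis 4 omega'] and [140 eis 6 omega'], which by the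
   differential equation of [wp] are polynomials in [e = wp omega'].  On the
   imaginary axis [wp] is real, comes from [-oo] and meets no root of the cubic
   before reaching [e], so [e] is the least root [-1/3].  The resulting invariants are those of the
   lattice of [p_lambda] divided by [sqrt 2 i], and a lattice is determined by
   its invariants: the doubling formula, a contraction near infinity, forces
   two Weierstrass functions with the same invariants to agree near [0], and
   then propagates their equality to the whole plane.

   An elliptic function that extends continuously across its lattice is
   constant because its means over circles do not depend on the radius. *)

From Stdlib Require Import Ranalysis5 Lra Lia Permutation FunctionalExtensionality PropExtensionality.
Require Import Defs.

(** * Unordered sums of complex numbers *)

(** Every identity between elliptic functions is obtained in one way: the candidate is periodic,
    differentiable off the lattice and has a limit at 0 read from Laurent expansions, so it equals
    that limit. Circle means suit this scheme because at the lattice points they ask for continuity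
    only. Comparing two lattices through Laurent coefficients would need the whole recursion between
    them. The doubling formula needs only [z^-2] and a bounded remainder at 0, because doubling acts
    near infinity like [x / 4]. It comes from regrouping the sum for [wp] over the [v] with [2 * v]
    in the lattice, followed by partial fractions in the three half-period values. These must be
    distinct, which is where a nonzero discriminant enters; for the invariants at hand it is
    [mu ^ 4 * (1 - mu ^ 2)]. The value [-1/3] is forced because the cubic of [p_kappa] has the roots
    [-1/3], [1/6 + lambda/2] and [1/6 - lambda/2], and [lambda < 1] puts [-1/3] below the other
    two. *)

Definition rsum {T : Type} (f : T -> R) (A : list T) : R :=
  fold_right (fun w s => f w + s)%R 0%R A.

Lemma rsum_app {T : Type} (f : T -> R) (A B : list T) :
  (rsum f (A ++ B) = rsum f A + rsum f B)%R.
Proof. induction A as [|a A IH]; simpl; [lra | rewrite IH; lra]. Qed.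

Lemma rsum_perm {T : Type} (f : T -> R) (A B : list T) :
  Permutation A B -> rsum f A = rsum f B.
Proof. induction 1; simpl; lra. Qed.

Lemma rsum_scal {T : Type} (f : T -> R) (k : R) (A : list T) :
  rsum (fun w => k * f w)%R A = (k * rsum f A)%R.
Proof. induction A as [|a A IH]; simpl; [lra | rewrite IH; lra]. Qed.

Lemma rsum_nonneg {T : Type} (f : T -> R) (A : list T) :
  (forall w, 0 <= f w)%R -> (0 <= rsum f A)%R.
Proof. intros H; induction A as [|a A IH]; simpl; [lra | specialize (H a); lra]. Qed.

Lemma rsum_le {T : Type} (D : T -> Prop) (f g : T -> R) (A : list T) :
  (forall w, D w -> f w <= g w)%R -> List.Forall D A -> (rsum f A <= rsum g A)%R.
Proof.
intros H HA; induction HA as [|a A Ha HA IH]; simpl; [lra | specialize (H a Ha); lra].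
Qed.

Lemma rsum_incl {T : Type} (f : T -> R) (A B : list T) :
  (forall w, 0 <= f w)%R -> NoDup A -> incl A B -> (rsum f A <= rsum f B)%R.
Proof.
intros Hf HA; revert B; induction HA as [|a A Ha HA IH]; intros B HB; simpl.
- now apply rsum_nonneg.
- destruct (in_split a B (HB a (or_introl eq_refl))) as [B1 [B2 ->]].
  rewrite (rsum_perm f _ _ (Permutation_sym (Permutation_middle B1 B2 a))); simpl.
  apply Rplus_le_compat_l, IH.
  intros x Hx; specialize (HB x (or_intror Hx)).
  apply in_app_or in HB; apply in_or_app.
  destruct HB as [HB | [-> | HB]]; auto; contradiction.
Qed.

Lemma rsum_map {S T : Type} (g : S -> T) (f : T -> R) (A : list S) :
  rsum f (map g A) = rsum (fun s => f (g s)) A.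
Proof. induction A as [|a A IH]; simpl; [easy | now rewrite IH]. Qed.

Lemma rsum_list_prod {S T : Type} (f : S -> R) (g : T -> R) A B :
  rsum (fun p => f (fst p) * g (snd p))%R (list_prod A B) = (rsum f A * rsum g B)%R.
Proof.
induction A as [|a A IH]; simpl; [lra|].
rewrite rsum_app, IH, rsum_map; simpl; rewrite (rsum_scal g (f a)); lra.
Qed.

Lemma list_sum_app (f : C -> C) (A B : list C) :
  list_sum f (A ++ B) = list_sum f A + list_sum f B.
Proof. induction A as [|a A IH]; simpl; [|rewrite IH]; ring. Qed.

Lemma list_sum_perm (f : C -> C) (A B : list C) :
  Permutation A B -> list_sum f A = list_sum f B.
Proof. induction 1; simpl; try congruence; ring. Qed.

Lemma list_sum_mod_le (f : C -> C) (A : list C) :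
  (Cmod (list_sum f A) <= rsum (fun w => Cmod (f w)) A)%R.
Proof.
induction A as [|a A IH]; simpl.
- rewrite Cmod_0; lra.
- eapply Rle_trans; [apply Cmod_triangle|]; lra.
Qed.

Lemma list_sum_ext (D : C -> Prop) (f g : C -> C) (A : list C) :
  (forall w, D w -> f w = g w) -> List.Forall D A -> list_sum f A = list_sum g A.
Proof. intros H; induction 1 as [|a A Ha HA IH]; simpl; [easy | now rewrite H, IH]. Qed.

Lemma list_sum_map (g : C -> C) (f : C -> C) (A : list C) :
  list_sum f (map g A) = list_sum (fun s => f (g s)) A.
Proof. induction A as [|a A IH]; simpl; [easy | now rewrite IH]. Qed.

Lemma incl_perm_split (A B : list C) :
  NoDup A -> NoDup B -> incl A B ->
  exists E, Permutation B (A ++ E) /\ NoDup E.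
Proof.
intros HA HB Hi.
set (p := fun x => if in_dec Ceq_dec x A then false else true).
exists (filter p B); split; [|now apply NoDup_filter].
apply NoDup_Permutation; auto.
- apply NoDup_app; auto; [now apply NoDup_filter|].
  intros x Hx Hx'; apply filter_In in Hx'; destruct Hx' as [_ Hp].
  unfold p in Hp; destruct (in_dec Ceq_dec x A); [discriminate | contradiction].
- intros x; split; intros Hx.
  + apply in_or_app; destruct (in_dec Ceq_dec x A) as [h|h]; [now left | right].
    apply filter_In; split; auto; unfold p.
    now destruct (in_dec Ceq_dec x A).
  + apply in_app_or in Hx; destruct Hx as [Hx|Hx]; [now apply Hi|].
    now apply filter_In in Hx.
Qed.

(** The limit behind [unordered_sum] as a relation with an explicit epsilon. Sums are transformed at
    this level and identified with [unordered_sum] by [unordered_sum_eq] once they are known to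
    converge. *)
Definition has_sum (D : C -> Prop) (f : C -> C) (l : C) : Prop :=
  forall eps : R, (0 < eps)%R -> exists A, List.Forall D A /\
    forall B, NoDup B -> List.Forall D B -> incl A B ->
      (Cmod (list_sum f B - l) < eps)%R.

Definition sum_bound (D : C -> Prop) (m : C -> R) (M : R) : Prop :=
  forall A, NoDup A -> List.Forall D A -> (rsum m A <= M)%R.

Lemma has_sum_nodup (D : C -> Prop) (f : C -> C) (l : C) (eps : R) :
  has_sum D f l -> (0 < eps)%R -> exists A, NoDup A /\ List.Forall D A /\
    forall B, NoDup B -> List.Forall D B -> incl A B ->
      (Cmod (list_sum f B - l) < eps)%R.
Proof.
intros H He; destruct (H eps He) as [A [HA HB]].
exists (nodup Ceq_dec A); split; [apply NoDup_nodup|split].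
- rewrite Forall_forall in *; intros x Hx; apply HA; now apply nodup_In in Hx.
- intros B h1 h2 h3; apply HB; auto; intros x Hx; apply h3; now apply nodup_In.
Qed.

Lemma has_sum_unique (D : C -> Prop) (f : C -> C) (l l' : C) :
  has_sum D f l -> has_sum D f l' -> l = l'.
Proof.
intros H H'; apply NNPP; intros Hn.
assert (Hp : (0 < Cmod (l - l'))%R) by (apply Cmod_gt_0, Cminus_eq_contra, Hn).
destruct (has_sum_nodup _ _ _ (Cmod (l - l') / 2) H ltac:(lra)) as [A [NA [HA HB]]].
destruct (has_sum_nodup _ _ _ (Cmod (l - l') / 2) H' ltac:(lra)) as [A' [NA' [HA' HB']]].
set (E := nodup Ceq_dec (A ++ A')).
assert (HE : List.Forall D E).
{ rewrite Forall_forall in *; intros x Hx; apply nodup_In, in_app_or in Hx.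
  destruct Hx; auto. }
specialize (HB E (NoDup_nodup _ _) HE).
specialize (HB' E (NoDup_nodup _ _) HE).
assert (h1 : (Cmod (list_sum f E - l) < Cmod (l - l') / 2)%R).
{ apply HB; intros x Hx; apply nodup_In, in_or_app; auto. }
assert (h2 : (Cmod (list_sum f E - l') < Cmod (l - l') / 2)%R).
{ apply HB'; intros x Hx; apply nodup_In, in_or_app; auto. }
assert (h3 := Cmod_triangle (list_sum f E - l') (- (list_sum f E - l))).
rewrite Cmod_opp in h3.
replace (list_sum f E - l' + - (list_sum f E - l)) with (l - l') in h3 by ring.
lra.
Qed.

Lemma Cmod_sqrt2_bound (z : C) (eps : R) :
  (Rabs (Re z) < eps / 2)%R -> (Rabs (Im z) < eps / 2)%R -> (Cmod z < eps)%R.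
Proof.
intros h1 h2.
assert (h : (Cmod z <= Rabs (Re z) + Rabs (Im z))%R).
{ replace z with (RtoC (Re z) + Ci * RtoC (Im z)) at 1.
  - eapply Rle_trans; [apply Cmod_triangle|].
    rewrite Cmod_mult, Cmod_Ci, !Cmod_R; lra.
  - destruct z as [x y]; unfold Ci, RtoC, Cmult, Cplus; simpl; f_equal; ring. }
lra.
Qed.

Lemma im_le_Cmod (z : C) : (Rabs (Im z) <= Cmod z)%R.
Proof.
eapply Rle_trans; [apply Rmax_r | apply (Rmax_Cmod z)].
Qed.

Lemma unordered_sum_eq (D : C -> Prop) (f : C -> C) (l : C) :
  has_sum D f l -> unordered_sum D f = l.
Proof.
intros H; unfold unordered_sum.
apply (@iota_filterlim_locally C_AbsRing C_CompleteNormedModule (list C)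
  (finite_subsets D) (Proper_StrongProper _ (finite_subsets_filter D))).
intros P [eps HP].
destruct (H eps (cond_pos eps)) as [A [HA HB]].
exists A; split; auto; intros B h1 h2 h3; apply HP.
specialize (HB B h1 h2 h3).
split.
- eapply Rle_lt_trans; [|apply HB]; apply (re_le_Cmod (list_sum f B - l)).
- eapply Rle_lt_trans; [|apply HB]; apply (im_le_Cmod (list_sum f B - l)).
Qed.

(** Let [S] be the supremum of the finite sums of moduli. A finite set whose sum of moduli exceeds
    [S - eps] leaves less than [eps] for any disjoint finite set, so the partial sums are Cauchy
    along the filter and completeness applies. *)
Lemma has_sum_exists (D : C -> Prop) (f : C -> C) (M : R) :
  sum_bound D (fun w => Cmod (f w)) M -> exists l, has_sum D f l.
Proof.
intros HM.
set (E := fun s : R => exists A, NoDup A /\ List.Forall D A /\ s = rsum (fun w => Cmod (f w)) A).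
destruct (completeness E) as [S [Sub Slub]].
{ exists M; intros s [A [h1 [h2 ->]]]; now apply HM. }
{ exists 0%R, nil; repeat split; constructor. }
assert (Hcau : forall eps : R, (0 < eps)%R -> exists A, NoDup A /\ List.Forall D A /\
  forall B, NoDup B -> List.Forall D B -> incl A B ->
  (Cmod (list_sum f B - list_sum f A) < eps)%R).
{ intros eps He; apply NNPP; intros Hn.
  assert (Hb : is_upper_bound E (S - eps)%R).
  { intros s [A [h1 [h2 ->]]]; apply Rnot_lt_le; intros Hlt; apply Hn.
    exists A; split; [auto | split; [auto|]]; intros B k1 k2 k3.
    destruct (incl_perm_split A B h1 k1 k3) as [F [HF NF]].
    rewrite (list_sum_perm f _ _ HF), list_sum_app.
    replace (list_sum f A + list_sum f F - list_sum f A) with (list_sum f F) by ring.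
    eapply Rle_lt_trans; [apply list_sum_mod_le|].
    assert (HB : (rsum (fun w => Cmod (f w)) B <= S)%R) by (apply Sub; now exists B).
    rewrite (rsum_perm _ _ _ HF), rsum_app in HB; lra. }
  specialize (Slub _ Hb); lra. }
assert (Hex : exists y : C_UniformSpace, filterlim (list_sum f) (finite_subsets D) (locally y)).
{ apply (proj1 (@filterlim_locally_cauchy (list C) C_CompleteNormedModule (finite_subsets D) _ (list_sum f))).
  intros eps.
  destruct (Hcau (eps / 2)%R) as [A [h1 [h2 h3]]]; [destruct eps; simpl; lra|].
  exists (fun B => NoDup B /\ List.Forall D B /\ incl A B); split.
  - exists A; split; auto.
  - intros u v [u1 [u2 u3]] [v1 [v2 v3]].
    assert (hu := h3 u u1 u2 u3); assert (hv := h3 v v1 v2 v3).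
    assert (h : (Cmod (list_sum f v - list_sum f u) < eps)%R).
    { replace (list_sum f v - list_sum f u) with
        (list_sum f v - list_sum f A + - (list_sum f u - list_sum f A)) by ring.
      eapply Rle_lt_trans; [apply Cmod_triangle|]; rewrite Cmod_opp; lra. }
    split; (eapply Rle_lt_trans; [|apply h]);
      [apply (re_le_Cmod (list_sum f v - list_sum f u)) | apply (im_le_Cmod (list_sum f v - list_sum f u))]. }
destruct Hex as [y Hy]; exists y; intros eps He.
assert (He2 : (0 < eps / 2)%R) by lra.
assert (Hl := Hy (ball (y : C_UniformSpace) (mkposreal _ He2)) (locally_ball _ _)).
destruct Hl as [A [HA HB]]; exists A; split; auto.
intros B h1 h2 h3; destruct (HB B h1 h2 h3) as [k1 k2].
apply Cmod_sqrt2_bound; [exact k1 | exact k2].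
Qed.

Lemma has_sum_ext (D : C -> Prop) (f g : C -> C) (l : C) :
  (forall w, D w -> f w = g w) -> has_sum D f l -> has_sum D g l.
Proof.
intros H Hf eps He; destruct (Hf eps He) as [A [HA HB]]; exists A; split; auto.
intros B h1 h2 h3; rewrite <- (list_sum_ext D f g) by auto; now apply HB.
Qed.

Lemma has_sum_plus (D : C -> Prop) (f g : C -> C) (l k : C) :
  has_sum D f l -> has_sum D g k -> has_sum D (fun w => f w + g w) (l + k).
Proof.
intros Hf Hg eps He.
destruct (Hf (eps / 2)%R ltac:(lra)) as [A [HA HB]].
destruct (Hg (eps / 2)%R ltac:(lra)) as [A' [HA' HB']].
exists (A ++ A')%list; split; [now apply Forall_app|].
intros B h1 h2 h3.
replace (list_sum (fun w => f w + g w) B) with (list_sum f B + list_sum g B).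
2: { clear; induction B as [|b B IH]; simpl; [|rewrite <- IH]; ring. }
replace (list_sum f B + list_sum g B - (l + k)) with
  ((list_sum f B - l) + (list_sum g B - k)) by ring.
eapply Rle_lt_trans; [apply Cmod_triangle|].
assert (k1 := HB B h1 h2 (fun x Hx => h3 x (in_or_app _ _ _ (or_introl Hx)))).
assert (k2 := HB' B h1 h2 (fun x Hx => h3 x (in_or_app _ _ _ (or_intror Hx)))).
lra.
Qed.

Lemma has_sum_scal (D : C -> Prop) (f : C -> C) (c l : C) :
  has_sum D f l -> has_sum D (fun w => c * f w) (c * l).
Proof.
intros Hf eps He.
assert (Hc := Cmod_ge_0 c).
destruct (Hf (eps / (Cmod c + 1))%R) as [A [HA HB]].
{ apply Rdiv_lt_0_compat; lra. }
exists A; split; auto; intros B h1 h2 h3; specialize (HB B h1 h2 h3).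
replace (list_sum (fun w => c * f w) B) with (c * list_sum f B).
2: { clear; induction B as [|b B IH]; simpl; [|rewrite <- IH]; ring. }
replace (c * list_sum f B - c * l) with (c * (list_sum f B - l)) by ring.
rewrite Cmod_mult.
assert (h := Cmod_ge_0 (list_sum f B - l)).
apply Rle_lt_trans with ((Cmod c + 1) * Cmod (list_sum f B - l))%R; [nra|].
apply Rmult_lt_reg_l with (/ (Cmod c + 1))%R; [apply Rinv_0_lt_compat; lra|].
field_simplify; [|lra|lra].
unfold Rdiv in *; rewrite (Rmult_comm eps) in HB |- *; lra.
Qed.

Lemma has_sum_minus (D : C -> Prop) (f g : C -> C) (l k : C) :
  has_sum D f l -> has_sum D g k -> has_sum D (fun w => f w - g w) (l - k).
Proof.
intros Hf Hg; apply has_sum_ext with (fun w => f w + (-1) * g w).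
- intros w _; ring.
- replace (l - k) with (l + (-1) * k) by ring.
  now apply has_sum_plus, has_sum_scal.
Qed.

Lemma has_sum_reindex (D E : C -> Prop) (phi psi : C -> C) (f : C -> C) (l : C) :
  (forall w, D w -> E (phi w)) -> (forall v, E v -> D (psi v)) ->
  (forall w, D w -> psi (phi w) = w) -> (forall v, E v -> phi (psi v) = v) ->
  has_sum E f l -> has_sum D (fun w => f (phi w)) l.
Proof.
intros HDE HED Hl Hr Hf eps He.
destruct (Hf eps He) as [A [HA HB]].
exists (map psi A); split.
- rewrite Forall_forall in *; intros x Hx; apply in_map_iff in Hx.
  destruct Hx as [v [<- Hv]]; auto.
- intros B h1 h2 h3.
  rewrite <- (list_sum_map phi f B); apply HB.
  + assert (Hinj : forall x y, In x B -> In y B -> phi x = phi y -> x = y).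
    { intros x y Hx Hy Hxy; rewrite Forall_forall in h2.
      rewrite <- (Hl x), <- (Hl y), Hxy; auto. }
    clear - h1 Hinj; induction h1 as [|b B Hb HB IH]; simpl; constructor.
    * intros Hin; apply in_map_iff in Hin; destruct Hin as [y [Hy Hin]].
      apply Hb; rewrite (Hinj b y); simpl; auto.
    * apply IH; intros x y Hx Hy; apply Hinj; simpl; auto.
  + rewrite Forall_forall in *; intros x Hx; apply in_map_iff in Hx.
    destruct Hx as [w [<- Hw]]; auto.
  + intros v Hv; apply in_map_iff; exists (psi v); split.
    * apply Hr; rewrite Forall_forall in HA; auto.
    * apply h3, in_map, Hv.
Qed.

Lemma filter_split_perm {T : Type} (p : T -> bool) (B : list T) :
  Permutation B (filter p B ++ filter (fun x => negb (p x)) B).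
Proof.
induction B as [|b B IH]; simpl; [constructor|].
destruct (p b); simpl.
- now constructor.
- now apply Permutation_cons_app.
Qed.

Lemma has_sum_union (D D1 D2 : C -> Prop) (f : C -> C) (l1 l2 : C) :
  (forall w, D w <-> D1 w \/ D2 w) -> (forall w, D1 w -> D2 w -> False) ->
  has_sum D1 f l1 -> has_sum D2 f l2 -> has_sum D f (l1 + l2).
Proof.
intros HD Hdis H1 H2 eps He.
destruct (H1 (eps / 2)%R ltac:(lra)) as [A1 [HA1 HB1]].
destruct (H2 (eps / 2)%R ltac:(lra)) as [A2 [HA2 HB2]].
exists (A1 ++ A2)%list; split.
{ apply Forall_app; rewrite !Forall_forall in *; split; intros x Hx; apply HD; auto. }
intros B h1 h2 h3.
set (p := fun x => if excluded_middle_informative (D1 x) then true else false).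
rewrite (list_sum_perm f _ _ (filter_split_perm p B)), list_sum_app.
assert (k1 : (Cmod (list_sum f (filter p B) - l1) < eps / 2)%R).
{ apply HB1; [now apply NoDup_filter| |].
  - rewrite Forall_forall; intros x Hx; apply filter_In in Hx; destruct Hx as [_ Hx].
    unfold p in Hx; now destruct (excluded_middle_informative (D1 x)).
  - intros x Hx; apply filter_In; split; [apply h3, in_or_app; auto|].
    unfold p; destruct (excluded_middle_informative (D1 x)) as [|n]; auto.
    rewrite Forall_forall in HA1; elim n; auto. }
assert (k2 : (Cmod (list_sum f (filter (fun x => negb (p x)) B) - l2) < eps / 2)%R).
{ apply HB2; [now apply NoDup_filter| |].
  - rewrite Forall_forall in *; intros x Hx; apply filter_In in Hx; destruct Hx as [Hi Hx].
    unfold p in Hx; destruct (excluded_middle_informative (D1 x)); [discriminate|].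
    destruct (proj1 (HD x) (h2 x Hi)); [contradiction | auto].
  - intros x Hx; apply filter_In; split; [apply h3, in_or_app; auto|].
    unfold p; destruct (excluded_middle_informative (D1 x)) as [n|]; auto.
    rewrite Forall_forall in HA2; elim (Hdis x); auto. }
set (x := list_sum f (filter p B)) in *.
set (y := list_sum f (filter (fun x => negb (p x)) B)) in *.
replace (x + y - (l1 + l2)) with ((x - l1) + (y - l2)) by ring.
eapply Rle_lt_trans; [apply Cmod_triangle|]; lra.
Qed.

Lemma has_sum_bound (D : C -> Prop) (f : C -> C) (m : C -> R) (l : C) (K M : R) :
  (0 <= K)%R -> sum_bound D m M -> (forall w, D w -> Cmod (f w) <= K * m w)%R ->
  has_sum D f l -> (Cmod l <= K * M)%R.
Proof.
intros HK Hm Hf H; apply Rnot_lt_le; intros Hlt.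
destruct (has_sum_nodup _ _ _ (Cmod l - K * M)%R H ltac:(lra)) as [A [NA [HA HB]]].
specialize (HB A NA HA (incl_refl A)).
assert (h1 := list_sum_mod_le f A).
assert (h2 := rsum_le D _ (fun w => K * m w)%R A Hf HA); rewrite rsum_scal in h2.
assert (h3 := Rmult_le_compat_l K _ _ HK (Hm A NA HA)).
assert (h4 := Cmod_triangle (list_sum f A) (- (list_sum f A - l))).
rewrite Cmod_opp in h4.
replace (list_sum f A + - (list_sum f A - l)) with l in h4 by ring.
lra.
Qed.

Lemma has_sum_dominated (D : C -> Prop) (f : C -> C) (m : C -> R) (K M : R) :
  (0 <= K)%R -> sum_bound D m M -> (forall w, D w -> Cmod (f w) <= K * m w)%R ->
  exists l, has_sum D f l.
Proof.
intros HK Hm Hf; apply has_sum_exists with (K * M)%R; intros A h1 h2.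
eapply Rle_trans; [apply (rsum_le D _ (fun w => K * m w)%R A Hf h2)|].
rewrite rsum_scal; apply Rmult_le_compat_l; auto.
Qed.

(** * Lattices *)

Lemma set_ext (P Q : C -> Prop) : (forall z, P z <-> Q z) -> P = Q.
Proof.
intros H; apply functional_extensionality; intros z.
apply propositional_extensionality, H.
Qed.

Lemma Ceq_ReIm (z w : C) : Re z = Re w -> Im z = Im w -> z = w.
Proof. destruct z, w; simpl; congruence. Qed.

(** The signed area of the parallelogram on [w1] and [w2]; Cramer's rule with it gives the real
    coordinates in a basis. *)
Definition cdet (w1 w2 : C) : R := (Re w1 * Im w2 - Im w1 * Re w2)%R.

Lemma cdet_neq0 (w1 w2 : C) : R_independent w1 w2 -> cdet w1 w2 <> 0%R.
Proof.
intros H Hd; unfold cdet, Re, Im in Hd.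
(* A zero determinant makes [(Re w2, - Re w1)] and [(Im w2, - Im w1)] linear relations. Independence
   then kills all four coordinates, and [(1, 0)] becomes a relation too. *)
destruct (H (Re w2) (- Re w1)%R) as [h1 h2].
{ apply Ceq_ReIm; unfold Re, Im; simpl; lra. }
destruct (H (Im w2) (- Im w1)%R) as [h3 h4].
{ apply Ceq_ReIm; unfold Re, Im; simpl; lra. }
destruct (H 1%R 0%R) as [h5 h6]; [|lra].
apply Ceq_ReIm; unfold Re, Im in *; simpl; lra.
Qed.

Lemma cdet_bound (z w : C) : (Rabs (cdet z w) <= 2 * Cmod z * Cmod w)%R.
Proof.
unfold cdet.
assert (h1 := re_le_Cmod z); assert (h2 := im_le_Cmod z).
assert (h3 := re_le_Cmod w); assert (h4 := im_le_Cmod w).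
eapply Rle_trans; [apply Rabs_triang|]; rewrite Rabs_Ropp, !Rabs_mult.
assert (Rabs (Re z) * Rabs (Im w) <= Cmod z * Cmod w)%R
  by (apply Rmult_le_compat; auto using Rabs_pos).
assert (Rabs (Im z) * Rabs (Re w) <= Cmod z * Cmod w)%R
  by (apply Rmult_le_compat; auto using Rabs_pos).
lra.
Qed.

Lemma coords_exist (w1 w2 z : C) : R_independent w1 w2 ->
  exists a b : R, z = a * w1 + b * w2.
Proof.
intros H; apply cdet_neq0 in H.
exists (cdet z w2 / cdet w1 w2)%R, (cdet w1 z / cdet w1 w2)%R.
unfold cdet in *; apply Ceq_ReIm; simpl; unfold Re, Im in *; field; lra.
Qed.

(** By Cramer's rule [a * d] and [b * d] are determinants involving the point, and a determinant is
    bounded by the product of the moduli. Discreteness of the lattice, its separation from other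
    points and its summability all rest on this. *)
Lemma coords_bound (w1 w2 : C) : R_independent w1 w2 ->
  exists c : R, (0 < c)%R /\
    forall a b : R, (c * (Rabs a + Rabs b) <= Cmod (a * w1 + b * w2))%R.
Proof.
intros H; apply cdet_neq0 in H.
set (d := cdet w1 w2) in *.
assert (Hd : (0 < Rabs d)%R) by now apply Rabs_pos_lt.
assert (P1 := Cmod_ge_0 w1); assert (P2 := Cmod_ge_0 w2).
set (s := (2 * Cmod w1 + 2 * Cmod w2 + 1)%R).
exists (Rabs d / s)%R; split; [apply Rdiv_lt_0_compat; unfold s; lra|].
intros a b; set (z := a * w1 + b * w2).
assert (h1 := cdet_bound z w2); assert (h2 := cdet_bound w1 z).
replace (cdet z w2) with (a * d)%R in h1 by (unfold z, d, cdet, Re, Im; simpl; ring).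
replace (cdet w1 z) with (b * d)%R in h2 by (unfold z, d, cdet, Re, Im; simpl; ring).
rewrite Rabs_mult in h1, h2.
assert (hz := Cmod_ge_0 z).
apply Rmult_le_reg_l with s; [unfold s; lra|].
replace (s * (Rabs d / s * (Rabs a + Rabs b)))%R with (Rabs a * Rabs d + Rabs b * Rabs d)%R
  by (field; unfold s; lra).
unfold s; nra.
Qed.

Lemma R_independent_coords (w1 w2 : C) (a b a' b' : R) : R_independent w1 w2 ->
  a * w1 + b * w2 = a' * w1 + b' * w2 -> a = a' /\ b = b'.
Proof.
intros H E; destruct (H (a - a')%R (b - b')%R) as [h1 h2]; [|split; lra].
rewrite !RtoC_minus.
replace ((a - a') * w1 + (b - b') * w2) with ((a * w1 + b * w2) - (a' * w1 + b' * w2)) by ring.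
rewrite E; ring.
Qed.

Definition is_lattice (L : C -> Prop) : Prop :=
  exists w1 w2, R_independent w1 w2 /\ L = lattice w1 w2.

Lemma lat_0 (L : C -> Prop) : is_lattice L -> L 0.
Proof. intros [w1 [w2 [_ ->]]]; exists 0%Z, 0%Z; ring. Qed.

Lemma lat_add (L : C -> Prop) (u v : C) : is_lattice L -> L u -> L v -> L (u + v).
Proof.
intros [w1 [w2 [_ ->]]] [m [n ->]] [m' [n' ->]]; exists (m + m')%Z, (n + n')%Z.
rewrite !plus_IZR, !RtoC_plus; ring.
Qed.

Lemma lat_opp (L : C -> Prop) (u : C) : is_lattice L -> L u -> L (- u).
Proof.
intros [w1 [w2 [_ ->]]] [m [n ->]]; exists (- m)%Z, (- n)%Z.
rewrite !opp_IZR, !RtoC_opp; ring.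
Qed.

Lemma lat_sub (L : C -> Prop) (u v : C) : is_lattice L -> L u -> L v -> L (u - v).
Proof. intros H Hu Hv; unfold Cminus; apply lat_add; auto; now apply lat_opp. Qed.

Lemma lat_add_iff (L : C -> Prop) (u v : C) : is_lattice L -> L v -> (L (u + v) <-> L u).
Proof.
intros H Hv; split; intros Hu; [|now apply lat_add].
replace u with (u + v - v) by ring; now apply lat_sub.
Qed.

Lemma lat_opp_iff (L : C -> Prop) (u : C) : is_lattice L -> (L (- u) <-> L u).
Proof.
intros H; split; intros Hu; [|now apply lat_opp].
replace u with (- - u) by ring; now apply lat_opp.
Qed.

Lemma lat_disc (L : C -> Prop) : is_lattice L ->
  exists d : R, (0 < d)%R /\ forall w, L w -> w <> 0 -> (d <= Cmod w)%R.
Proof.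
intros [w1 [w2 [Hi ->]]]; destruct (coords_bound _ _ Hi) as [c [Hc Hb]].
exists c; split; auto; intros w [m [n ->]] Hw.
eapply Rle_trans; [|apply Hb].
assert (h : (1 <= Rabs (IZR m) + Rabs (IZR n))%R).
{ rewrite <- !abs_IZR, <- plus_IZR; apply IZR_le.
  destruct (Z.eq_dec m 0) as [->|]; [destruct (Z.eq_dec n 0) as [->|]|]; try lia.
  elim Hw; ring. }
nra.
Qed.

Lemma dist_int (a : R) : (forall m : Z, a <> IZR m) ->
  exists e : R, (0 < e)%R /\ forall m : Z, (e <= Rabs (a - IZR m))%R.
Proof.
intros H; destruct (archimed a) as [h1 h2].
set (k := up a) in *.
assert (h3 : (a <> IZR k - 1)%R) by (rewrite <- minus_IZR; apply H).
exists (Rmin (IZR k - a) (a - (IZR k - 1))); split; [apply Rmin_glb_lt; lra|].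
intros m; destruct (Z_le_gt_dec k m) as [Hm|Hm].
- apply IZR_le in Hm; rewrite Rabs_left1 by lra.
  eapply Rle_trans; [apply Rmin_l|]; lra.
- assert (Hm' : (m <= k - 1)%Z) by lia; apply IZR_le in Hm'; rewrite minus_IZR in Hm'.
  rewrite Rabs_right by lra; eapply Rle_trans; [apply Rmin_r|]; lra.
Qed.

Lemma lat_sep (L : C -> Prop) (z : C) : is_lattice L -> ~ L z ->
  exists e : R, (0 < e)%R /\ forall w, L w -> (e <= Cmod (z - w))%R.
Proof.
intros [w1 [w2 [Hi ->]]] Hz; destruct (coords_bound _ _ Hi) as [c [Hc Hb]].
destruct (coords_exist w1 w2 z Hi) as [a [b ->]].
assert (Hk : forall m n : Z, (c * (Rabs (a - IZR m) + Rabs (b - IZR n)) <=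
  Cmod (a * w1 + b * w2 - (IZR m * w1 + IZR n * w2)))%R).
{ intros m n; eapply Rle_trans; [apply Hb|]; rewrite !RtoC_minus.
  right; f_equal; ring. }
destruct (classic (exists m, a = IZR m)) as [[m0 Ha]|Ha].
- assert (Hb' : forall n, b <> IZR n).
  { intros n Hn; apply Hz; exists m0, n; now rewrite Ha, Hn. }
  destruct (dist_int b Hb') as [e [He Hd]]; exists (c * e)%R; split; [nra|].
  intros w [m [n ->]]; eapply Rle_trans; [|apply Hk].
  specialize (Hd n); assert (h := Rabs_pos (a - IZR m)); nra.
- destruct (dist_int a) as [e [He Hd]].
  { intros m Hm; apply Ha; now exists m. }
  exists (c * e)%R; split; [nra|].
  intros w [m [n ->]]; eapply Rle_trans; [|apply Hk].
  specialize (Hd m); assert (h := Rabs_pos (b - IZR n)); nra.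
Qed.

(** This is [(1 + x)^(-3/2)]: still summable over the integers, and a product of two such factors
    dominates an inverse cube in two variables. *)
Definition decay (x : R) : R := (/ ((1 + x) * sqrt (1 + x)))%R.

Lemma decay_pos (x : R) : (0 <= x)%R -> (0 < decay x)%R.
Proof.
intros Hx; apply Rinv_0_lt_compat, Rmult_lt_0_compat; [lra | apply sqrt_lt_R0; lra].
Qed.

(** Telescoping, as in the comparison with the integral of [x^(-3/2)]: the term at [x] is at most
    [2 / sqrt x - 2 / sqrt (x + 1)]. *)
Lemma decay_sum (N : nat) :
  (rsum (fun k => decay (INR k)) (seq 0 (S N)) <= 3 - 2 / sqrt (INR (S N)))%R.
Proof.
induction N as [|N IH].
- unfold decay; simpl; rewrite !Rplus_0_r, sqrt_1; lra.
- rewrite seq_S, rsum_app.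
  change (rsum (fun k => decay (INR k)) (cons (0 + S N)%nat nil)) with (decay (INR (S N)) + 0)%R.
  enough (decay (INR (S N)) <= 2 / sqrt (INR (S N)) - 2 / sqrt (INR (S (S N))))%R by lra.
  unfold decay; rewrite (S_INR (S N)).
  set (x := INR (S N)).
  assert (Hx : (0 < x)%R) by apply lt_0_INR, Nat.lt_0_succ.
  rewrite (Rplus_comm 1 x).
  set (s := sqrt x); set (t := sqrt (x + 1)).
  assert (Hs : (0 < s)%R) by now apply sqrt_lt_R0.
  assert (Ht : (0 < t)%R) by (apply sqrt_lt_R0; lra).
  assert (Es : (s * s = x)%R) by (apply sqrt_sqrt; lra).
  assert (Et : (t * t = x + 1)%R) by (apply sqrt_sqrt; lra).
  assert (Hst : (s <= t)%R) by (apply sqrt_le_1_alt; lra).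
  rewrite <- Et.
  apply Rmult_le_reg_r with (s * (t * t * t))%R; [repeat apply Rmult_lt_0_compat; auto|].
  field_simplify; [|lra|lra].
  nra.
Qed.

Lemma decay_sum_Z (N : nat) : exists B : list Z,
  (forall m : Z, (Z.abs m <= Z.of_nat N)%Z -> In m B) /\
  (rsum (fun m => decay (Rabs (IZR m))) B <= 6)%R.
Proof.
(* Zero occurs in both halves, which is harmless for an upper bound; 6 is twice the bound 3 of
   [decay_sum]. *)
exists (map Z.of_nat (seq 0 (S N)) ++ map (fun k => - Z.of_nat k)%Z (seq 0 (S N)))%list; split.
- intros m Hm; apply in_or_app.
  destruct (Z_le_gt_dec 0 m); [left | right]; apply in_map_iff; exists (Z.abs_nat m);
    (split; [lia | apply in_seq; lia]).
- rewrite rsum_app, !rsum_map.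
  assert (h := decay_sum N).
  assert (h0 : (0 < / sqrt (INR (S N)))%R)
    by (apply Rinv_0_lt_compat, sqrt_lt_R0, lt_0_INR, Nat.lt_0_succ).
  replace (fun s : nat => decay (Rabs (IZR (Z.of_nat s)))) with (fun k => decay (INR k)).
  2:{ apply functional_extensionality; intros k.
      now rewrite INR_IZR_INZ, Rabs_right by (apply Rle_ge, IZR_le; lia). }
  replace (fun s : nat => decay (Rabs (IZR (- Z.of_nat s)))) with (fun k => decay (INR k)).
  2:{ apply functional_extensionality; intros k.
      now rewrite opp_IZR, Rabs_Ropp, INR_IZR_INZ, Rabs_right by (apply Rle_ge, IZR_le; lia). }
  unfold Rdiv in h; lra.
Qed.

(** One majorant for all the lattice sums, whose terms are [O(|w|^-3)] or smaller at infinity. The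
    summand 1 keeps it finite at [w = 0]. *)
Definition majorant (w : C) : R := (/ (1 + Cmod w) ^ 3)%R.

Lemma majorant_pos (w : C) : (0 < majorant w)%R.
Proof. apply Rinv_0_lt_compat, pow_lt; assert (h := Cmod_ge_0 w); lra. Qed.

(** Both [(1 + x) * (1 + y) <= (1 + x + y)^2] and [sqrt ((1 + x) * (1 + y)) <= 1 + x + y]; their
    product splits the inverse cube, so that a sum over the lattice is bounded by a product of two
    sums over the integers. *)
Lemma cube_split (c x y t : R) : (0 < c)%R -> (0 <= x)%R -> (0 <= y)%R ->
  (c * (1 + x + y) <= t)%R -> (/ t ^ 3 <= / c ^ 3 * (decay x * decay y))%R.
Proof.
intros Hc Hx Hy Ht; unfold decay.
assert (Hs : (0 < sqrt (1 + x))%R) by (apply sqrt_lt_R0; lra).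
assert (Hu : (0 < sqrt (1 + y))%R) by (apply sqrt_lt_R0; lra).
assert (Es : (sqrt (1 + x) * sqrt (1 + x) = 1 + x)%R) by (apply sqrt_sqrt; lra).
assert (Eu : (sqrt (1 + y) * sqrt (1 + y) = 1 + y)%R) by (apply sqrt_sqrt; lra).
rewrite <- !Rinv_mult.
apply Rinv_le_contravar.
- repeat (apply Rmult_lt_0_compat); try apply pow_lt; lra.
- apply Rle_trans with ((c * (1 + x + y)) ^ 3)%R; [|apply pow_incr; nra].
  rewrite Rpow_mult_distr.
  apply Rmult_le_compat_l; [apply pow_le; lra|].
  set (s := sqrt (1 + x)) in *; set (u := sqrt (1 + y)) in *.
  assert (h1 : (s * u <= 1 + x + y)%R) by nra.
  assert (h2 : ((1 + x) * (1 + y) <= (1 + x + y) * (1 + x + y))%R) by nra.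
  replace ((1 + x) * s * ((1 + y) * u))%R with ((1 + x) * (1 + y) * (s * u))%R by ring.
  replace ((1 + x + y) ^ 3)%R with ((1 + x + y) * (1 + x + y) * (1 + x + y))%R by ring.
  apply Rmult_le_compat; auto; nra.
Qed.

Lemma lat_summable (L : C -> Prop) : is_lattice L -> exists M, sum_bound L majorant M.
Proof.
intros [w1 [w2 [Hi ->]]]; destruct (coords_bound _ _ Hi) as [c0 [Hc0 Hb0]].
(* The cap at 1 lets the same constant absorb the summand 1 of [1 + Cmod w]. *)
set (c := Rmin c0 1).
assert (Hc : (0 < c)%R) by (apply Rmin_glb_lt; lra).
set (pt := fun p : Z * Z => IZR (fst p) * w1 + IZR (snd p) * w2).
set (g := fun p : Z * Z => (decay (Rabs (IZR (fst p))) * decay (Rabs (IZR (snd p))))%R).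
assert (Hmaj : forall p, (majorant (pt p) <= / c ^ 3 * g p)%R).
{ intros [m n]; apply cube_split; auto using Rabs_pos; simpl.
  assert (h := Hb0 (IZR m) (IZR n)); unfold pt; simpl in *.
  assert (h1 : (c <= c0)%R) by apply Rmin_l.
  assert (h2 : (c <= 1)%R) by apply Rmin_r.
  assert (h3 := Rabs_pos (IZR m)); assert (h4 := Rabs_pos (IZR n)).
  nra. }
(* A finite set of lattice points lies in a square box of coordinates, over which the product
   majorant sums to at most [6 * 6]. *)
exists (/ c ^ 3 * 36)%R; intros A NA HA.
assert (HN : exists N : nat, forall w, In w A -> exists p,
  w = pt p /\ (Z.abs (fst p) <= Z.of_nat N)%Z /\ (Z.abs (snd p) <= Z.of_nat N)%Z).
{ clear NA; induction HA as [|w A [m [n Hw]] HA [N IH]].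
  - exists 0%nat; intros w [].
  - exists (N + Z.abs_nat m + Z.abs_nat n)%nat; intros v [<-|Hv].
    + exists (m, n); split; auto; simpl; lia.
    + destruct (IH v Hv) as [p [Ep [h1 h2]]]; exists p; split; auto; lia. }
destruct HN as [N HN]; destruct (decay_sum_Z N) as [B [HB SB]].
apply Rle_trans with (rsum majorant (map pt (list_prod B B))).
{ apply rsum_incl; auto.
  - intros w; left; apply majorant_pos.
  - intros w Hw; destruct (HN w Hw) as [[m n] [-> [h1 h2]]].
    apply in_map, in_prod; now apply HB. }
rewrite rsum_map.
eapply Rle_trans; [apply (rsum_le (fun _ => True) _ (fun p => / c ^ 3 * g p)%R)|].
{ intros p _; apply Hmaj. }
{ apply Forall_forall; trivial. }
rewrite rsum_scal; apply Rmult_le_compat_l; [left; apply Rinv_0_lt_compat, pow_lt; auto|].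
unfold g; rewrite (rsum_list_prod (fun m => decay (Rabs (IZR m))) (fun m => decay (Rabs (IZR m)))).
assert (h : (0 <= rsum (fun m => decay (Rabs (IZR m))) B)%R).
{ apply rsum_nonneg; intros m; left; apply decay_pos, Rabs_pos. }
nra.
Qed.

(** * Limits and derivatives in the complex plane *)

(** The limit is punctured: at a lattice point the sums have a meaningless value, coming from
    [/ 0 = 0], that must not count. *)
Definition clim (z0 : C) (f : C -> C) (l : C) : Prop :=
  forall eps : R, (0 < eps)%R -> exists d : R, (0 < d)%R /\
    forall z, (0 < Cmod (z - z0) < d)%R -> (Cmod (f z - l) < eps)%R.

Definition ccont (f : C -> C) (z : C) : Prop := clim z f (f z).

Definition cderiv (f : C -> C) (z l : C) : Prop :=
  forall eps : R, (0 < eps)%R -> exists d : R, (0 < d)%R /\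
    forall h, (Cmod h < d)%R -> (Cmod (f (z + h)%C - f z - l * h) <= eps * Cmod h)%R.

Lemma ccont_ball (f : C -> C) (z : C) (eps : R) : ccont f z -> (0 < eps)%R ->
  exists d : R, (0 < d)%R /\ forall w, (Cmod (w - z) < d)%R -> (Cmod (f w - f z) < eps)%R.
Proof.
intros H He; destruct (H eps He) as [d [Hd Hf]]; exists d; split; auto.
intros w Hw; destruct (Ceq_dec w z) as [->|n].
- replace (f z - f z) with (RtoC 0) by ring; now rewrite Cmod_0.
- apply Hf; split; auto; now apply Cmod_gt_0, Cminus_eq_contra.
Qed.

Lemma clim_const (z0 c : C) : clim z0 (fun _ => c) c.
Proof.
intros eps He; exists 1%R; split; [lra|]; intros z _.
replace (c - c) with (RtoC 0) by ring; now rewrite Cmod_0.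
Qed.

Lemma clim_id (z0 : C) : clim z0 (fun z => z) z0.
Proof. intros eps He; exists eps; split; auto; tauto. Qed.

Lemma clim_plus (z0 : C) (f g : C -> C) (l k : C) :
  clim z0 f l -> clim z0 g k -> clim z0 (fun z => f z + g z) (l + k).
Proof.
intros Hf Hg eps He.
destruct (Hf (eps / 2)%R ltac:(lra)) as [d [Hd Kf]].
destruct (Hg (eps / 2)%R ltac:(lra)) as [d' [Hd' Kg]].
exists (Rmin d d'); split; [now apply Rmin_glb_lt|]; intros z [h1 h2].
assert (k1 := Kf z (conj h1 (Rlt_le_trans _ _ _ h2 (Rmin_l _ _)))).
assert (k2 := Kg z (conj h1 (Rlt_le_trans _ _ _ h2 (Rmin_r _ _)))).
replace (f z + g z - (l + k)) with ((f z - l) + (g z - k)) by ring.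
eapply Rle_lt_trans; [apply Cmod_triangle|]; lra.
Qed.

Lemma clim_mult (z0 : C) (f g : C -> C) (l k : C) :
  clim z0 f l -> clim z0 g k -> clim z0 (fun z => f z * g z) (l * k).
Proof.
intros Hf Hg eps He.
assert (Pl := Cmod_ge_0 l); assert (Pk := Cmod_ge_0 k).
set (s := (Cmod l + Cmod k + 1)%R).
set (e := Rmin 1 (eps / (2 * s))).
assert (Hs : (0 < s)%R) by (unfold s; lra).
assert (He' : (0 < e)%R).
{ apply Rmin_glb_lt; [lra | apply Rdiv_lt_0_compat; lra]. }
destruct (Hf e He') as [d [Hd Kf]]; destruct (Hg e He') as [d' [Hd' Kg]].
exists (Rmin d d'); split; [now apply Rmin_glb_lt|]; intros z [h1 h2].
assert (k1 := Kf z (conj h1 (Rlt_le_trans _ _ _ h2 (Rmin_l _ _)))).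
assert (k2 := Kg z (conj h1 (Rlt_le_trans _ _ _ h2 (Rmin_r _ _)))).
replace (f z * g z - l * k) with ((f z - l) * (g z - k) + (l * (g z - k) + k * (f z - l))) by ring.
eapply Rle_lt_trans; [eapply Rle_trans; [apply Cmod_triangle|];
  apply Rplus_le_compat_l, Cmod_triangle|].
rewrite !Cmod_mult.
assert (p1 := Cmod_ge_0 (f z - l)); assert (p2 := Cmod_ge_0 (g z - k)).
assert (e1 : (e <= 1)%R) by apply Rmin_l.
assert (e2 : (e * s <= eps / 2)%R).
{ apply Rle_trans with (eps / (2 * s) * s)%R.
  - apply Rmult_le_compat_r; [lra | apply Rmin_r].
  - right; field; lra. }
unfold s in e2; nra.
Qed.

Lemma clim_scal (z0 c : C) (f : C -> C) (l : C) :
  clim z0 f l -> clim z0 (fun z => c * f z) (c * l).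
Proof. intros H; apply clim_mult; auto using clim_const. Qed.

Lemma clim_minus (z0 : C) (f g : C -> C) (l k : C) :
  clim z0 f l -> clim z0 g k -> clim z0 (fun z => f z - g z) (l - k).
Proof.
intros Hf Hg; replace (l - k) with (l + (-1) * k) by ring.
replace (fun z => f z - g z) with (fun z => f z + (-1) * g z)
  by (apply functional_extensionality; intros z; ring).
apply clim_plus; auto using clim_scal.
Qed.

Lemma clim_ext (z0 : C) (f g : C -> C) (l : C) (r : R) : (0 < r)%R ->
  (forall z, 0 < Cmod (z - z0) < r -> f z = g z)%R -> clim z0 f l -> clim z0 g l.
Proof.
intros Hr H Hf eps He; destruct (Hf eps He) as [d [Hd K]].
exists (Rmin d r); split; [now apply Rmin_glb_lt|]; intros z [h1 h2].
rewrite <- H; [apply K|]; split; auto; eapply Rlt_le_trans; eauto; [apply Rmin_l|apply Rmin_r].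
Qed.

Lemma clim_bound (z0 : C) (f : C -> C) (l : C) (K r : R) : (0 < r)%R ->
  (forall z, 0 < Cmod (z - z0) < r -> Cmod (f z - l) <= K * Cmod (z - z0))%R -> clim z0 f l.
Proof.
intros Hr H eps He.
set (d := (eps / (Rabs K + 1))%R).
assert (hK := Rabs_pos K).
assert (Hd : (0 < d)%R) by (apply Rdiv_lt_0_compat; lra).
exists (Rmin d r); split; [now apply Rmin_glb_lt|]; intros z [h1 h2].
eapply Rle_lt_trans; [apply H; split; auto; eapply Rlt_le_trans; eauto; apply Rmin_r|].
assert (h3 : (Cmod (z - z0) < d)%R) by exact (Rlt_le_trans _ _ _ h2 (Rmin_l _ _)).
assert (h4 := Rle_abs K).
assert (h5 : (d * (Rabs K + 1) = eps)%R) by (unfold d; field; lra).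
nra.
Qed.

Lemma cderiv_cont (f : C -> C) (z l : C) : cderiv f z l -> ccont f z.
Proof.
intros H; destruct (H 1%R ltac:(lra)) as [d [Hd K]].
apply clim_bound with (1 + Cmod l)%R d; auto; intros w [_ Hw].
specialize (K (w - z) Hw); replace (z + (w - z)) with w in K by ring.
replace (f w - f z) with ((f w - f z - l * (w - z)) + l * (w - z)) by ring.
eapply Rle_trans; [apply Cmod_triangle|]; rewrite Cmod_mult; lra.
Qed.

Lemma cderiv_ext (f g : C -> C) (z l : C) (r : R) : (0 < r)%R ->
  (forall w, Cmod (w - z) < r -> f w = g w)%R -> cderiv f z l -> cderiv g z l.
Proof.
intros Hr H Hf eps He; destruct (Hf eps He) as [d [Hd K]].
exists (Rmin d r); split; [now apply Rmin_glb_lt|]; intros h Hh.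
assert (h1 : (Cmod h < d)%R) by exact (Rlt_le_trans _ _ _ Hh (Rmin_l _ _)).
assert (h2 : (Cmod h < r)%R) by exact (Rlt_le_trans _ _ _ Hh (Rmin_r _ _)).
rewrite <- !H; auto.
- replace (z - z) with (RtoC 0) by ring; now rewrite Cmod_0.
- now replace (z + h - z) with h by ring.
Qed.

Lemma cderiv_unique (f : C -> C) (z l k : C) : cderiv f z l -> cderiv f z k -> l = k.
Proof.
intros Hl Hk; apply NNPP; intros n.
assert (Hp : (0 < Cmod (l - k))%R) by (apply Cmod_gt_0, Cminus_eq_contra, n).
destruct (Hl (Cmod (l - k) / 3)%R ltac:(lra)) as [d [Hd Kl]].
destruct (Hk (Cmod (l - k) / 3)%R ltac:(lra)) as [d' [Hd' Kk]].
set (e := (Rmin d d' / 2)%R).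
assert (He : (0 < Rmin d d')%R) by now apply Rmin_glb_lt.
assert (m1 : (Rmin d d' <= d)%R) by apply Rmin_l.
assert (m2 : (Rmin d d' <= d')%R) by apply Rmin_r.
assert (Ce : Cmod (RtoC e) = e) by (rewrite Cmod_R, Rabs_right; unfold e; lra).
specialize (Kl e); specialize (Kk e); rewrite Ce in Kl, Kk.
specialize (Kl ltac:(unfold e; lra)); specialize (Kk ltac:(unfold e; lra)).
assert (T := Cmod_triangle (f (z + e) - f z - k * e) (- (f (z + e) - f z - l * e))).
rewrite Cmod_opp in T.
replace (f (z + e) - f z - k * e + - (f (z + e) - f z - l * e)) with ((l - k) * e) in T by ring.
rewrite Cmod_mult, Ce in T.
assert (0 < e)%R by (unfold e; lra).
nra.
Qed.

Lemma cderiv_const (c z : C) : cderiv (fun _ => c) z 0.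
Proof.
intros eps He; exists 1%R; split; [lra|]; intros h _.
replace (c - c - 0 * h) with (RtoC 0) by ring; rewrite Cmod_0.
assert (p := Cmod_ge_0 h); nra.
Qed.

Lemma cderiv_plus (f g : C -> C) (z l k : C) :
  cderiv f z l -> cderiv g z k -> cderiv (fun z => f z + g z) z (l + k).
Proof.
intros Hf Hg eps He.
destruct (Hf (eps / 2)%R ltac:(lra)) as [d [Hd Kf]].
destruct (Hg (eps / 2)%R ltac:(lra)) as [d' [Hd' Kg]].
exists (Rmin d d'); split; [now apply Rmin_glb_lt|]; intros h Hh.
assert (k1 := Kf h (Rlt_le_trans _ _ _ Hh (Rmin_l _ _))).
assert (k2 := Kg h (Rlt_le_trans _ _ _ Hh (Rmin_r _ _))).
replace (f (z + h) + g (z + h) - (f z + g z) - (l + k) * h) with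
  ((f (z + h)%C - f z - l * h) + (g (z + h) - g z - k * h)) by ring.
eapply Rle_trans; [apply Cmod_triangle|]; lra.
Qed.

Lemma cderiv_mult (f g : C -> C) (z l k : C) :
  cderiv f z l -> cderiv g z k -> cderiv (fun z => f z * g z) z (l * g z + f z * k).
Proof.
intros Hf Hg eps He.
assert (p1 := Cmod_ge_0 (f z)); assert (p2 := Cmod_ge_0 (g z)).
assert (p3 := Cmod_ge_0 l).
set (s := (Cmod (f z) + Cmod (g z) + Cmod l + 2)%R).
assert (Hs : (0 < s)%R) by (unfold s; lra).
set (e := Rmin 1 (eps / s)).
assert (He' : (0 < e)%R) by (apply Rmin_glb_lt; [lra | now apply Rdiv_lt_0_compat]).
destruct (Hf e He') as [d [Hd Kf]]; destruct (Hg e He') as [d' [Hd' Kg]].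
destruct (ccont_ball g z e (cderiv_cont _ _ _ Hg) He') as [d2 [Hd2 Kg2]].
exists (Rmin (Rmin d d') d2); split; [repeat apply Rmin_glb_lt; auto|].
intros h Hh.
assert (m1 := Rmin_l (Rmin d d') d2); assert (m2 := Rmin_r (Rmin d d') d2).
assert (m3 := Rmin_l d d'); assert (m4 := Rmin_r d d').
specialize (Kf h ltac:(lra)); specialize (Kg h ltac:(lra)).
specialize (Kg2 (z + h)); replace (z + h - z) with h in Kg2 by ring.
specialize (Kg2 ltac:(lra)).
set (A := f (z + h)%C - f z - l * h) in *.
set (B := g (z + h) - g z - k * h) in *.
set (G := g (z + h) - g z) in *.
replace (f (z + h) * g (z + h) - f z * g z - (l * g z + f z * k) * h)
  with (A * g z + (f z * B + (A * G + l * h * G))) by (unfold A, B, G; ring).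
eapply Rle_trans; [apply Cmod_triangle|].
eapply Rle_trans; [apply Rplus_le_compat_l, Cmod_triangle|].
eapply Rle_trans; [apply Rplus_le_compat_l, Rplus_le_compat_l, Cmod_triangle|].
rewrite !Cmod_mult.
assert (q1 := Cmod_ge_0 A); assert (q2 := Cmod_ge_0 B); assert (q3 := Cmod_ge_0 G).
assert (q4 := Cmod_ge_0 h).
assert (e1 : (e <= 1)%R) by apply Rmin_l.
assert (e2 : (e * s <= eps)%R).
{ apply Rle_trans with (eps / s * s)%R.
  - apply Rmult_le_compat_r; [lra | apply Rmin_r].
  - right; field; lra. }
apply Rle_trans with (e * s * Cmod h)%R; [|apply Rmult_le_compat_r; auto].
unfold s.
assert (t1 : (Cmod A * Cmod (g z) <= e * Cmod h * Cmod (g z))%R) by nra.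
assert (t2 : (Cmod (f z) * Cmod B <= Cmod (f z) * (e * Cmod h))%R) by nra.
assert (t3 : (Cmod A * Cmod G <= e * Cmod h * 1)%R) by (apply Rmult_le_compat; lra).
assert (t4 : (Cmod l * Cmod h * Cmod G <= Cmod l * Cmod h * e)%R).
{ apply Rmult_le_compat_l; [apply Rmult_le_pos; auto | lra]. }
assert (t5 : (0 <= e * Cmod h)%R) by (apply Rmult_le_pos; lra).
lra.
Qed.

Lemma cderiv_scal (f : C -> C) (c z l : C) :
  cderiv f z l -> cderiv (fun z => c * f z) z (c * l).
Proof.
intros H; replace (c * l) with (0 * f z + c * l) by ring.
apply (cderiv_mult (fun _ => c)); auto using cderiv_const.
Qed.

Lemma cderiv_minus (f g : C -> C) (z l k : C) :
  cderiv f z l -> cderiv g z k -> cderiv (fun z => f z - g z) z (l - k).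
Proof.
intros Hf Hg; replace (l - k) with (l + (-1) * k) by ring.
replace (fun z => f z - g z) with (fun z => f z + (-1) * g z)
  by (apply functional_extensionality; intros w; ring).
apply cderiv_plus; auto using cderiv_scal.
Qed.

Lemma cderiv_shift (f : C -> C) (a z l : C) :
  cderiv f (z + a) l -> cderiv (fun z => f (z + a)) z l.
Proof.
intros H eps He; destruct (H eps He) as [d [Hd K]]; exists d; split; auto.
intros h Hh; specialize (K h Hh); now replace (z + h + a) with (z + a + h) by ring.
Qed.

Lemma cderiv_quad (f : C -> C) (z l : C) (K r : R) : (0 < r)%R ->
  (forall h, Cmod h < r -> Cmod (f (z + h)%C - f z - l * h) <= K * Cmod h ^ 2)%R -> cderiv f z l.
Proof.
intros Hr H eps He.
set (d := (eps / (Rabs K + 1))%R).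
assert (hK := Rabs_pos K).
assert (Hd : (0 < d)%R) by (apply Rdiv_lt_0_compat; lra).
exists (Rmin d r); split; [now apply Rmin_glb_lt|]; intros h Hh.
eapply Rle_trans; [apply H; eapply Rlt_le_trans; eauto; apply Rmin_r|].
assert (h3 : (Cmod h < d)%R) by exact (Rlt_le_trans _ _ _ Hh (Rmin_l _ _)).
assert (h4 := Rle_abs K); assert (h6 := Cmod_ge_0 h).
assert (h5 : (d * (Rabs K + 1) = eps)%R) by (unfold d; field; lra).
replace (K * Cmod h ^ 2)%R with (K * Cmod h * Cmod h)%R by ring.
apply Rmult_le_compat_r; auto; nra.
Qed.

(** Taken coordinatewise, so that the real theorems on derivatives and integrals apply;
    [curve_deriv_eps] is the form that composes with [cderiv]. *)
Definition curve_deriv (g : R -> C) (t : R) (l : C) : Prop :=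
  is_derive (fun t => Re (g t)) t (Re l) /\ is_derive (fun t => Im (g t)) t (Im l).

Lemma curve_deriv_eps (g : R -> C) (t : R) (l : C) : curve_deriv g t l <->
  forall eps : R, (0 < eps)%R -> exists d : R, (0 < d)%R /\
    forall h : R, (Rabs h < d)%R -> (Cmod (g (t + h)%R - g t - l * h) <= eps * Rabs h)%R.
Proof.
unfold curve_deriv; rewrite !is_derive_Reals; split.
- intros [H1 H2] eps He.
  destruct (H1 (eps / 2 / 2)%R ltac:(lra)) as [d1 K1].
  destruct (H2 (eps / 2 / 2)%R ltac:(lra)) as [d2 K2].
  exists (Rmin d1 d2); split; [apply Rmin_glb_lt; apply cond_pos|]; intros h Hh.
  destruct (Req_dec h 0) as [->|n].
  + rewrite Rplus_0_r; replace (g t - g t - l * 0) with (RtoC 0) by ring.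
    rewrite Cmod_0, Rabs_R0; lra.
  + assert (P : (0 < Rabs h)%R) by now apply Rabs_pos_lt.
    specialize (K1 h n ltac:(eapply Rlt_le_trans; eauto; apply Rmin_l)).
    specialize (K2 h n ltac:(eapply Rlt_le_trans; eauto; apply Rmin_r)).
    left; apply Cmod_sqrt2_bound.
    * replace (Re (g (t + h)%R - g t - l * h)) with
        (((Re (g (t + h)%R) - Re (g t)) / h - Re l) * h)%R by (unfold Re; simpl; field; auto).
      rewrite Rabs_mult; nra.
    * replace (Im (g (t + h)%R - g t - l * h)) with
        (((Im (g (t + h)%R) - Im (g t)) / h - Im l) * h)%R by (unfold Im; simpl; field; auto).
      rewrite Rabs_mult; nra.
- intros H; split; intros eps He; destruct (H (eps / 2)%R ltac:(lra)) as [d [Hd K]];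
    exists (mkposreal d Hd); intros h n Hh; simpl in Hh; specialize (K h Hh);
    assert (P : (0 < Rabs h)%R) by now apply Rabs_pos_lt.
  + replace ((Re (g (t + h)%R) - Re (g t)) / h - Re l)%R with
      (Re (g (t + h)%R - g t - l * h) / h)%R by (unfold Re; simpl; field; auto).
    unfold Rdiv; rewrite Rabs_mult, Rabs_inv.
    apply Rmult_lt_reg_r with (Rabs h); auto; rewrite Rmult_assoc, Rinv_l, Rmult_1_r by lra.
    eapply Rle_lt_trans; [apply re_le_Cmod|]; nra.
  + replace ((Im (g (t + h)%R) - Im (g t)) / h - Im l)%R with
      (Im (g (t + h)%R - g t - l * h) / h)%R by (unfold Im; simpl; field; auto).
    unfold Rdiv; rewrite Rabs_mult, Rabs_inv.
    apply Rmult_lt_reg_r with (Rabs h); auto; rewrite Rmult_assoc, Rinv_l, Rmult_1_r by lra.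
    eapply Rle_lt_trans; [apply im_le_Cmod|]; nra.
Qed.

Lemma curve_deriv_comp (f : C -> C) (g : R -> C) (t : R) (l k : C) :
  curve_deriv g t k -> cderiv f (g t) l -> curve_deriv (fun t => f (g t)) t (l * k).
Proof.
rewrite !curve_deriv_eps; intros Hg Hf eps He.
assert (pk := Cmod_ge_0 k); assert (pl := Cmod_ge_0 l).
destruct (Hf (eps / 2 / (Cmod k + 1))%R) as [d [Hd Kf]].
{ apply Rdiv_lt_0_compat; lra. }
destruct (Hg 1%R ltac:(lra)) as [d1 [Hd1 Kg1]].
destruct (Hg (eps / 2 / (Cmod l + 1))%R) as [d2 [Hd2 Kg2]].
{ apply Rdiv_lt_0_compat; lra. }
exists (Rmin (Rmin d1 d2) (d / (Cmod k + 1))); split.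
{ repeat apply Rmin_glb_lt; auto; apply Rdiv_lt_0_compat; lra. }
intros h Hh.
assert (h1 : (Rabs h < d1)%R) by (eapply Rlt_le_trans; [apply Hh|]; eapply Rle_trans; apply Rmin_l).
assert (h2 : (Rabs h < d2)%R)
  by (eapply Rlt_le_trans; [apply Hh|]; eapply Rle_trans; [apply Rmin_l | apply Rmin_r]).
assert (h3 : (Rabs h < d / (Cmod k + 1))%R) by (eapply Rlt_le_trans; [apply Hh|]; apply Rmin_r).
specialize (Kg1 h h1); specialize (Kg2 h h2).
set (x := g (t + h)%R - g t) in *.
assert (Hx : (Cmod x <= (Cmod k + 1) * Rabs h)%R).
{ replace x with ((x - k * h) + k * h) by ring.
  eapply Rle_trans; [apply Cmod_triangle|]; rewrite Cmod_mult, Cmod_R; lra. }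
assert (Hxd : (Cmod x < d)%R).
{ eapply Rle_lt_trans; [apply Hx|].
  apply Rmult_lt_reg_r with (/ (Cmod k + 1))%R; [apply Rinv_0_lt_compat; lra|].
  replace ((Cmod k + 1) * Rabs h * / (Cmod k + 1))%R with (Rabs h) by (field; lra).
  exact h3. }
specialize (Kf x Hxd).
replace (g t + x) with (g (t + h)%R) in Kf by (unfold x; ring).
replace (f (g (t + h)%R) - f (g t) - l * k * h) with
  ((f (g (t + h)%R) - f (g t) - l * x) + l * (x - k * h)) by ring.
eapply Rle_trans; [apply Cmod_triangle|]; rewrite Cmod_mult.
assert (E1 : (eps / 2 / (Cmod k + 1) * Cmod x <= eps / 2 * Rabs h)%R).
{ replace (eps / 2 * Rabs h)%R with (eps / 2 / (Cmod k + 1) * ((Cmod k + 1) * Rabs h))%R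
    by (field; lra).
  apply Rmult_le_compat_l; auto; left; apply Rdiv_lt_0_compat; lra. }
assert (E2 : (Cmod l * Cmod (x - k * h) <= eps / 2 * Rabs h)%R).
{ apply Rle_trans with ((Cmod l + 1) * (eps / 2 / (Cmod l + 1) * Rabs h))%R.
  - apply Rmult_le_compat; auto using Cmod_ge_0; lra.
  - right; field; lra. }
lra.
Qed.

Lemma curve_deriv_zero (g : R -> C) (a b : R) :
  (forall t, curve_deriv g t 0) -> g a = g b.
Proof.
intros H.
assert (K : forall a b : R, (a < b)%R -> g a = g b).
{ clear a b; intros a b Hab; apply Ceq_ReIm.
  - apply (eq_is_derive (fun t => Re (g t)) a b); auto; intros t _; apply (H t).
  - apply (eq_is_derive (fun t => Im (g t)) a b); auto; intros t _; apply (H t). }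
destruct (Rtotal_order a b) as [h|[->|h]]; auto; symmetry; auto.
Qed.

Lemma curve_deriv_line (p d : C) (t : R) : curve_deriv (fun t => p + t * d) t d.
Proof.
split; unfold Re, Im; simpl; auto_derive; auto; ring.
Qed.

(** * Constancy of elliptic functions without poles *)

Definition cis (t : R) : C := (cos t, sin t).

Lemma Cmod_cis (t : R) : Cmod (cis t) = 1%R.
Proof.
unfold Cmod, cis; simpl.
replace (cos t * (cos t * 1) + sin t * (sin t * 1))%R with 1%R; [apply sqrt_1|].
assert (h := sin2_cos2 t); unfold Rsqr in h; lra.
Qed.

Lemma Cmod_circle (s : R) (w : C) (t : R) : (0 < s)%R ->
  Cmod (s * (w * cis t)) = (s * Cmod w)%R.
Proof. intros Hs; rewrite !Cmod_mult, Cmod_cis, Cmod_R, Rabs_right by lra; ring. Qed.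

Lemma curve_deriv_circle (z0 w : C) (s t : R) :
  curve_deriv (fun t : R => z0 + s * (w * cis t)) t (s * (w * (Ci * cis t))).
Proof. split; unfold Re, Im; simpl; auto_derive; auto; ring. Qed.

Lemma circle_continuity_2d (z0 w : C) (x t : R) :
  continuity_2d_pt (fun u v => Re (z0 + u * (w * cis v))) x t /\
  continuity_2d_pt (fun u v => Im (z0 + u * (w * cis v))) x t.
Proof.
assert (Hc : continuity_2d_pt (fun _ v => cos v) x t).
{ apply (continuity_1d_2d_pt_comp cos (fun _ v => v)); [apply continuity_cos | apply continuity_2d_pt_id2]. }
assert (Hs : continuity_2d_pt (fun _ v => sin v) x t).
{ apply (continuity_1d_2d_pt_comp sin (fun _ v => v)); [apply continuity_sin | apply continuity_2d_pt_id2]. }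
split.
- apply continuity_2d_pt_ext with
    (fun u v => Re z0 + u * (Re w * cos v - Im w * sin v))%R;
    [intros; unfold Re, Im; simpl; ring|].
  repeat (apply continuity_2d_pt_minus || apply continuity_2d_pt_plus || apply continuity_2d_pt_mult);
    auto using continuity_2d_pt_const, continuity_2d_pt_id1.
- apply continuity_2d_pt_ext with
    (fun u v => Im z0 + u * (Re w * sin v + Im w * cos v))%R;
    [intros; unfold Re, Im; simpl; ring|].
  repeat (apply continuity_2d_pt_minus || apply continuity_2d_pt_plus || apply continuity_2d_pt_mult);
    auto using continuity_2d_pt_const, continuity_2d_pt_id1.
Qed.

Lemma continuity_2d_comp (f : C -> C) (g : R -> R -> C) (x t : R) :
  ccont f (g x t) -> continuity_2d_pt (fun u v => Re (g u v)) x t ->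
  continuity_2d_pt (fun u v => Im (g u v)) x t ->
  continuity_2d_pt (fun u v => Re (f (g u v))) x t /\
  continuity_2d_pt (fun u v => Im (f (g u v))) x t.
Proof.
intros Hf Hr Hi.
assert (K : forall eps : posreal,
  locally_2d (fun u v => Cmod (f (g u v) - f (g x t)) < eps)%R x t).
{ intros eps; destruct (ccont_ball f (g x t) eps Hf (cond_pos eps)) as [d [Hd K]].
  assert (Hd2 : (0 < d / 2)%R) by lra.
  apply locally_2d_impl with (2 := locally_2d_and _ _ _ _
    (Hr (mkposreal _ Hd2)) (Hi (mkposreal _ Hd2))).
  apply locally_2d_forall; intros u v [h1 h2]; apply K, Cmod_sqrt2_bound; auto. }
split; intros eps; (eapply locally_2d_impl; [|apply (K eps)]); apply locally_2d_forall;
  intros u v Huv; (eapply Rle_lt_trans; [|apply Huv]).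
- apply (re_le_Cmod (f (g u v) - f (g x t))).
- apply (im_le_Cmod (f (g u v) - f (g x t))).
Qed.

Lemma continuity_2d_snd (f : R -> R -> R) (x t : R) :
  continuity_2d_pt f x t -> continuous (fun v => f x v) t.
Proof.
intros H; apply continuity_pt_filterlim.
intros eps He; destruct (H (mkposreal eps He)) as [d Hd].
exists d; split; [apply cond_pos|]; intros v [_ Hv].
apply Hd; auto; rewrite Rminus_diag, Rabs_R0; apply cond_pos.
Qed.

Lemma curve_deriv_fst (F : C -> C) (z0 w l : C) (s t : R) :
  cderiv F (z0 + s * (w * cis t))%C l ->
  is_derive (fun s : R => Re (F (z0 + s * (w * cis t))%C)) s (Re (l * (w * cis t))).
Proof.
intros H; apply (curve_deriv_comp F (fun s : R => z0 + s * (w * cis t))); auto.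
apply curve_deriv_line.
Qed.

Lemma RInt_zero_nonneg (g : R -> R) (a b c : R) : (a < c < b)%R ->
  (forall t, a <= t <= b -> continuous g t)%R -> (forall t, 0 <= g t)%R ->
  RInt g a b = 0%R -> g c = 0%R.
Proof.
intros Hc Hg Hp H0; destruct (Hp c) as [Hlt|E]; [exfalso|easy].
assert (Hcont : continuous g c) by (apply Hg; lra).
apply continuity_pt_filterlim in Hcont.
destruct (Hcont (g c) Hlt) as [d [Hd K]].
set (e := Rmin d (Rmin (c - a) (b - c))).
assert (He : (0 < e)%R) by (repeat apply Rmin_glb_lt; lra).
assert (m1 : (e <= d)%R) by apply Rmin_l.
assert (m2 : (e <= c - a)%R) by (eapply Rle_trans; [apply Rmin_r | apply Rmin_l]).
assert (m3 : (e <= b - c)%R) by (eapply Rle_trans; [apply Rmin_r | apply Rmin_r]).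
assert (Hex : forall x y, (a <= x)%R -> (x <= y)%R -> (y <= b)%R -> ex_RInt g x y).
{ intros x y h1 h2 h3; apply (ex_RInt_continuous g); intros z.
  rewrite Rmin_left, Rmax_right by lra; intros; apply Hg; lra. }
assert (I1 : (0 <= RInt g a (c - e))%R) by (apply RInt_ge_0; auto; [lra | apply Hex; lra]).
assert (I3 : (0 <= RInt g (c + e) b)%R) by (apply RInt_ge_0; auto; [lra | apply Hex; lra]).
assert (I2 : (0 < RInt g (c - e) (c + e))%R).
{ apply RInt_gt_0; [lra| |intros; apply Hg; lra].
  intros x Hx; destruct (Req_dec x c) as [->|n]; auto.
  assert (h : (Rabs (g x - g c) < g c)%R).
  { apply K; split; [split; [exact I | auto]|].
    apply Rabs_def1; lra. }
  apply Rabs_def2 in h; lra. }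
assert (E1 := RInt_Chasles g a (c - e) (c + e) ltac:(apply Hex; lra) ltac:(apply Hex; lra)).
assert (E2 := RInt_Chasles g a (c + e) b ltac:(apply Hex; lra) ltac:(apply Hex; lra)).
unfold plus in *; simpl in *; lra.
Qed.

(* The circle means of [Re F] do not depend on the radius: differentiating
   under the integral produces the integral of an angular derivative of
   [Im F].  Only continuity is needed at the centre. *)
Lemma circle_min (F F' : C -> C) (z0 : C) (rho : R) :
  (forall z, 0 < Cmod (z - z0) < rho -> cderiv F z (F' z) /\ ccont F' z)%R ->
  ccont F z0 -> F z0 = 0 -> (forall z, 0 <= Re (F z))%R ->
  forall z, (Cmod (z - z0) < rho)%R -> Re (F z) = 0%R.
Proof.
intros HF Hc H0 Hpos z1 Hz1.
destruct (Ceq_dec z1 z0) as [->|n]; [now rewrite H0|].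
set (w := z1 - z0) in *.
assert (Hw : (0 < Cmod w)%R) by now apply Cmod_gt_0, Cminus_eq_contra.
(* The circles are scaled so that [z1] itself is the point [s = 1], [t = 0]; [sigma > 1] is the
   scale at which they reach the boundary of the disc. *)
set (U := fun s t : R => Re (F (z0 + s * (w * cis t))%C)).
set (dU := fun s t : R => Re (F' (z0 + s * (w * cis t))%C * (w * cis t))).
set (sigma := (rho / Cmod w)%R).
assert (Hs1 : (1 < sigma)%R).
{ apply Rmult_lt_reg_r with (Cmod w); auto; unfold sigma.
  replace (rho / Cmod w * Cmod w)%R with rho by (field; lra); lra. }
assert (Hin : forall s t, (0 < s < sigma)%R ->
  (0 < Cmod (z0 + s * (w * cis t) - z0) < rho)%R).
{ intros s t [h1 h2]; replace (z0 + s * (w * cis t) - z0) with (s * (w * cis t)) by ring.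
  rewrite Cmod_circle by auto; split; [now apply Rmult_lt_0_compat|].
  replace rho with (sigma * Cmod w)%R by (unfold sigma; field; lra).
  now apply Rmult_lt_compat_r. }
assert (HU : forall s t, (0 < s < sigma)%R -> is_derive (fun s : R => U s t) s (dU s t)).
{ intros s t Hs; apply curve_deriv_fst, HF, Hin, Hs. }
assert (HUc : forall s t, (0 < s < sigma)%R -> continuous (U s) t).
{ intros s t Hs; apply (continuity_2d_snd U).
  apply (continuity_2d_comp F (fun u v => z0 + u * (w * cis v))); try apply circle_continuity_2d.
  eapply cderiv_cont, HF, Hin, Hs. }
assert (HdU : forall s t, (0 < s < sigma)%R -> continuity_2d_pt dU s t).
{ intros s t Hs.
  destruct (continuity_2d_comp F' (fun u v => z0 + u * (w * cis v)) s t) as [h1 h2];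
    try apply circle_continuity_2d.
  { apply HF, Hin, Hs. }
  assert (hc : continuity_2d_pt (fun _ v => Re (w * cis v)) s t
             /\ continuity_2d_pt (fun _ v => Im (w * cis v)) s t).
  { split; [apply continuity_2d_pt_ext with (fun _ v => Re w * cos v - Im w * sin v)%R
      | apply continuity_2d_pt_ext with (fun _ v => Re w * sin v + Im w * cos v)%R];
      try (intros; unfold Re, Im; simpl; ring);
      repeat (apply continuity_2d_pt_minus || apply continuity_2d_pt_plus || apply continuity_2d_pt_mult);
      try apply continuity_2d_pt_const;
      (apply (continuity_1d_2d_pt_comp cos (fun _ v => v)) ||
       apply (continuity_1d_2d_pt_comp sin (fun _ v => v)));
      try apply continuity_2d_pt_id2; try apply continuity_cos; apply continuity_sin. }
  apply continuity_2d_pt_ext with (fun u v => Re (F' (z0 + u * (w * cis v))%C) * Re (w * cis v)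
    - Im (F' (z0 + u * (w * cis v))%C) * Im (w * cis v))%R.
  - intros; unfold dU; symmetry; apply re_mult.
  - apply continuity_2d_pt_minus; apply continuity_2d_pt_mult; tauto. }
set (Phi := fun s : R => RInt (U s) (- PI) PI).
assert (HPI := PI_RGT_0).
assert (Hnear : forall s, (0 < s < sigma)%R -> locally s (fun s => 0 < s < sigma)%R).
{ intros s Hs; apply (open_and (fun x => 0 < x)%R (fun x => x < sigma)%R);
    [apply open_gt | apply open_lt | auto]. }
assert (HdPhi : forall s, (0 < s < sigma)%R -> is_derive Phi s 0%R).
{ intros s Hs.
  assert (E : RInt (fun t => Derive (fun u => U u t) s) (- PI) PI = 0%R).
  { rewrite (RInt_ext _ (dU s)) by (intros; apply is_derive_unique, HU; auto).
    apply is_RInt_unique.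
    (* Cauchy-Riemann in polar form: the angular derivative of [Im F] is [s] times the radial
       derivative of [Re F]. Hence the integrand is the derivative of [f], which takes equal values
       at both ends. *)
    set (f := fun t : R => (Im (F (z0 + s * (w * cis t))%C) / s)%R).
    replace 0%R with (minus (f PI) (f (- PI)%R)).
    2:{ unfold f; replace (cis (- PI)) with (cis PI)
          by (unfold cis; now rewrite cos_neg, sin_neg, sin_PI, Ropp_0).
        set (y := (Im _ / s)%R); change (y - y = 0)%R; ring. }
    apply (is_RInt_derive f (dU s)).
    - intros t _.
      assert (h := curve_deriv_comp F (fun t => z0 + s * (w * cis t)) t _ _
        (curve_deriv_circle z0 w s t) (proj1 (HF _ (Hin s t Hs)))).
      destruct h as [_ h].
      replace (dU s t) with (/ s * Im (F' (z0 + s * (w * cis t))%C * (s * (w * (Ci * cis t)))))%R.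
      2:{ unfold dU; set (x := F' _); unfold Re, Im, Ci; simpl; field; lra. }
      apply is_derive_ext with (fun t : R => / s * Im (F (z0 + s * (w * cis t))%C))%R.
      { intros t'; unfold f, Rdiv; apply Rmult_comm. }
      now apply is_derive_scal.
    - intros t _; now apply continuity_2d_snd, HdU. }
  rewrite <- E; apply is_derive_RInt_param.
  - apply filter_imp with (2 := Hnear s Hs); intros u Hu t _; exists (dU u t); now apply HU.
  - intros t _; apply continuity_2d_pt_ext_loc with dU; [|now apply HdU].
    destruct (Hnear s Hs) as [d Hd]; exists d; intros u v Hu _.
    symmetry; apply is_derive_unique, HU, Hd, Hu.
  - apply filter_imp with (2 := Hnear s Hs); intros u Hu.
    apply (ex_RInt_continuous (U u)); intros t _; now apply HUc. }
(* The integral does not depend on the radius and, by continuity at the centre where [F] vanishes,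
   tends to 0 with it. The interval has length [2 * PI], so [e] leaves [eps / 2]. *)
assert (HPhi : Phi 1%R = 0%R).
{ apply cond_eq; intros eps He; rewrite Rminus_0_r.
  set (e := (eps / (4 * PI))%R).
  assert (He' : (0 < e)%R) by (apply Rdiv_lt_0_compat; lra).
  destruct (ccont_ball F z0 e Hc He') as [d [Hd K]].
  set (s := Rmin (1 / 2) (d / (2 * Cmod w))).
  assert (Hs : (0 < s)%R) by (apply Rmin_glb_lt; [lra | apply Rdiv_lt_0_compat; lra]).
  assert (hs1 : (s <= 1 / 2)%R) by apply Rmin_l.
  assert (hs2 : (s * Cmod w <= d / 2)%R).
  { apply Rle_trans with (d / (2 * Cmod w) * Cmod w)%R.
    - apply Rmult_le_compat_r; [lra | apply Rmin_r].
    - right; field; lra. }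
  replace (Phi 1%R) with (Phi s).
  2:{ apply (eq_is_derive Phi s 1%R); [intros t Ht; apply HdPhi|]; lra. }
  apply Rle_lt_trans with ((PI - - PI) * e)%R.
  - apply abs_RInt_le_const; [lra | |].
    + apply (ex_RInt_continuous (U s)); intros t _; apply HUc; lra.
    + intros t _; left; unfold U.
      assert (h := K (z0 + s * (w * cis t))).
      rewrite H0 in h; replace (z0 + s * (w * cis t) - z0) with (s * (w * cis t)) in h by ring.
      rewrite Cmod_circle in h by auto.
      eapply Rle_lt_trans; [apply re_le_Cmod|].
      specialize (h ltac:(lra)).
      now replace (F (z0 + s * (w * cis t)) - 0) with (F (z0 + s * (w * cis t))) in h by ring.
  - unfold e; replace ((PI - - PI) * (eps / (4 * PI)))%R with (eps / 2)%R by (field; lra); lra. }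
(* A continuous nonnegative function with zero integral vanishes at interior points; the range from
   [- PI] to [PI] makes [t = 0] interior. *)
assert (E : U 1%R 0%R = 0%R).
{ apply (RInt_zero_nonneg (U 1%R) (- PI) PI 0%R); auto; [lra| |].
  - intros t _; apply HUc; lra.
  - intros t; apply Hpos. }
unfold U in E; rewrite <- E; f_equal; f_equal.
unfold w, cis; rewrite cos_0, sin_0.
change ((1%R, 0%R)) with (RtoC 1); ring.
Qed.

(** Connectedness of the unit interval: the supremum of the points of [P] belongs to [P] because the
    complement is open, and cannot lie below 1 because [P] is open. *)
Lemma clopen_real (P : R -> Prop) : P 0%R ->
  (forall t, P t -> exists e, (0 < e)%R /\ forall s, (Rabs (s - t) < e)%R -> P s) ->
  (forall t, ~ P t -> exists e, (0 < e)%R /\ forall s, (Rabs (s - t) < e)%R -> ~ P s) ->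
  P 1%R.
Proof.
intros P0 Ho Hc.
destruct (completeness (fun t => 0 <= t <= 1 /\ P t)%R) as [m [Hub Hlub]].
{ exists 1%R; intros t [Ht _]; lra. }
{ exists 0%R; split; [lra | easy]. }
assert (Hm : (0 <= m <= 1)%R).
{ split; [apply Hub; split; [lra|easy] | apply Hlub; intros t [Ht _]; lra]. }
assert (Pm : P m).
{ apply NNPP; intros n; destruct (Hc m n) as [e [He K]].
  assert (h : is_upper_bound (fun t => 0 <= t <= 1 /\ P t)%R (m - e)%R).
  { intros t [Ht Pt]; apply Rnot_lt_le; intros Hlt; apply (K t); auto.
    assert (t <= m)%R by (apply Hub; auto); apply Rabs_def1; lra. }
  specialize (Hlub _ h); lra. }
destruct (Ho m Pm) as [e [He K]].
destruct (Rlt_dec m 1) as [Hlt|Hge]; [|replace 1%R with m by lra; auto].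
set (s := Rmin 1 (m + e / 2)).
assert (hs : (m < s)%R) by (apply Rmin_glb_lt; lra).
assert (hs1 : (s <= 1)%R) by apply Rmin_l.
assert (hs2 : (s <= m + e / 2)%R) by apply Rmin_r.
assert (s <= m)%R; [|lra].
apply Hub; split; [lra|]; apply K, Rabs_def1; lra.
Qed.

Definition rcont (g : C -> R) : Prop :=
  forall z eps, (0 < eps)%R -> exists d, (0 < d)%R /\
    forall w, (Cmod (w - z) < d)%R -> (Rabs (g w - g z) < eps)%R.

Lemma unit_shift (a : R) : exists m : Z, (0 <= a - IZR m <= 1)%R.
Proof. exists (up a - 1)%Z; rewrite minus_IZR; destruct (archimed a); lra. Qed.

(** Compactness of the period parallelogram. Each point gets a radius that is at most half the value
    of [g] there and within which [g] stays above that half; a common lower bound for the radii of a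
    cover is then a lower bound for [g]. *)
Lemma periodic_pos_bound (w1 w2 : C) (g : C -> R) : R_independent w1 w2 -> rcont g ->
  (forall z, 0 < g z)%R -> (forall z w, lattice w1 w2 w -> g (z + w) = g z) ->
  exists d, (0 < d)%R /\ forall z, (d <= g z)%R.
Proof.
intros Hi Hg Hp Hper.
set (pt := fun a b : R => a * w1 + b * w2).
assert (Hd : forall a b : R, exists d : posreal, (d <= g (pt a b) / 2)%R /\
  forall x y, (Rabs (x - a) < d)%R -> (Rabs (y - b) < d)%R -> (g (pt a b) / 2 < g (pt x y))%R).
{ intros a b; assert (P := Hp (pt a b)).
  destruct (Hg (pt a b) (g (pt a b) / 2)%R ltac:(lra)) as [e [He K]].
  assert (p1 := Cmod_ge_0 w1); assert (p2 := Cmod_ge_0 w2).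
  set (s := (Cmod w1 + Cmod w2 + 1)%R).
  assert (Hs : (0 < e / s)%R) by (apply Rdiv_lt_0_compat; unfold s; lra).
  assert (Hd : (0 < Rmin (e / s) (g (pt a b) / 2))%R) by (apply Rmin_glb_lt; lra).
  exists (mkposreal _ Hd); simpl; split; [apply Rmin_r|]; intros x y hx hy.
  assert (h : (Rabs (g (pt x y) - g (pt a b)) < g (pt a b) / 2)%R).
  { apply K; replace (pt x y - pt a b) with (RtoC (x - a) * w1 + RtoC (y - b) * w2)
      by (unfold pt; rewrite !RtoC_minus; ring).
    eapply Rle_lt_trans; [apply Cmod_triangle|]; rewrite !Cmod_mult, !Cmod_R.
    assert (m := Rmin_l (e / s) (g (pt a b) / 2)).
    replace e with (e / s * s)%R by (field; unfold s; lra); unfold s at 2.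
    assert (q1 := Rabs_pos (x - a)); assert (q2 := Rabs_pos (y - b)); nra. }
  apply Rabs_def2 in h; lra. }
set (delta := fun a b => proj1_sig (constructive_indefinite_description _ (Hd a b))).
assert (Hdelta : forall a b, (delta a b <= g (pt a b) / 2)%R /\ forall x y,
  (Rabs (x - a) < delta a b)%R -> (Rabs (y - b) < delta a b)%R -> (g (pt a b) / 2 < g (pt x y))%R).
{ intros a b; apply (proj2_sig (constructive_indefinite_description _ (Hd a b))). }
destruct (compactness_value_2d 0 1 0 1 delta) as [d K].
exists d; split; [apply cond_pos|]; intros z.
destruct (coords_exist w1 w2 z Hi) as [a [b ->]].
destruct (unit_shift a) as [m Hm]; destruct (unit_shift b) as [n Hn].
replace (g (a * w1 + b * w2)) with (g (pt (a - IZR m)%R (b - IZR n)%R)).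
2:{ rewrite <- (Hper _ (IZR m * w1 + IZR n * w2)) by (now exists m, n); f_equal.
    unfold pt; rewrite !RtoC_minus; ring. }
apply Rnot_lt_le; intros Hlt; apply (K _ _ Hm Hn); intros [u [v [_ [_ [h1 [h2 h3]]]]]].
destruct (Hdelta u v) as [k1 k2]; specialize (k2 _ _ h1 h2); lra.
Qed.

Lemma ccont_Re (F : C -> C) : (forall z, ccont F z) -> rcont (fun z => Re (F z)).
Proof.
intros H z eps He; destruct (ccont_ball F z eps (H z) He) as [d [Hd K]].
exists d; split; auto; intros w Hw.
eapply Rle_lt_trans; [apply (re_le_Cmod (F w - F z)) | now apply K].
Qed.

(** The lower bound for positive functions is used twice: on [/ (1 + Cmod (F z))], to see that [F]
    is bounded, and then, if the infimum of [Re F] were not attained, on [Re F] minus its infimum,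
    which would push the infimum up. *)
Lemma periodic_min (w1 w2 : C) (F : C -> C) : R_independent w1 w2 ->
  (forall z, ccont F z) -> (forall z w, lattice w1 w2 w -> F (z + w) = F z) ->
  exists z0, forall z, (Re (F z0) <= Re (F z))%R.
Proof.
intros Hi Hc Hper.
destruct (periodic_pos_bound w1 w2 (fun z => / (1 + Cmod (F z)))%R Hi) as [d [Hd K]].
{ intros z eps He; destruct (ccont_ball F z eps (Hc z) He) as [d [Hd K]].
  exists d; split; auto; intros w Hw; specialize (K w Hw).
  assert (p := Cmod_ge_0 (F w)); assert (q := Cmod_ge_0 (F z)).
  replace (/ (1 + Cmod (F w)) - / (1 + Cmod (F z)))%R with
    ((Cmod (F z) - Cmod (F w)) * (/ (1 + Cmod (F w)) * / (1 + Cmod (F z))))%R by (field; lra).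
  rewrite Rabs_mult.
  assert (i1 : (0 < / (1 + Cmod (F w)) <= 1)%R).
  { split; [apply Rinv_0_lt_compat; lra|].
    rewrite <- Rinv_1; apply Rinv_le_contravar; lra. }
  assert (i2 : (0 < / (1 + Cmod (F z)) <= 1)%R).
  { split; [apply Rinv_0_lt_compat; lra|].
    rewrite <- Rinv_1; apply Rinv_le_contravar; lra. }
  assert (i3 : (0 < / (1 + Cmod (F w)) * / (1 + Cmod (F z)) <= 1)%R) by nra.
  rewrite (Rabs_right (/ _ * / _)) by lra.
  assert (t1 := Cmod_triangle (F z) (F w - F z)).
  assert (t2 := Cmod_triangle (F w) (- (F w - F z))).
  rewrite Cmod_opp in t2.
  replace (F z + (F w - F z)) with (F w) in t1 by ring.
  replace (F w + - (F w - F z)) with (F z) in t2 by ring.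
  assert (Rabs (Cmod (F z) - Cmod (F w)) < eps)%R by (apply Rabs_def1; lra).
  assert (h := Rabs_pos (Cmod (F z) - Cmod (F w))); nra. }
{ intros z; apply Rinv_0_lt_compat; assert (p := Cmod_ge_0 (F z)); lra. }
{ intros z w Hw; now rewrite Hper. }
destruct (completeness (fun t => exists z, t = (- Re (F z))%R)) as [m [Hub Hlub]].
{ exists (/ d)%R; intros t [z ->]; specialize (K z).
  assert (p := Cmod_ge_0 (F z)).
  apply Rinv_le_contravar in K; auto; rewrite Rinv_inv in K.
  assert (q := re_le_Cmod (F z)); assert (r := Rle_abs (- Re (F z))).
  rewrite Rabs_Ropp in r; lra. }
{ now exists (- Re (F 0))%R, 0. }
apply NNPP; intros Hn.
destruct (periodic_pos_bound w1 w2 (fun z => Re (F z) + m)%R Hi) as [e [He Ke]].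
{ intros z eps He; destruct (ccont_Re F Hc z eps He) as [e [He' K']].
  exists e; split; auto; intros w Hw.
  replace (Re (F w) + m - (Re (F z) + m))%R with (Re (F w) - Re (F z))%R by ring; auto. }
{ intros z; apply Rnot_le_lt; intros Hle; apply Hn; exists z; intros w.
  assert (- Re (F w) <= m)%R by (apply Hub; now exists w); lra. }
{ intros z w Hw; now rewrite Hper. }
assert (h : is_upper_bound (fun t => exists z, t = (- Re (F z))%R) (m - e)%R).
{ intros t [z ->]; specialize (Ke z); lra. }
specialize (Hlub _ h); lra.
Qed.

Lemma lat_punctured (L : C -> Prop) (z : C) : is_lattice L ->
  exists r, (0 < r)%R /\ forall w, (0 < Cmod (w - z) < r)%R -> ~ L w.
Proof.
intros HL; destruct (classic (L z)) as [Hz|Hz].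
- destruct (lat_disc L HL) as [d [Hd K]]; exists d; split; auto.
  intros w [h1 h2] Hw.
  assert (d <= Cmod (w - z))%R; [|lra].
  apply K; [now apply lat_sub | now apply Cmod_gt_0].
- destruct (lat_sep L z HL Hz) as [e [He K]]; exists e; split; auto.
  intros w [h1 h2] Hw; specialize (K w Hw).
  replace (z - w) with (- (w - z)) in K by ring; rewrite Cmod_opp in K; lra.
Qed.

(** Around a point where [Re F] is minimal [circle_min] makes it constant; the centre may be a
    lattice point, since a small punctured disc contains none. So on any segment from a minimum
    point the minimum is attained on a set both open and closed. *)
Lemma elliptic_Re_const (L : C -> Prop) (F F' : C -> C) : is_lattice L ->
  (forall z, ccont F z) -> (forall z w, L w -> F (z + w) = F z) ->
  (forall z, ~ L z -> cderiv F z (F' z) /\ ccont F' z) ->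
  forall z w, Re (F z) = Re (F w).
Proof.
intros HL Hc Hper HF.
assert (H : exists z0, forall z, (Re (F z0) <= Re (F z))%R).
{ destruct HL as [w1 [w2 [Hi ->]]]; now apply (periodic_min w1 w2). }
destruct H as [z0 Hmin].
enough (K : forall z, Re (F z) = Re (F z0)) by (intros z w; now rewrite !K).
intros z.
assert (Hline : forall s t : R, Cmod (z0 + s * (z - z0) - (z0 + t * (z - z0))) =
  (Rabs (s - t) * Cmod (z - z0))%R).
{ intros s t; rewrite <- Cmod_R, <- Cmod_mult, RtoC_minus; f_equal; ring. }
assert (Hd : exists k, (0 < k)%R /\ (Cmod (z - z0) <= k)%R).
{ exists (Cmod (z - z0) + 1)%R; assert (h := Cmod_ge_0 (z - z0)); lra. }
destruct Hd as [k [Hk Hzk]].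
assert (Hsmall : forall s t r, (Rabs (s - t) < r / k)%R ->
  (Cmod (z0 + RtoC s * (z - z0) - (z0 + RtoC t * (z - z0))) < r)%R).
{ intros s t r h; rewrite Hline.
  apply Rle_lt_trans with (Rabs (s - t) * k)%R.
  - apply Rmult_le_compat_l; auto using Rabs_pos.
  - replace r with (r / k * k)%R by (field; lra); now apply Rmult_lt_compat_r. }
replace z with (z0 + RtoC 1 * (z - z0)) at 1 by ring.
apply (clopen_real (fun t => Re (F (z0 + t * (z - z0))) = Re (F z0))).
- f_equal; f_equal; ring.
- intros t Ht; set (p := z0 + t * (z - z0)) in *.
  destruct (lat_punctured L p HL) as [r [Hr Kr]].
  exists (r / k)%R; split; [now apply Rdiv_lt_0_compat|]; intros s Hs.
  specialize (Hsmall s t r Hs); fold p in Hsmall.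
  assert (h := circle_min (fun x => F x - F p) F' p r).
  assert (h' : Re (F (z0 + s * (z - z0)) - F p) = 0%R).
  { apply h; auto.
    - intros x Hx; destruct (HF x (Kr x Hx)) as [h1 h2]; split; auto.
      replace (F' x) with (F' x - 0) by ring; apply cderiv_minus; auto using cderiv_const.
    - intros eps He; destruct (Hc p eps He) as [e [He' Ke]]; exists e; split; auto.
      intros x Hx; replace (F x - F p - (F p - F p)) with (F x - F p) by ring; auto.
    - ring.
    - intros x; specialize (Hmin x); unfold Re in *; simpl; lra. }
  rewrite <- Ht; unfold Re in *; simpl in h'; lra.
- intros t Ht; set (p := z0 + t * (z - z0)) in *.
  assert (Hpos : (0 < Re (F p) - Re (F z0))%R) by (specialize (Hmin p); lra).
  destruct (ccont_Re F Hc p _ Hpos) as [r [Hr Kr]].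
  exists (r / k)%R; split; [now apply Rdiv_lt_0_compat|]; intros s Hs.
  specialize (Kr _ (Hsmall s t r Hs)); apply Rabs_def2 in Kr; lra.
Qed.

(** The function is completed on the lattice by its limit [c], which periodicity carries from 0 to
    every lattice point. The imaginary part is the real part of [- Ci * G]. *)
Lemma elliptic_const (L : C -> Prop) (F F' : C -> C) (c : C) : is_lattice L ->
  (forall z, ~ L z -> cderiv F z (F' z) /\ ccont F' z) ->
  (forall z w, ~ L z -> L w -> F (z + w) = F z) -> clim 0 F c ->
  forall z, ~ L z -> F z = c.
Proof.
intros HL HF Hper Hlim z Hz.
set (G := fun z => if excluded_middle_informative (L z) then c else F z).
assert (Gin : forall z, L z -> G z = c).
{ intros x Hx; unfold G; destruct (excluded_middle_informative (L x)); easy. }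
assert (Gout : forall z, ~ L z -> G z = F z).
{ intros x Hx; unfold G; destruct (excluded_middle_informative (L x)); easy. }
assert (GF : forall z, ~ L z -> cderiv G z (F' z) /\ ccont F' z).
{ intros x Hx; destruct (HF x Hx) as [h1 h2]; split; auto.
  destruct (lat_sep L x HL Hx) as [e [He K]].
  apply cderiv_ext with F e; auto; intros y Hy; symmetry; apply Gout; intros Ly.
  specialize (K y Ly); replace (x - y) with (- (y - x)) in K by ring.
  rewrite Cmod_opp in K; lra. }
assert (Gper : forall z w, L w -> G (z + w) = G z).
{ intros x w Hw; destruct (classic (L x)) as [h|h].
  - rewrite !Gin; auto; now apply lat_add.
  - rewrite !Gout; auto; now rewrite lat_add_iff. }
assert (Gc : forall z, ccont G z).
{ intros x; destruct (classic (L x)) as [h|h]; [|eapply cderiv_cont, GF, h].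
  unfold ccont; rewrite (Gin x h); intros eps He.
  destruct (Hlim eps He) as [d [Hd K]].
  destruct (lat_punctured L 0 HL) as [r [Hr Kr]].
  exists (Rmin d r); split; [now apply Rmin_glb_lt|]; intros y [h1 h2].
  assert (h3 := Rlt_le_trans _ _ _ h2 (Rmin_l _ _)).
  assert (h4 := Rlt_le_trans _ _ _ h2 (Rmin_r _ _)).
  replace y with ((y - x) + x) by ring; rewrite Gper by auto.
  replace (y - x) with (y - x - 0) in h1, h3, h4 by ring.
  rewrite Gout by (now apply Kr); now apply K. }
rewrite <- (Gout z Hz), <- (Gin 0 (lat_0 L HL)).
apply Ceq_ReIm; [now apply (elliptic_Re_const L G F')|].
assert (E : forall x, Im (G x) = Re (- Ci * G x)) by (intros x; unfold Re, Im; simpl; ring).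
rewrite !E; apply (elliptic_Re_const L (fun z => - Ci * G z) (fun z => - Ci * F' z)); auto.
- intros x; apply clim_scal, Gc.
- intros x w Hw; now rewrite Gper.
- intros x Hx; destruct (GF x Hx); split; [now apply cderiv_scal | now apply clim_scal].
Qed.

(** * Weierstrass and Eisenstein sums *)

Definition eis (L : C -> Prop) (n : nat) (z : C) : C :=
  unordered_sum L (fun w => / (z - w) ^ n).

(* As [/ 0 = 0], the term [w = 0] is [/ z ^ 2]: the sum runs over all of [L]. *)
Definition wp (L : C -> Prop) (z : C) : C :=
  unordered_sum L (fun w => / (z - w) ^ 2 - / w ^ 2).

Definition gsum (L : C -> Prop) (n : nat) : C :=
  unordered_sum (nonzero_points L) (fun w => / w ^ n).

Lemma RtoC_neq (x : R) : x <> 0%R -> RtoC x <> 0.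
Proof. intros H E; now apply H, RtoC_inj. Qed.

Lemma Cinv_0 : / RtoC 0 = 0.
Proof. apply Ceq_ReIm; unfold Re, Im; simpl; unfold Rdiv; ring. Qed.

Lemma Cmod_inv_all (x : C) : Cmod (/ x) = (/ Cmod x)%R.
Proof.
destruct (Ceq_dec x 0) as [->|n]; [|now apply Cmod_inv].
now rewrite Cinv_0, Cmod_0, Rinv_0.
Qed.

Lemma Rdiv_le_compat (a b c d : R) : (0 <= a)%R -> (a <= c)%R -> (0 < d)%R -> (d <= b)%R ->
  (a * / b <= c * / d)%R.
Proof.
intros h1 h2 h3 h4; apply Rmult_le_compat; auto.
- left; apply Rinv_0_lt_compat; lra.
- now apply Rinv_le_contravar.
Qed.

Lemma pow_majorant (n : nat) (c t : R) (w : C) : (3 <= n)%nat -> (0 < c)%R ->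
  (c * (1 + Cmod w) <= t)%R -> (/ t ^ n <= / c ^ n * majorant w)%R.
Proof.
intros Hn Hc Ht; unfold majorant; rewrite <- Rinv_mult.
assert (h := Cmod_ge_0 w).
apply Rinv_le_contravar.
- apply Rmult_lt_0_compat; apply pow_lt; lra.
- apply Rle_trans with ((c * (1 + Cmod w)) ^ n)%R.
  + rewrite Rpow_mult_distr; apply Rmult_le_compat_l; [apply pow_le; lra|].
    apply Rle_pow; auto; lra.
  + apply pow_incr; split; auto; apply Rmult_le_pos; lra.
Qed.

Lemma Cmod_inv_pow_majorant (n : nat) (c : R) (x w : C) : (3 <= n)%nat -> (0 < c)%R ->
  (c * (1 + Cmod w) <= Cmod x)%R -> (Cmod (/ x ^ n) <= / c ^ n * majorant w)%R.
Proof. intros; rewrite Cmod_inv_all, Cmod_pow; now apply pow_majorant. Qed.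

Lemma lat_lower (L : C -> Prop) (z : C) : is_lattice L -> ~ L z ->
  exists c, (0 < c)%R /\ forall w, L w -> (c * (1 + Cmod w) <= Cmod (z - w))%R.
Proof.
intros HL Hz; destruct (lat_sep L z HL Hz) as [e [He K]].
assert (p := Cmod_ge_0 z).
(* From [|w| <= |z| + |z - w|] and [e <= |z - w|] follows [e (1 + |w|) <= e (1 + |z|) + e |z - w| <=
   (1 + |z| + e) |z - w|]. *)
exists (e / (1 + Cmod z + e))%R; split; [apply Rdiv_lt_0_compat; lra|].
intros w Hw; specialize (K w Hw).
assert (t : (Cmod w <= Cmod z + Cmod (z - w))%R).
{ replace w with (z + - (z - w)) at 1 by ring.
  eapply Rle_trans; [apply Cmod_triangle|]; rewrite Cmod_opp; lra. }
apply Rmult_le_reg_l with (1 + Cmod z + e)%R; [lra|].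
replace ((1 + Cmod z + e) * (e / (1 + Cmod z + e) * (1 + Cmod w)))%R
  with (e * (1 + Cmod w))%R by (field; lra).
nra.
Qed.

Lemma lat_lower_nz (L : C -> Prop) : is_lattice L ->
  exists c, (0 < c)%R /\ forall w, nonzero_points L w -> (c * (1 + Cmod w) <= Cmod w)%R.
Proof.
intros HL; destruct (lat_disc L HL) as [d [Hd K]].
exists (d / (1 + d))%R; split; [apply Rdiv_lt_0_compat; lra|].
intros w [Hw Hn]; specialize (K w Hw Hn).
apply Rmult_le_reg_l with (1 + d)%R; [lra|].
replace ((1 + d) * (d / (1 + d) * (1 + Cmod w)))%R with (d * (1 + Cmod w))%R by (field; lra).
nra.
Qed.

Lemma lat_summable_nz (L : C -> Prop) : is_lattice L ->
  exists M, sum_bound (nonzero_points L) majorant M.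
Proof.
intros HL; destruct (lat_summable L HL) as [M HM]; exists M; intros A h1 h2.
apply HM; auto; eapply Forall_impl; [|apply h2]; intros w [Hw _]; auto.
Qed.

Lemma inv_pow_pos (c : R) (n : nat) : (0 < c)%R -> (0 <= / c ^ n)%R.
Proof. intros; left; apply Rinv_0_lt_compat, pow_lt; auto. Qed.

Lemma eis_has_sum (L : C -> Prop) (n : nat) (z : C) : is_lattice L -> (3 <= n)%nat -> ~ L z ->
  has_sum L (fun w => / (z - w) ^ n) (eis L n z).
Proof.
intros HL Hn Hz; destruct (lat_lower L z HL Hz) as [c [Hc K]].
destruct (lat_summable L HL) as [M HM].
destruct (has_sum_dominated L (fun w => / (z - w) ^ n) majorant (/ c ^ n)%R M) as [l Hl]; auto.
- now apply inv_pow_pos.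
- intros w Hw; apply Cmod_inv_pow_majorant; auto.
- unfold eis; now rewrite (unordered_sum_eq _ _ _ Hl).
Qed.

Lemma gsum_has_sum (L : C -> Prop) (n : nat) : is_lattice L -> (3 <= n)%nat ->
  has_sum (nonzero_points L) (fun w => / w ^ n) (gsum L n).
Proof.
intros HL Hn; destruct (lat_lower_nz L HL) as [c [Hc K]].
destruct (lat_summable_nz L HL) as [M HM].
destruct (has_sum_dominated (nonzero_points L) (fun w => / w ^ n) majorant (/ c ^ n)%R M) as [l Hl]; auto.
- now apply inv_pow_pos.
- intros w Hw; apply Cmod_inv_pow_majorant; auto.
- unfold gsum; now rewrite (unordered_sum_eq _ _ _ Hl).
Qed.

Lemma lat_sub_neq0 (L : C -> Prop) (z w : C) : ~ L z -> L w -> z - w <> 0.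
Proof. intros Hz Hw E; apply Hz; replace z with w; auto; symmetry; now apply Ceq_minus. Qed.

Lemma wp_has_sum (L : C -> Prop) (z : C) : is_lattice L -> ~ L z ->
  has_sum L (fun w => / (z - w) ^ 2 - / w ^ 2) (wp L z).
Proof.
intros HL Hz; destruct (lat_lower L z HL Hz) as [c [Hc K]].
destruct (lat_lower_nz L HL) as [c' [Hc' K']].
destruct (lat_summable L HL) as [M HM].
assert (pz := Cmod_ge_0 z).
(* The term is [z (2 w - z) / ((z - w)^2 w^2)]; with [t = 1 + |w|] the numerator is at most
   [|z| (2 + |z|) t] and the denominator at least [c^2 c'^2 t^4]. *)
set (B := (Cmod z * (2 + Cmod z) * / (c ^ 2 * c' ^ 2))%R).
assert (HB : (0 <= B)%R).
{ apply Rmult_le_pos; [nra|]; left; apply Rinv_0_lt_compat.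
  apply Rmult_lt_0_compat; apply pow_lt; auto. }
assert (HZ := Cmod_ge_0 (/ z ^ 2)).
(* The second constant covers [w = 0], where the term is [/ z ^ 2] and the majorant is 1. *)
destruct (has_sum_dominated L (fun w => / (z - w) ^ 2 - / w ^ 2) majorant
  (B + Cmod (/ z ^ 2))%R M) as [l Hl]; auto; [lra| |].
- intros w Hw; destruct (Ceq_dec w 0) as [->|n].
  + unfold majorant; rewrite Cmod_0, Rplus_0_r, pow1, Rinv_1, Rmult_1_r.
    replace (/ (z - 0) ^ 2 - / 0 ^ 2) with (/ z ^ 2); [lra|].
    replace (RtoC 0 ^ 2) with (RtoC 0) by ring.
    rewrite Cinv_0; replace (z - 0) with z by ring; ring.
  + assert (h1 := K w Hw); assert (h2 := K' w (conj Hw n)).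
    assert (pw := Cmod_ge_0 w).
    assert (n1 := lat_sub_neq0 L z w Hz Hw).
    replace (/ (z - w) ^ 2 - / w ^ 2) with (z * (2 * w - z) * / ((z - w) ^ 2 * w ^ 2))
      by (field; auto).
    rewrite !Cmod_mult, Cmod_inv_all, Cmod_mult, !Cmod_pow.
    apply Rle_trans with (B * majorant w)%R.
    2:{ apply Rmult_le_compat_r; [left; apply majorant_pos | lra]. }
    set (t := (1 + Cmod w)%R) in *.
    assert (Ht : (0 < t)%R) by (unfold t; lra).
    apply Rle_trans with (Cmod z * ((2 + Cmod z) * t) * / ((c * t) ^ 2 * (c' * t) ^ 2))%R.
    * apply Rdiv_le_compat.
      -- apply Rmult_le_pos; auto; apply Cmod_ge_0.
      -- apply Rmult_le_compat_l; auto.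
         eapply Rle_trans; [apply (Cmod_triangle (2 * w) (- z))|].
         rewrite Cmod_opp, Cmod_mult, Cmod_R, Rabs_right by lra; unfold t; nra.
      -- apply Rmult_lt_0_compat; apply pow_lt, Rmult_lt_0_compat; auto.
      -- apply Rmult_le_compat; try (apply pow_le, Rmult_le_pos; lra);
         apply pow_incr; split; auto; apply Rmult_le_pos; lra.
    * right; unfold B, majorant; fold t; field; repeat split; lra.
- unfold wp; now rewrite (unordered_sum_eq _ _ _ Hl).
Qed.

Lemma has_sum_split0 (L : C -> Prop) (f : C -> C) (s : C) : L 0 ->
  has_sum L f s -> has_sum (nonzero_points L) f (s - f 0).
Proof.
intros H0 Hs eps He; destruct (Hs eps He) as [A [HA HB]].
set (p := fun x => if Ceq_dec x 0 then false else true).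
exists (filter p A); split.
- rewrite Forall_forall in *; intros x Hx; apply filter_In in Hx; destruct Hx as [h1 h2].
  split; auto; unfold p in h2; destruct (Ceq_dec x 0); easy.
- intros B h1 h2 h3.
  replace (list_sum f B - (s - f 0)) with (list_sum f (RtoC 0 :: B) - s) by (simpl; ring).
  rewrite Forall_forall in h2; apply HB.
  + constructor; auto; intros Hi; now destruct (h2 _ Hi).
  + constructor; auto; rewrite Forall_forall; intros x Hx; now destruct (h2 _ Hx).
  + intros x Hx; destruct (Ceq_dec x 0) as [->|n]; [now left|right].
    apply h3, filter_In; split; auto; unfold p; now destruct (Ceq_dec x 0).
Qed.

Lemma wp_lattice_out (L : C -> Prop) (z : C) : is_lattice L -> ~ L z ->
  wp_lattice L z = Some (wp L z).
Proof.
intros HL Hz; unfold wp_lattice; destruct (excluded_middle_informative (L z)); [easy|].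
assert (h := has_sum_split0 L _ _ (lat_0 L HL) (wp_has_sum L z HL Hz)).
rewrite (unordered_sum_eq _ _ _ h); f_equal.
replace (RtoC 0 ^ 2) with (RtoC 0) by ring.
rewrite Cinv_0; replace (z - 0) with z by ring; ring.
Qed.

Lemma wp_lattice_in (L : C -> Prop) (z : C) : L z -> wp_lattice L z = None.
Proof. intros Hz; unfold wp_lattice; now destruct (excluded_middle_informative (L z)). Qed.

(** * Taylor expansions and derivatives of the lattice sums *)

Lemma Cmod_add_half (x h : C) : (Cmod h <= Cmod x / 2)%R -> (Cmod x / 2 <= Cmod (x + h))%R.
Proof.
intros Hh; assert (t := Cmod_triangle (x + h) (- h)); rewrite Cmod_opp in t.
replace (x + h + - h) with x in t by ring; lra.
Qed.

(** The constant must not depend on [x], because the estimate is summed over all [x = z - w]. In the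
    induction the remainder is multiplied by [/ (x + h)], of modulus at most [2 / |x|], and a new
    term of size [(n + 1) |h|^2 |x + h|^-1 |x|^-(n+2)] appears, whence the recursion for [K]. *)
Lemma inv_pow_taylor (n : nat) : exists K, (0 <= K)%R /\ forall x h : C, x <> 0 ->
  (Cmod h <= Cmod x / 2)%R ->
  (Cmod (/ (x + h) ^ n - / x ^ n + INR n * h * / x ^ (n + 1)) <=
    K * Cmod h ^ 2 * / Cmod x ^ (n + 2))%R.
Proof.
induction n as [|n [K [HK IH]]].
- exists 0%R; split; [lra|]; intros x h Hx Hh; simpl.
  replace (/ 1 - / 1 + 0 * h * / (x * 1)) with (RtoC 0) by ring.
  rewrite Cmod_0; lra.
- exists (2 * K + 2 * INR (S n))%R.
  assert (Pn := pos_INR (S n)).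
  split; [lra|]; intros x h Hx Hh.
  assert (Px : (0 < Cmod x)%R) by now apply Cmod_gt_0.
  assert (Hxh := Cmod_add_half x h Hh).
  assert (Nxh : x + h <> 0) by (apply Cmod_gt_0; lra).
  specialize (IH x h Hx Hh).
  replace (/ (x + h) ^ S n - / x ^ S n + INR (S n) * h * / x ^ (S n + 1)) with
    (/ (x + h) * (/ (x + h) ^ n - / x ^ n + INR n * h * / x ^ (n + 1)) +
     INR (S n) * (h ^ 2 * / (x + h) * / x ^ (n + 2))).
  2:{ rewrite S_INR, RtoC_plus, !Cpow_add_r, !Cpow_S.
      replace (n + 1)%nat with (S n) by lia.
      simpl Cpow; field; repeat split; auto using Cpow_nz. }
  assert (Hinv : (Cmod (/ (x + h)) <= 2 * / Cmod x)%R).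
  { rewrite Cmod_inv_all; replace (2 * / Cmod x)%R with (/ (Cmod x / 2))%R by (field; lra).
    apply Rinv_le_contravar; lra. }
  eapply Rle_trans; [apply Cmod_triangle|].
  rewrite !Cmod_mult, Cmod_pow, (Cmod_inv_all (x ^ (n + 2))), Cmod_pow, Cmod_R, Rabs_right by lra.
  replace (S n + 2)%nat with (S (n + 2)) by lia; simpl pow.
  set (y := Cmod _) at 2.
  set (X := (Cmod x ^ (n + 2))%R) in *.
  assert (PX : (0 < X)%R) by (apply pow_lt; auto).
  assert (PX' : (0 < / X)%R) by (apply Rinv_0_lt_compat; auto).
  assert (Px' : (0 < / Cmod x)%R) by (apply Rinv_0_lt_compat; auto).
  assert (Ph := Cmod_ge_0 h).
  rewrite Rinv_mult.
  assert (E1 : (Cmod (/ (x + h)) * y <= 2 * / Cmod x * (K * Cmod h ^ 2 * / X))%R).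
  { apply Rmult_le_compat; auto using Cmod_ge_0; apply Cmod_ge_0. }
  assert (E2 : (INR (S n) * (Cmod h ^ 2 * Cmod (/ (x + h)) * / X) <=
    INR (S n) * (Cmod h ^ 2 * (2 * / Cmod x) * / X))%R).
  { apply Rmult_le_compat_l; auto; apply Rmult_le_compat_r; [lra|].
    apply Rmult_le_compat_l; auto; apply pow_le; auto. }
  replace (Cmod h * (Cmod h * 1))%R with (Cmod h ^ 2)%R in * by ring.
  eapply Rle_trans; [apply Rplus_le_compat; [apply E1 | apply E2]|].
  right; ring.
Qed.

(** One radius for [h] serves all lattice points at once, since [c <= |z - w|] for each of them;
    this is the smallness condition of the Taylor estimates. *)
Lemma lat_near (L : C -> Prop) (z : C) : is_lattice L -> ~ L z ->
  exists c, (0 < c)%R /\ forall h, (Cmod h < c / 2)%R -> ~ L (z + h) /\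
   forall w, L w -> (c * (1 + Cmod w) <= Cmod (z - w))%R /\ (Cmod h <= Cmod (z - w) / 2)%R.
Proof.
intros HL Hz; destruct (lat_lower L z HL Hz) as [c [Hc K]]; exists c; split; auto.
assert (K' : forall h w, (Cmod h < c / 2)%R -> L w ->
  (c * (1 + Cmod w) <= Cmod (z - w))%R /\ (Cmod h <= Cmod (z - w) / 2)%R).
{ intros h w Hh Hw; specialize (K w Hw); split; auto; assert (p := Cmod_ge_0 w); nra. }
intros h Hh; split; [|intros w Hw; now apply K'].
intros Hw; destruct (K' h _ Hh Hw) as [h1 h2].
replace (z - (z + h)) with (- h) in h1, h2 by ring; rewrite Cmod_opp in h1, h2.
assert (p := Cmod_ge_0 (z + h)); nra.
Qed.

Lemma eis_cderiv (L : C -> Prop) (n : nat) (z : C) : is_lattice L -> (3 <= n)%nat -> ~ L z ->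
  cderiv (eis L n) z (- (INR n * eis L (n + 1) z)).
Proof.
intros HL Hn Hz; destruct (lat_near L z HL Hz) as [c [Hc Hnear]].
destruct (lat_summable L HL) as [M HM].
destruct (inv_pow_taylor n) as [K [HK HT]].
apply cderiv_quad with (K * / c ^ (n + 2) * M)%R (c / 2)%R; [lra|].
intros h Hh; destruct (Hnear h Hh) as [Hzh Hw].
assert (S1 := has_sum_minus _ _ _ _ _ (eis_has_sum L n (z + h) HL Hn Hzh) (eis_has_sum L n z HL Hn Hz)).
assert (S2 := has_sum_plus _ _ _ _ _ S1
  (has_sum_scal _ _ (INR n * h) _ (eis_has_sum L (n + 1) z HL ltac:(lia) Hz))).
replace (eis L n (z + h) - eis L n z - - (INR n * eis L (n + 1) z) * h) with
  (eis L n (z + h) - eis L n z + INR n * h * eis L (n + 1) z) by ring.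
replace (K * / c ^ (n + 2) * M * Cmod h ^ 2)%R with (K * Cmod h ^ 2 * / c ^ (n + 2) * M)%R by ring.
assert (P2 : (0 <= Cmod h ^ 2)%R) by (apply pow_le, Cmod_ge_0).
apply has_sum_bound with (4 := S2) (m := majorant); auto.
- apply Rmult_le_pos; [apply Rmult_le_pos|]; auto using inv_pow_pos.
- intros w Lw; destruct (Hw w Lw) as [h1 h2].
  replace (z + h - w) with (z - w + h) by ring.
  eapply Rle_trans; [apply HT; auto; now apply lat_sub_neq0 with L|].
  rewrite (Rmult_assoc (K * _)); apply Rmult_le_compat_l; [now apply Rmult_le_pos|].
  apply pow_majorant; auto; lia.
Qed.

(** The expansion goes to second order because at a half period the linear term vanishes and the
    quadratic one gives the limit in [half_product]. *)
Lemma wp_taylor (L : C -> Prop) (z : C) : is_lattice L -> ~ L z ->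
  exists K r, (0 < r)%R /\ forall h, (Cmod h < r)%R -> ~ L (z + h) /\
  (Cmod (wp L (z + h) - wp L z + 2 * h * eis L 3 z - 3 * h ^ 2 * eis L 4 z) <= K * Cmod h ^ 3)%R.
Proof.
intros HL Hz; destruct (lat_near L z HL Hz) as [c [Hc Hnear]].
destruct (lat_summable L HL) as [M HM].
(* Since [|h| <= |x| / 2], [|4 x + 3 h| <= 11/2 |x|] and [|x + h|^2 >= |x|^2 / 4]; 22 is
   [11/2 * 4]. *)
exists (22 * / c ^ 5 * M)%R, (c / 2)%R; split; [lra|].
intros h Hh; destruct (Hnear h Hh) as [Hzh Hw]; split; auto.
assert (S1 := has_sum_minus _ _ _ _ _ (wp_has_sum L (z + h) HL Hzh) (wp_has_sum L z HL Hz)).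
assert (S2 := has_sum_plus _ _ _ _ _ S1
  (has_sum_scal _ _ (2 * h) _ (eis_has_sum L 3 z HL ltac:(lia) Hz))).
assert (S3 := has_sum_minus _ _ _ _ _ S2
  (has_sum_scal _ _ (3 * h ^ 2) _ (eis_has_sum L 4 z HL ltac:(lia) Hz))).
replace (22 * / c ^ 5 * M * Cmod h ^ 3)%R with (22 * Cmod h ^ 3 * / c ^ 5 * M)%R by ring.
assert (P3 : (0 <= Cmod h ^ 3)%R) by (apply pow_le, Cmod_ge_0).
apply has_sum_bound with (4 := S3) (m := majorant); auto.
- apply Rmult_le_pos; [lra | auto using inv_pow_pos].
- intros w Lw; destruct (Hw w Lw) as [h1 h2]; cbv beta.
  assert (n1 := lat_sub_neq0 L z w Hz Lw).
  assert (n2 := lat_sub_neq0 L (z + h) w Hzh Lw).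
  set (x := z - w) in *.
  replace (z + h - w) with (x + h) in * by (unfold x; ring).
  replace (/ (x + h) ^ 2 - / w ^ 2 - (/ x ^ 2 - / w ^ 2) + 2 * h * / x ^ 3 - 3 * h ^ 2 * / x ^ 4)
    with (- (h ^ 3 * (4 * x + 3 * h)) * / (x ^ 4 * (x + h) ^ 2)).
  2:{ generalize (/ w ^ 2); intros y; field; auto. }
  assert (Px : (0 < Cmod x)%R) by now apply Cmod_gt_0.
  assert (Hxh := Cmod_add_half x h h2).
  rewrite Cmod_mult, Cmod_opp, Cmod_inv_all, !Cmod_mult, !Cmod_pow.
  apply Rle_trans with (Cmod h ^ 3 * (11 / 2 * Cmod x) * / (Cmod x ^ 4 * (Cmod x / 2) ^ 2))%R.
  + apply Rdiv_le_compat.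
    * apply Rmult_le_pos; auto; apply Cmod_ge_0.
    * apply Rmult_le_compat_l; auto.
      eapply Rle_trans; [apply Cmod_triangle|]; rewrite !Cmod_mult, !Cmod_R, !Rabs_right by lra; lra.
    * apply Rmult_lt_0_compat; apply pow_lt; lra.
    * apply Rmult_le_compat_l; [apply pow_le; lra | apply pow_incr; lra].
  + replace (Cmod h ^ 3 * (11 / 2 * Cmod x) * / (Cmod x ^ 4 * (Cmod x / 2) ^ 2))%R
      with (22 * Cmod h ^ 3 * / Cmod x ^ 5)%R by (field; lra).
    rewrite (Rmult_assoc (22 * _)); apply Rmult_le_compat_l; [lra|].
    apply pow_majorant; auto; lia.
Qed.

Lemma wp_cderiv (L : C -> Prop) (z : C) : is_lattice L -> ~ L z ->
  cderiv (wp L) z (-2 * eis L 3 z).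
Proof.
intros HL Hz; destruct (wp_taylor L z HL Hz) as [K [r [Hr H]]].
assert (p4 := Cmod_ge_0 (eis L 4 z)).
apply cderiv_quad with (Rabs K + 3 * Cmod (eis L 4 z))%R (Rmin r 1); [apply Rmin_glb_lt; lra|].
intros h Hh.
assert (h1 := Rlt_le_trans _ _ _ Hh (Rmin_l _ _)).
assert (h2 := Rlt_le_trans _ _ _ Hh (Rmin_r _ _)).
destruct (H h h1) as [_ B].
replace (wp L (z + h) - wp L z - -2 * eis L 3 z * h) with
  ((wp L (z + h) - wp L z + 2 * h * eis L 3 z - 3 * h ^ 2 * eis L 4 z) + 3 * h ^ 2 * eis L 4 z)
  by (replace (RtoC (-2)) with (- RtoC 2) by (rewrite <- RtoC_opp; f_equal; lra); ring).
eapply Rle_trans; [apply Cmod_triangle|].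
rewrite !Cmod_mult, Cmod_pow, Cmod_R, Rabs_right by lra.
assert (ph := Cmod_ge_0 h); assert (pk := Rle_abs K); assert (pk' := Rabs_pos K).
assert (P2 : (0 <= Cmod h ^ 2)%R) by now apply pow_le.
assert (E : (K * Cmod h ^ 3 <= Rabs K * Cmod h ^ 2)%R).
{ apply Rle_trans with (Rabs K * Cmod h ^ 3)%R.
  - apply Rmult_le_compat_r; auto; now apply pow_le.
  - apply Rmult_le_compat_l; auto; simpl; simpl in P2; nra. }
lra.
Qed.

(** * Parity, translation, and vanishing of the odd lattice sums *)

Lemma has_sum_opp_reindex (D : C -> Prop) (f : C -> C) (l : C) :
  (forall w, D w -> D (- w)) -> has_sum D f l -> has_sum D (fun w => f (- w)) l.
Proof.
intros HD; apply has_sum_reindex with (fun w => - w); auto; intros; ring.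
Qed.

Lemma has_sum_shift_reindex (L : C -> Prop) (v : C) (f : C -> C) (l : C) : is_lattice L -> L v ->
  has_sum L f l -> has_sum L (fun w => f (w + v)) l.
Proof.
intros HL Hv; apply has_sum_reindex with (fun w => w - v).
- intros w Hw; now apply lat_add.
- intros w Hw; now apply lat_sub.
- intros; ring.
- intros; ring.
Qed.

Lemma wp_even (L : C -> Prop) (z : C) : is_lattice L -> ~ L z -> wp L (- z) = wp L z.
Proof.
intros HL Hz; assert (Hz' : ~ L (- z)) by now rewrite lat_opp_iff.
apply has_sum_unique with (2 := wp_has_sum L z HL Hz).
apply has_sum_ext with (2 := has_sum_opp_reindex _ _ _ (fun w => lat_opp L w HL)
  (wp_has_sum L (- z) HL Hz')).
intros w _; replace ((- z - - w) ^ 2) with ((z - w) ^ 2) by ring.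
now replace ((- w) ^ 2) with (w ^ 2) by ring.
Qed.

Lemma eis3_odd (L : C -> Prop) (z : C) : is_lattice L -> ~ L z -> eis L 3 (- z) = - eis L 3 z.
Proof.
intros HL Hz; assert (Hz' : ~ L (- z)) by now rewrite lat_opp_iff.
replace (- eis L 3 z) with ((-1) * eis L 3 z) by ring.
apply has_sum_unique with (2 := has_sum_scal _ _ (-1) _ (eis_has_sum L 3 z HL ltac:(lia) Hz)).
apply has_sum_ext with (2 := has_sum_opp_reindex _ _ _ (fun w => lat_opp L w HL)
  (eis_has_sum L 3 (- z) HL ltac:(lia) Hz')).
intros w Hw; assert (n := lat_sub_neq0 L z w Hz Hw).
replace (- z - - w) with (- (z - w)) by ring.
replace ((- (z - w)) ^ 3) with (- (z - w) ^ 3) by ring.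
set (y := (z - w) ^ 3); assert (Hy : y <> 0) by now apply Cpow_nz.
field; auto.
Qed.

Lemma eis_periodic (L : C -> Prop) (n : nat) (z v : C) : is_lattice L -> (3 <= n)%nat ->
  ~ L z -> L v -> eis L n (z + v) = eis L n z.
Proof.
intros HL Hn Hz Hv; assert (Hz' : ~ L (z + v)) by now rewrite lat_add_iff.
apply has_sum_unique with (2 := eis_has_sum L n z HL Hn Hz).
apply has_sum_ext with (2 := has_sum_shift_reindex _ v _ _ HL Hv (eis_has_sum L n (z + v) HL Hn Hz')).
intros w _; do 2 f_equal; ring.
Qed.

Lemma nonzero_opp (L : C -> Prop) (w : C) : is_lattice L -> nonzero_points L w -> nonzero_points L (- w).
Proof.
intros HL [h1 h2]; split; [now apply lat_opp|]; intros E; apply h2.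
replace w with (- - w) by ring; rewrite E; ring.
Qed.

Lemma gsum_odd_0 (L : C -> Prop) (n : nat) : is_lattice L -> (n = 3 \/ n = 5)%nat -> gsum L n = 0.
Proof.
intros HL Hn; assert (H3 : (3 <= n)%nat) by lia.
assert (E : gsum L n = (-1) * gsum L n).
{ apply has_sum_unique with (2 := has_sum_scal _ _ (-1) _ (gsum_has_sum L n HL H3)).
  apply has_sum_ext with (2 := has_sum_opp_reindex _ _ _ (fun w => nonzero_opp L w HL) (gsum_has_sum L n HL H3)).
  intros w [_ Hw]; assert (Hw' : - w <> 0).
  { intros E; apply Hw; replace w with (- - w) by ring; rewrite E; ring. }
  destruct Hn; subst n; field; auto. }
replace (gsum L n) with ((gsum L n - (-1) * gsum L n) / 2) by field.
rewrite <- E; field.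
Qed.

(** * Laurent expansions at the origin *)

Lemma frac_bound (a b : C) (A B : R) : (Cmod a <= A)%R -> (0 < B)%R -> (B <= Cmod b)%R ->
  (Cmod (a * / b) <= A * / B)%R.
Proof.
intros h1 h2 h3; rewrite Cmod_mult, Cmod_inv_all; apply Rdiv_le_compat; auto using Cmod_ge_0.
Qed.

Lemma has_sum_remainder (L : C -> Prop) (f : C -> C) (c K M t s : R) (n : nat) (S : C) :
  (0 < c)%R -> (forall w, nonzero_points L w -> c * (1 + Cmod w) <= Cmod w)%R ->
  sum_bound (nonzero_points L) majorant M -> (0 <= K)%R -> (0 <= t)%R -> (3 <= n)%nat ->
  has_sum (nonzero_points L) f S ->
  (forall w, nonzero_points L w -> (Cmod (f w) <= t * (K * / Cmod w ^ n))%R) ->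
  (Cmod S <= K * / c ^ n * M * t)%R.
Proof.
intros Hc Hcw HM HK Ht Hn HS Hf.
replace (K * / c ^ n * M * t)%R with (t * (K * / c ^ n) * M)%R by ring.
apply has_sum_bound with (4 := HS) (m := majorant); auto.
- apply Rmult_le_pos; auto; apply Rmult_le_pos; auto using inv_pow_pos.
- intros w Hw; eapply Rle_trans; [apply Hf; auto|].
  rewrite (Rmult_assoc t); apply Rmult_le_compat_l; auto.
  rewrite (Rmult_assoc K); apply Rmult_le_compat_l; auto.
  apply pow_majorant; auto.
Qed.

Lemma laurent_setup (L : C -> Prop) : is_lattice L -> exists r, (0 < r)%R /\ (r <= 1)%R /\
  forall z, (0 < Cmod z < r)%R -> z <> 0 /\ ~ L z /\
   forall w, nonzero_points L w -> w <> 0 /\ z - w <> 0 /\ (0 < Cmod w)%R /\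
     (Cmod z <= Cmod w / 2)%R /\ (Cmod w / 2 <= Cmod (z - w))%R.
Proof.
intros HL; destruct (lat_disc L HL) as [d [Hd K]].
exists (Rmin 1 (d / 2)); split; [apply Rmin_glb_lt; lra|].
split; [apply Rmin_l|].
intros z [h1 h2]; assert (h3 := Rlt_le_trans _ _ _ h2 (Rmin_r _ _)).
assert (n0 : z <> 0) by now apply Cmod_gt_0.
assert (nz : ~ L z) by (intros Lz; specialize (K z Lz n0); lra).
split; [|split]; auto; intros w [Lw n]; specialize (K w Lw n).
split; [|split; [|split; [|split]]]; auto; try lra.
- now apply lat_sub_neq0 with L.
- replace (z - w) with (- (w + - z)) by ring; rewrite Cmod_opp.
  apply Cmod_add_half; rewrite Cmod_opp; lra.
Qed.

Lemma Cmod_nat_scal (k : R) (x : C) : (0 <= k)%R -> Cmod (k * x) = (k * Cmod x)%R.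
Proof. intros h; rewrite Cmod_mult, Cmod_R, Rabs_right; lra. Qed.

(** Termwise [/ (z - w)^2 - / w^2] is the series of [(k + 1) z^k / w^(k+2)] over [k >= 1]. Four
    terms are subtracted, those with odd exponent [k] contributing nothing after summation, and an
    exact fraction of order [z^5] remains. *)
Lemma wp_laurent (L : C -> Prop) : is_lattice L -> exists K r, (0 < r)%R /\
  forall z, (0 < Cmod z < r)%R -> z <> 0 /\ ~ L z /\
  (Cmod (wp L z - / z ^ 2 - 3 * gsum L 4 * z ^ 2 - 5 * gsum L 6 * z ^ 4) <= K * Cmod z ^ 5)%R.
Proof.
intros HL; destruct (laurent_setup L HL) as [r [Hr [_ Hset]]].
destruct (lat_lower_nz L HL) as [c [Hc Kc]].
destruct (lat_summable_nz L HL) as [M HM].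
(* [|6 w - 5 z| <= 9 |w|] and [|z - w|^2 >= |w|^2 / 4] give [9 * 4]. *)
exists (36 * / c ^ 7 * M)%R, r; split; auto.
intros z Hz; destruct (Hset z Hz) as [n0 [Lz Hw]]; split; [|split]; auto.
assert (S0 := has_sum_split0 L _ _ (lat_0 L HL) (wp_has_sum L z HL Lz)); cbv beta in S0.
assert (S1 := has_sum_minus _ _ _ _ _ S0 (has_sum_scal _ _ (2 * z) _ (gsum_has_sum L 3 HL ltac:(lia)))).
assert (S2 := has_sum_minus _ _ _ _ _ S1 (has_sum_scal _ _ (3 * z ^ 2) _ (gsum_has_sum L 4 HL ltac:(lia)))).
assert (S3 := has_sum_minus _ _ _ _ _ S2 (has_sum_scal _ _ (4 * z ^ 3) _ (gsum_has_sum L 5 HL ltac:(lia)))).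
assert (S4 := has_sum_minus _ _ _ _ _ S3 (has_sum_scal _ _ (5 * z ^ 4) _ (gsum_has_sum L 6 HL ltac:(lia)))).
rewrite (gsum_odd_0 L 3 HL), (gsum_odd_0 L 5 HL) in S4 by auto.
replace (wp L z - (/ (z - 0) ^ 2 - / 0 ^ 2) - 2 * z * 0 - 3 * z ^ 2 * gsum L 4
  - 4 * z ^ 3 * 0 - 5 * z ^ 4 * gsum L 6) with
  (wp L z - / z ^ 2 - 3 * gsum L 4 * z ^ 2 - 5 * gsum L 6 * z ^ 4) in S4.
2:{ replace (RtoC 0 ^ 2) with (RtoC 0) by ring; rewrite Cinv_0.
    replace (z - 0) with z by ring; ring. }
apply has_sum_remainder with (8 := S4); auto; try lia; try lra; [apply pow_le, Cmod_ge_0|].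
intros w Dw; destruct (Hw w Dw) as [nw [nzw [pw [h1 h2]]]].
replace (/ (z - w) ^ 2 - / w ^ 2 - 2 * z * / w ^ 3 - 3 * z ^ 2 * / w ^ 4 - 4 * z ^ 3 * / w ^ 5 -
  5 * z ^ 4 * / w ^ 6) with (z ^ 5 * ((6 * w - 5 * z) * / (w ^ 6 * (z - w) ^ 2))) by (field; auto).
rewrite Cmod_mult, Cmod_pow; apply Rmult_le_compat_l; [apply pow_le, Cmod_ge_0|].
replace (36 * / Cmod w ^ 7)%R with (9 * Cmod w * / (Cmod w ^ 6 * (Cmod w / 2) ^ 2))%R by (field; lra).
apply frac_bound.
- eapply Rle_trans; [apply (Cmod_triangle (6 * w) (- (5 * z)))|].
  rewrite Cmod_opp, !Cmod_nat_scal by lra; lra.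
- apply Rmult_lt_0_compat; apply pow_lt; lra.
- rewrite Cmod_mult, !Cmod_pow; apply Rmult_le_compat_l; [apply pow_le; lra | apply pow_incr; lra].
Qed.

(** The coefficients 1, 3, 6, 10 are those of [(1 - x)^(-3)]; as before the odd lattice sums drop
    out. *)
Lemma eis3_laurent (L : C -> Prop) : is_lattice L -> exists K r, (0 < r)%R /\
  forall z, (0 < Cmod z < r)%R -> z <> 0 /\ ~ L z /\
  (Cmod (eis L 3 z - / z ^ 3 + 3 * gsum L 4 * z + 10 * gsum L 6 * z ^ 3) <= K * Cmod z ^ 4)%R.
Proof.
intros HL; destruct (laurent_setup L HL) as [r [Hr [_ Hset]]].
destruct (lat_lower_nz L HL) as [c [Hc Kc]].
destruct (lat_summable_nz L HL) as [M HM].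
(* The numerator is at most [(15 + 12 + 5/2) |w|^2 <= 30 |w|^2], and [|z - w|^3 >= |w|^3 / 8]
   contributes the factor 8. *)
exists (240 * / c ^ 7 * M)%R, r; split; auto.
intros z Hz; destruct (Hset z Hz) as [n0 [Lz Hw]]; split; [|split]; auto.
assert (S0 := has_sum_split0 L _ _ (lat_0 L HL) (eis_has_sum L 3 z HL ltac:(lia) Lz)); cbv beta in S0.
assert (S1 := has_sum_plus _ _ _ _ _ S0 (gsum_has_sum L 3 HL ltac:(lia))).
assert (S2 := has_sum_plus _ _ _ _ _ S1 (has_sum_scal _ _ (3 * z) _ (gsum_has_sum L 4 HL ltac:(lia)))).
assert (S3 := has_sum_plus _ _ _ _ _ S2 (has_sum_scal _ _ (6 * z ^ 2) _ (gsum_has_sum L 5 HL ltac:(lia)))).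
assert (S4 := has_sum_plus _ _ _ _ _ S3 (has_sum_scal _ _ (10 * z ^ 3) _ (gsum_has_sum L 6 HL ltac:(lia)))).
rewrite (gsum_odd_0 L 3 HL), (gsum_odd_0 L 5 HL) in S4 by auto.
replace (eis L 3 z - / (z - 0) ^ 3 + 0 + 3 * z * gsum L 4 + 6 * z ^ 2 * 0 + 10 * z ^ 3 * gsum L 6)
  with (eis L 3 z - / z ^ 3 + 3 * gsum L 4 * z + 10 * gsum L 6 * z ^ 3) in S4.
2:{ replace (z - 0) with z by ring; ring. }
apply has_sum_remainder with (8 := S4); auto; try lia; try lra; [apply pow_le, Cmod_ge_0|].
intros w Dw; destruct (Hw w Dw) as [nw [nzw [pw [h1 h2]]]].
replace (/ (z - w) ^ 3 + / w ^ 3 + 3 * z * / w ^ 4 + 6 * z ^ 2 * / w ^ 5 + 10 * z ^ 3 * / w ^ 6)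
  with (z ^ 4 * ((15 * w ^ 2 - 24 * (z * w) + 10 * z ^ 2) * / (w ^ 6 * (z - w) ^ 3))) by (field; auto).
rewrite Cmod_mult, Cmod_pow; apply Rmult_le_compat_l; [apply pow_le, Cmod_ge_0|].
replace (240 * / Cmod w ^ 7)%R with (30 * Cmod w ^ 2 * / (Cmod w ^ 6 * (Cmod w / 2) ^ 3))%R by (field; lra).
apply frac_bound.
- eapply Rle_trans; [apply Cmod_triangle|].
  eapply Rle_trans; [apply Rplus_le_compat_r, (Cmod_triangle (15 * w ^ 2) (- (24 * (z * w))))|].
  rewrite Cmod_opp, !Cmod_nat_scal, !Cmod_mult, !Cmod_pow by lra.
  assert (pz := Cmod_ge_0 z).
  assert (Cmod z * Cmod w <= Cmod w ^ 2 / 2)%R by nra.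
  assert (Cmod z ^ 2 <= Cmod w ^ 2 / 4)%R by nra.
  nra.
- apply Rmult_lt_0_compat; apply pow_lt; lra.
- rewrite Cmod_mult, !Cmod_pow; apply Rmult_le_compat_l; [apply pow_le; lra | apply pow_incr; lra].
Qed.

(** The constant term suffices, since [eis 4] enters [eis4_wp] linearly and only a limit is taken.
    In the proof 208 is [13 * 16], the numerator being at most [5/2 * 13/4 <= 13] times [|w|^3]. *)
Lemma eis4_laurent (L : C -> Prop) : is_lattice L -> exists K r, (0 < r)%R /\
  forall z, (0 < Cmod z < r)%R -> z <> 0 /\ ~ L z /\
  (Cmod (eis L 4 z - / z ^ 4 - gsum L 4) <= K * Cmod z ^ 1)%R.
Proof.
intros HL; destruct (laurent_setup L HL) as [r [Hr [_ Hset]]].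
destruct (lat_lower_nz L HL) as [c [Hc Kc]].
destruct (lat_summable_nz L HL) as [M HM].
exists (208 * / c ^ 5 * M)%R, r; split; auto.
intros z Hz; destruct (Hset z Hz) as [n0 [Lz Hw]]; split; [|split]; auto.
assert (S0 := has_sum_split0 L _ _ (lat_0 L HL) (eis_has_sum L 4 z HL ltac:(lia) Lz)); cbv beta in S0.
assert (S1 := has_sum_minus _ _ _ _ _ S0 (gsum_has_sum L 4 HL ltac:(lia))).
replace (z - 0) with z in S1 by ring.
apply has_sum_remainder with (8 := S1); auto; try lia; try (assert (pz := Cmod_ge_0 z); lra).
intros w Dw; destruct (Hw w Dw) as [nw [nzw [pw [h1 h2]]]].
replace (/ (z - w) ^ 4 - / w ^ 4)
  with (z ^ 1 * ((2 * w - z) * (w ^ 2 + (z - w) ^ 2) * / (w ^ 4 * (z - w) ^ 4))) by (field; auto).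
rewrite Cmod_mult, Cmod_pow; apply Rmult_le_compat_l; [apply pow_le, Cmod_ge_0|].
replace (208 * / Cmod w ^ 5)%R with (13 * Cmod w ^ 3 * / (Cmod w ^ 4 * (Cmod w / 2) ^ 4))%R by (field; lra).
apply frac_bound.
- rewrite Cmod_mult.
  assert (pz := Cmod_ge_0 z).
  assert (E1 : (Cmod (2 * w - z) <= 5 / 2 * Cmod w)%R).
  { eapply Rle_trans; [apply (Cmod_triangle (2 * w) (- z))|]; rewrite Cmod_opp, Cmod_nat_scal; lra. }
  assert (E2 : (Cmod (z - w) <= 3 / 2 * Cmod w)%R).
  { eapply Rle_trans; [apply (Cmod_triangle z (- w))|]; rewrite Cmod_opp; lra. }
  assert (E3 : (Cmod (w ^ 2 + (z - w) ^ 2) <= 13 / 4 * Cmod w ^ 2)%R).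
  { eapply Rle_trans; [apply Cmod_triangle|]; rewrite !Cmod_pow.
    assert (Cmod (z - w) ^ 2 <= (3 / 2 * Cmod w) ^ 2)%R by (apply pow_incr; split; auto using Cmod_ge_0).
    lra. }
  apply Rle_trans with (5 / 2 * Cmod w * (13 / 4 * Cmod w ^ 2))%R.
  + apply Rmult_le_compat; auto using Cmod_ge_0.
  + assert (0 <= Cmod w ^ 3)%R by (apply pow_le; lra); simpl in *; lra.
- apply Rmult_lt_0_compat; apply pow_lt; lra.
- rewrite Cmod_mult, !Cmod_pow; apply Rmult_le_compat_l; [apply pow_le; lra | apply pow_incr; lra].
Qed.

(** * Periodicity and differential equations *)

Lemma lattice_swap (w1 w2 : C) : lattice w1 w2 = lattice w2 w1.
Proof.
apply set_ext; intros z; split; intros [m [n ->]]; exists n, m; ring.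
Qed.

Lemma R_independent_swap (w1 w2 : C) : R_independent w1 w2 -> R_independent w2 w1.
Proof.
intros H a b E; destruct (H b a); [|tauto]; rewrite <- E; ring.
Qed.

Lemma not_lattice_coords (w1 w2 : C) (a b : R) : R_independent w1 w2 ->
  ((forall m, a <> IZR m) \/ (forall n, b <> IZR n)) -> ~ lattice w1 w2 (a * w1 + b * w2).
Proof.
intros Hi Hab [m [n E]]; destruct (R_independent_coords _ _ _ _ _ _ Hi E) as [h1 h2].
destruct Hab as [h|h]; [now apply (h m) | now apply (h n)].
Qed.

Lemma half_not_int (m : Z) : (/ 2)%R <> IZR m.
Proof.
intros E; assert (E' : (IZR (2 * m) = IZR 1)%R) by (rewrite mult_IZR, <- E; field).
apply eq_IZR in E'; lia.
Qed.

Lemma neg_half_not_int (m : Z) : (- / 2)%R <> IZR m.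
Proof.
intros E; apply (half_not_int (- m)); rewrite opp_IZR, <- E; ring.
Qed.

(* The difference [wp (z + w1) - wp z] has derivative [0], hence is constant
   on every line avoiding the lattice; such lines connect any [z] to
   [- w1 / 2], where the difference vanishes because [wp] is even. *)
Lemma wp_periodic_basis (w1 w2 z : C) : R_independent w1 w2 -> ~ lattice w1 w2 z ->
  wp (lattice w1 w2) (z + w1) = wp (lattice w1 w2) z.
Proof.
intros Hi Hz; set (L := lattice w1 w2) in *.
assert (HL : is_lattice L) by now exists w1, w2.
assert (Lw1 : L w1) by (exists 1%Z, 0%Z; ring).
set (g := fun z => wp L (z + w1) - wp L z).
assert (Hg : forall z, ~ L z -> cderiv g z 0).
{ intros x Hx; assert (Hx' : ~ L (x + w1)) by now rewrite lat_add_iff.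
  replace (RtoC 0) with (-2 * eis L 3 (x + w1) - -2 * eis L 3 x).
  2:{ rewrite eis_periodic by auto; ring. }
  apply cderiv_minus; [|now apply wp_cderiv].
  apply cderiv_shift; now apply wp_cderiv. }
assert (Hline : forall p d : C, (forall t : R, ~ L (p + t * d)) -> forall s t : R,
  g (p + s * d) = g (p + t * d)).
{ intros p d H s t; apply (curve_deriv_zero (fun t : R => g (p + t * d))); intros x.
  replace (RtoC 0) with (0 * d) by ring.
  apply (curve_deriv_comp g (fun t : R => p + t * d)); [apply curve_deriv_line|].
  now apply Hg. }
set (G := fun a b : R => g (a * w1 + b * w2)).
assert (Hh : forall a a' b : R, (forall n, b <> IZR n) -> G a b = G a' b).
{ intros a a' b Hb; unfold G.
  rewrite (Cplus_comm (a * w1)), (Cplus_comm (a' * w1)); apply Hline; intros t.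
  rewrite Cplus_comm; apply not_lattice_coords; auto. }
assert (Hv : forall a b b' : R, (forall m, a <> IZR m) -> G a b = G a b').
{ intros a b b' Ha; unfold G; apply Hline; intros t; apply not_lattice_coords; auto. }
assert (E : g z = 0).
{ destruct (coords_exist w1 w2 z Hi) as [a [b Ez]]; rewrite Ez; change (G a b = 0).
  (* Horizontal moves are allowed at non-integral height, vertical ones at non-integral abscissa. If
     [b] is integral, [a] is not, and a vertical move to height 1/2 comes first. *)
  transitivity (G (- / 2)%R 0%R).
  - destruct (classic (exists n, b = IZR n)) as [[n Hb]|Hb].
    + rewrite (Hv a b (/ 2)%R).
      * rewrite (Hh a (- / 2)%R) by apply half_not_int; apply Hv, neg_half_not_int.
      * intros m Ha; apply Hz; exists m, n; now rewrite Ez, Ha, Hb.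
    + rewrite (Hh a (- / 2)%R) by (intros n Hn; apply Hb; now exists n).
      apply Hv, neg_half_not_int.
  - unfold G, g.
    assert (n : ~ L (RtoC (/ 2) * w1 + RtoC 0 * w2))
      by (apply not_lattice_coords; auto; left; apply half_not_int).
    replace (RtoC (- / 2) * w1 + RtoC 0 * w2) with (- (RtoC (/ 2) * w1 + RtoC 0 * w2))
      by (rewrite RtoC_opp; ring).
    rewrite (wp_even L _ HL n).
    replace (- (RtoC (/ 2) * w1 + RtoC 0 * w2) + w1) with (RtoC (/ 2) * w1 + RtoC 0 * w2); [ring|].
    replace w1 with ((RtoC (/ 2) + RtoC (/ 2)) * w1) at 3; [ring|].
    rewrite <- RtoC_plus; replace (/ 2 + / 2)%R with 1%R by field; ring. }
unfold g in E; now apply Ceq_minus.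
Qed.

Lemma Z_periodic (L : C -> Prop) (f : C -> C) (w : C) : is_lattice L -> L w ->
  (forall z, ~ L z -> f (z + w) = f z) -> forall (m : Z) z, ~ L z -> f (z + IZR m * w) = f z.
Proof.
intros HL Hw Hf.
assert (LZ : forall m : Z, L (IZR m * w)).
{ destruct HL as [w1 [w2 [_ ->]]]; destruct Hw as [k [l ->]]; intros m.
  exists (m * k)%Z, (m * l)%Z; rewrite !mult_IZR, !RtoC_mult; ring. }
assert (Hn : forall (n : nat) z, ~ L z -> f (z + IZR (Z.of_nat n) * w) = f z).
{ induction n as [|n IH]; intros z Hz.
  - f_equal; simpl; ring.
  - rewrite Nat2Z.inj_succ, succ_IZR, RtoC_plus.
    replace (z + (IZR (Z.of_nat n) + 1) * w) with (z + IZR (Z.of_nat n) * w + w) by ring.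
    rewrite Hf, IH; auto; now rewrite lat_add_iff. }
intros m z Hz; destruct (Z_le_gt_dec 0 m) as [h|h].
- replace m with (Z.of_nat (Z.to_nat m)) by lia; now apply Hn.
- rewrite <- (Hn (Z.to_nat (- m)) (z + IZR m * w)) by (now rewrite lat_add_iff).
  f_equal; rewrite Z2Nat.id, opp_IZR, RtoC_opp by lia; ring.
Qed.

Lemma wp_periodic (L : C -> Prop) (z v : C) : is_lattice L -> ~ L z -> L v ->
  wp L (z + v) = wp L z.
Proof.
intros HL Hz Hv; assert (HL' := HL); destruct HL' as [w1 [w2 [Hi E]]].
assert (L1 : L w1) by (rewrite E; exists 1%Z, 0%Z; ring).
assert (L2 : L w2) by (rewrite E; exists 0%Z, 1%Z; ring).
assert (P1 : forall z, ~ L z -> wp L (z + w1) = wp L z).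
{ intros x Hx; rewrite E in *; now apply wp_periodic_basis. }
assert (P2 : forall z, ~ L z -> wp L (z + w2) = wp L z).
{ intros x Hx; rewrite E, lattice_swap in *; apply wp_periodic_basis; auto.
  now apply R_independent_swap. }
rewrite E in Hv; destruct Hv as [m [n ->]].
replace (z + (IZR m * w1 + IZR n * w2)) with (z + IZR m * w1 + IZR n * w2) by ring.
assert (Hz' : ~ L (z + IZR m * w1)).
{ rewrite lat_add_iff; auto; rewrite E; exists m, 0%Z; ring. }
rewrite (Z_periodic L (wp L) w2) by auto; now apply Z_periodic with L.
Qed.

Lemma ccont_eis (L : C -> Prop) (n : nat) (z : C) : is_lattice L -> (3 <= n)%nat -> ~ L z ->
  ccont (eis L n) z.
Proof. intros HL Hn Hz; eapply cderiv_cont, eis_cderiv; auto. Qed.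

Lemma ccont_wp (L : C -> Prop) (z : C) : is_lattice L -> ~ L z -> ccont (wp L) z.
Proof. intros HL Hz; eapply cderiv_cont, wp_cderiv; auto. Qed.

Lemma clim_remainder (f : C -> C) (K r : R) (n : nat) : (0 < r)%R ->
  (forall z, 0 < Cmod z < r -> Cmod (f z) <= K * Cmod z ^ (S n))%R ->
  clim 0 (fun z => f z * / z ^ n) 0.
Proof.
intros Hr H; apply clim_bound with K r; auto; intros z; replace (z - 0) with z by ring; intros Hz.
replace (f z * / z ^ n - 0) with (f z * / z ^ n) by ring.
rewrite Cmod_mult, Cmod_inv_all, Cmod_pow.
assert (P : (0 < Cmod z ^ n)%R) by (apply pow_lt; tauto).
specialize (H z Hz); simpl in H.
apply Rmult_le_reg_r with (Cmod z ^ n)%R; auto.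
rewrite Rmult_assoc, Rinv_l, Rmult_1_r by lra; lra.
Qed.

(** Writing the remainders as functions that tend to 0 reduces the limits below to algebra: once
    [field] has cancelled the poles, a polynomial in [z], [A z], [B z], [E z] is left, whose limit
    is its value at zero. *)
Lemma laurent_functions (L : C -> Prop) : is_lattice L -> exists (A B E : C -> C) r, (0 < r)%R /\
  clim 0 A 0 /\ clim 0 B 0 /\ clim 0 E 0 /\
  forall z, (0 < Cmod z < r)%R -> z <> 0 /\ ~ L z /\
    wp L z = / z ^ 2 + 3 * gsum L 4 * z ^ 2 + 5 * gsum L 6 * z ^ 4 + A z * z ^ 4 /\
    eis L 3 z = / z ^ 3 - 3 * gsum L 4 * z - 10 * gsum L 6 * z ^ 3 + B z * z ^ 3 /\
    eis L 4 z = / z ^ 4 + gsum L 4 + E z.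
Proof.
intros HL.
destruct (wp_laurent L HL) as [K1 [r1 [Hr1 H1]]].
destruct (eis3_laurent L HL) as [K2 [r2 [Hr2 H2]]].
destruct (eis4_laurent L HL) as [K3 [r3 [Hr3 H3]]].
exists (fun z => (wp L z - / z ^ 2 - 3 * gsum L 4 * z ^ 2 - 5 * gsum L 6 * z ^ 4) * / z ^ 4).
exists (fun z => (eis L 3 z - / z ^ 3 + 3 * gsum L 4 * z + 10 * gsum L 6 * z ^ 3) * / z ^ 3).
exists (fun z => (eis L 4 z - / z ^ 4 - gsum L 4) * / z ^ 0).
exists (Rmin r1 (Rmin r2 r3)); split; [repeat apply Rmin_glb_lt; auto|].
split; [|split; [|split]].
- eapply clim_remainder with (2 := fun z Hz => proj2 (proj2 (H1 z Hz))); auto.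
- eapply clim_remainder with (2 := fun z Hz => proj2 (proj2 (H2 z Hz))); auto.
- eapply clim_remainder with (2 := fun z Hz => proj2 (proj2 (H3 z Hz))); auto.
- intros z [h1 h2].
  assert (k1 := Rlt_le_trans _ _ _ h2 (Rmin_l _ _)).
  destruct (H1 z (conj h1 k1)) as [n [Lz _]].
  repeat split; auto; simpl; field; auto.
Qed.

Ltac clim_auto := repeat first
  [ assumption | apply clim_const | apply clim_id | apply clim_minus | apply clim_plus | apply clim_mult ].

(* This is [wp'' = 6 wp ^ 2 - g2 / 2], since [wp'' = 6 eis 4] and [g2 = 60 gsum 4]. *)
Lemma eis4_wp (L : C -> Prop) (z : C) : is_lattice L -> ~ L z ->
  eis L 4 z = wp L z * wp L z - 5 * gsum L 4.
Proof.
intros HL Hz.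
enough (E : eis L 4 z - wp L z * wp L z = - (5 * gsum L 4)).
{ replace (eis L 4 z) with (eis L 4 z - wp L z * wp L z + wp L z * wp L z) by ring.
  rewrite E; ring. }
apply (elliptic_const L (fun z => eis L 4 z - wp L z * wp L z)
  (fun z => - (INR 4 * eis L (4 + 1) z) - (-2 * eis L 3 z * wp L z + wp L z * (-2 * eis L 3 z)))); auto.
- intros x Hx; split.
  + apply cderiv_minus; [apply eis_cderiv; auto; lia|].
    apply cderiv_mult; now apply wp_cderiv.
  + assert (c1 := ccont_eis L 3 x HL ltac:(lia) Hx); assert (c2 := ccont_eis L (4 + 1) x HL ltac:(lia) Hx).
    assert (c3 := ccont_wp L x HL Hx); unfold ccont in *.
    replace (fun z => - (INR 4 * eis L (4 + 1) z) - (-2 * eis L 3 z * wp L z + wp L z * (-2 * eis L 3 z)))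
      with (fun z => (-1) * (INR 4 * eis L (4 + 1) z) - (-2 * eis L 3 z * wp L z + wp L z * (-2 * eis L 3 z)))
      by (apply functional_extensionality; intros; ring).
    replace (- (INR 4 * eis L (4 + 1) x)) with ((-1) * (INR 4 * eis L (4 + 1) x)) by ring.
    clim_auto.
- intros x w Hx Hw; now rewrite eis_periodic, wp_periodic by (auto; lia).
- destruct (laurent_functions L HL) as [A [B [E [r [Hr [HA [HB [HE H]]]]]]]].
  set (g4 := gsum L 4) in *; set (g6 := gsum L 6) in *.
  (* With [wp x = x^-2 + x^2 u] the two poles [x^-4] cancel and [Q] is what remains; at zero it is
     [g4 - 6 g4]. *)
  pose (u := fun x a : C => 3 * g4 + 5 * g6 * (x * x) + a * (x * x)).
  pose (Q := fun x a e : C => g4 + e - 2 * u x a - x * x * x * x * (u x a * u x a)).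
  apply clim_ext with (fun x => Q x (A x) (E x)) r; auto.
  { intros x; replace (x - 0) with x by ring; intros Hx.
    destruct (H x Hx) as [n [_ [-> [_ ->]]]]; unfold Q, u; field; auto. }
  replace (- (5 * g4)) with (Q 0 0 0) by (unfold Q, u; ring).
  unfold Q, u; clim_auto.
Qed.

(* Weierstrass' equation, since [wp' = -2 eis 3]. *)
Lemma eis3_wp (L : C -> Prop) (z : C) : is_lattice L -> ~ L z ->
  eis L 3 z * eis L 3 z = wp L z * wp L z * wp L z - 15 * gsum L 4 * wp L z - 35 * gsum L 6.
Proof.
intros HL Hz.
set (F := fun z => eis L 3 z * eis L 3 z - wp L z * wp L z * wp L z + 15 * gsum L 4 * wp L z).
enough (E : F z = - (35 * gsum L 6)).
{ replace (eis L 3 z * eis L 3 z) with (F z + wp L z * wp L z * wp L z - 15 * gsum L 4 * wp L z)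
    by (unfold F; ring).
  rewrite E; ring. }
(* By [eis4_wp] the derivative of [F] is [6 eis 3 (wp^2 - 5 gsum 4 - eis 4) = 0]. *)
apply (elliptic_const L F (fun z => RtoC 0)); auto.
- intros x Hx; split; [|apply clim_const].
  assert (d3 := eis_cderiv L 3 x HL ltac:(lia) Hx); assert (dp := wp_cderiv L x HL Hx).
  assert (E := cderiv_plus _ _ _ _ _ (cderiv_minus _ _ _ _ _ (cderiv_mult _ _ _ _ _ d3 d3)
    (cderiv_mult _ _ _ _ _ (cderiv_mult _ _ _ _ _ dp dp) dp)) (cderiv_scal _ (15 * gsum L 4) _ _ dp)).
  replace (RtoC 0) with (- (INR 3 * eis L (3 + 1) x) * eis L 3 x + eis L 3 x * - (INR 3 * eis L (3 + 1) x) -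
     ((-2 * eis L 3 x * wp L x + wp L x * (-2 * eis L 3 x)) * wp L x + wp L x * wp L x * (-2 * eis L 3 x)) +
     15 * gsum L 4 * (-2 * eis L 3 x)); [exact E|].
  change (3 + 1)%nat with 4%nat; rewrite eis4_wp by auto.
  replace (INR 3) with 3%R by (simpl; ring).
  replace (RtoC (-2)) with (- RtoC 2) by (rewrite <- RtoC_opp; f_equal; lra); ring.
- intros x w Hx Hw; unfold F; now rewrite eis_periodic, wp_periodic by (auto; lia).
- destruct (laurent_functions L HL) as [A [B [E [r [Hr [HA [HB [HE H]]]]]]]].
  set (g4 := gsum L 4) in *; set (g6 := gsum L 6) in *.
  (* Here [wp x = x^-2 + x^2 u] and [eis 3 x = x^-3 + x v]. The poles [x^-6] cancel, and so does
     [x^-2], with coefficient [-6 g4 - 9 g4 + 15 g4]; the limit is [-20 g6 - 15 g6]. *)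
  pose (u := fun x a : C => 3 * g4 + 5 * g6 * (x * x) + a * (x * x)).
  pose (v := fun x b : C => - (3) * g4 - 10 * g6 * (x * x) + b * (x * x)).
  pose (Q := fun x a b : C => - (20) * g6 + 2 * b - 15 * g6 - 3 * a + x * x * (v x b * v x b)
    - 3 * (x * x) * (u x a * u x a) - x * x * (x * x) * (x * x) * (u x a * u x a * u x a)
    + 15 * g4 * (x * x * u x a)).
  apply clim_ext with (fun x => Q x (A x) (B x)) r; auto.
  { intros x; replace (x - 0) with x by ring; intros Hx.
    destruct (H x Hx) as [n [_ [E1 [E2 _]]]]; unfold F; rewrite E1, E2; unfold Q, u, v; field; auto. }
  replace (- (35 * g6)) with (Q 0 0 0) by (unfold Q, u, v; ring).
  unfold Q, u, v; clim_auto.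
Qed.

Lemma lat_compl_open (L : C -> Prop) (z : C) : is_lattice L -> ~ L z ->
  exists r, (0 < r)%R /\ forall w, (Cmod (w - z) < r)%R -> ~ L w.
Proof.
intros HL Hz; destruct (lat_sep L z HL Hz) as [e [He K]]; exists e; split; auto.
intros w Hw Lw; specialize (K w Lw); replace (z - w) with (- (w - z)) in K by ring.
rewrite Cmod_opp in K; lra.
Qed.

(** The derivative of [eis4_wp]; differentiating once more gives [eis6_wp], from which the change of
    [g3] is read. *)
Lemma eis5_wp (L : C -> Prop) (z : C) : is_lattice L -> ~ L z ->
  eis L 5 z = wp L z * eis L 3 z.
Proof.
intros HL Hz; destruct (lat_compl_open L z HL Hz) as [r [Hr K]].
assert (dp := wp_cderiv L z HL Hz).
assert (D := cderiv_minus _ _ _ _ _ (cderiv_mult _ _ _ _ _ dp dp) (cderiv_const (5 * gsum L 4) z)).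
assert (E : - (INR 4 * eis L (4 + 1) z) = -2 * eis L 3 z * wp L z + wp L z * (-2 * eis L 3 z) - 0).
{ apply cderiv_unique with (2 := D) (f := fun z => wp L z * wp L z - 5 * gsum L 4).
  apply cderiv_ext with (eis L 4) r; auto; [|apply eis_cderiv; auto; lia].
  intros w Hw; apply eis4_wp; auto. }
change (4 + 1)%nat with 5%nat in E.
replace (INR 4) with 4%R in E by (simpl; ring).
replace (RtoC (-2)) with (- RtoC 2) in E by (rewrite <- RtoC_opp; f_equal; lra).
replace (eis L 5 z) with (- (- (4 * eis L 5 z)) / 4) by field.
rewrite E; field.
Qed.

Lemma eis6_wp (L : C -> Prop) (z : C) : is_lattice L -> ~ L z ->
  eis L 6 z = (2 * (eis L 3 z * eis L 3 z) + 3 * (wp L z * eis L 4 z)) / 5.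
Proof.
intros HL Hz; destruct (lat_compl_open L z HL Hz) as [r [Hr K]].
assert (D := cderiv_mult _ _ _ _ _ (wp_cderiv L z HL Hz) (eis_cderiv L 3 z HL ltac:(lia) Hz)).
assert (E : - (INR 5 * eis L (5 + 1) z) =
  -2 * eis L 3 z * eis L 3 z + wp L z * - (INR 3 * eis L (3 + 1) z)).
{ apply cderiv_unique with (2 := D) (f := fun z => wp L z * eis L 3 z).
  apply cderiv_ext with (eis L 5) r; auto; [|apply eis_cderiv; auto; lia].
  intros w Hw; apply eis5_wp; auto. }
change (5 + 1)%nat with 6%nat in E; change (3 + 1)%nat with 4%nat in E.
replace (INR 5) with 5%R in E by (simpl; ring).
replace (INR 3) with 3%R in E by (simpl; ring).
replace (RtoC (-2)) with (- RtoC 2) in E by (rewrite <- RtoC_opp; f_equal; lra).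
replace (eis L 6 z) with (- (- (5 * eis L 6 z)) / 5) by field.
rewrite E; field.
Qed.

(** * Half periods *)

Definition adjoin (L : C -> Prop) (h : C) (z : C) : Prop := L z \/ L (z - h).

Definition half_period (L : C -> Prop) (h : C) : Prop :=
  ~ L h /\ L (h + h) /\ is_lattice (adjoin L h).

Lemma Z_even_odd (m : Z) : (exists k, m = 2 * k)%Z \/ (exists k, m = 2 * k + 1)%Z.
Proof.
destruct (Z.Even_or_Odd m) as [[k Hk]|[k Hk]]; [left | right]; now exists k.
Qed.

Lemma adjoin_lattice (a w : C) : adjoin (lattice (2 * a) w) a = lattice a w.
Proof.
apply set_ext; intros z; split.
- intros [[m [n E]]|[m [n E]]].
  + exists (2 * m)%Z, n; rewrite E, mult_IZR, RtoC_mult; ring.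
  + exists (2 * m + 1)%Z, n; replace z with (z - a + a) by ring.
    rewrite E, plus_IZR, mult_IZR, RtoC_plus, RtoC_mult; ring.
- intros [m [n ->]]; destruct (Z_even_odd m) as [[k ->]|[k ->]]; [left | right]; exists k, n.
  + rewrite mult_IZR, RtoC_mult; ring.
  + rewrite plus_IZR, mult_IZR, RtoC_plus, RtoC_mult; ring.
Qed.

Lemma R_independent_half (a w : C) : R_independent (2 * a) w -> R_independent a w.
Proof.
intros H x y E; destruct (H (x / 2)%R y) as [h1 h2]; [|split; [lra | auto]].
rewrite <- E, RtoC_div by lra; field.
Qed.

Lemma half_period_basis (a w : C) : R_independent (2 * a) w -> half_period (lattice (2 * a) w) a.
Proof.
intros H; repeat split.
- replace a with (RtoC (/ 2) * (2 * a) + RtoC 0 * w) at 2.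
  + apply not_lattice_coords; auto; left; apply half_not_int.
  + rewrite RtoC_inv by lra; field.
- exists 1%Z, 0%Z; ring.
- exists a, w; split; [now apply R_independent_half | apply adjoin_lattice].
Qed.

Lemma half_periods (a b : C) : R_independent (2 * a) (2 * b) ->
  half_period (lattice (2 * a) (2 * b)) a /\ half_period (lattice (2 * a) (2 * b)) b /\
  half_period (lattice (2 * a) (2 * b)) (a + b).
Proof.
intros H; split; [|split].
- now apply half_period_basis.
- rewrite lattice_swap; apply half_period_basis; now apply R_independent_swap.
- replace (lattice (2 * a) (2 * b)) with (lattice (2 * (a + b)) (2 * b)).
  + apply half_period_basis; intros x y E.
    destruct (H x (x + y)%R) as [h1 h2]; [|split; lra].
    rewrite <- E, RtoC_plus; ring.
  + apply set_ext; intros z; split; intros [m [n ->]].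
    * exists m, (m + n)%Z; rewrite plus_IZR, RtoC_plus; ring.
    * exists m, (n - m)%Z; rewrite minus_IZR, RtoC_minus; ring.
Qed.

Lemma half_cases (L : C -> Prop) (a b v : C) : L = lattice (2 * a) (2 * b) -> L (2 * v) ->
  L v \/ L (v - a) \/ L (v - b) \/ L (v - (a + b)).
Proof.
intros -> [m [n E]].
assert (Ev : v = IZR m * a + IZR n * b).
{ replace v with (2 * v / 2) by field.
  rewrite E; field. }
destruct (Z_even_odd m) as [[k Hk]|[k Hk]]; destruct (Z_even_odd n) as [[l Hl]|[l Hl]];
  [left | do 2 right; left | right; left | do 3 right]; exists k, l;
  rewrite Ev, Hk, Hl, ?plus_IZR, ?mult_IZR, ?RtoC_plus, ?RtoC_mult; ring.
Qed.

(** [eis 3] is odd, and [h] and [- h] differ by the period [h + h]. *)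
Lemma half_eis3 (L : C -> Prop) (h : C) : is_lattice L -> half_period L h -> eis L 3 h = 0.
Proof.
intros HL [Hh [H2 _]].
assert (Hn : ~ L (- h)) by now rewrite lat_opp_iff.
assert (E := eis_periodic L 3 (- h) (h + h) HL ltac:(lia) Hn H2).
replace (- h + (h + h)) with h in E by ring; rewrite eis3_odd in E by auto.
replace (eis L 3 h) with ((eis L 3 h - - eis L 3 h) / 2) by field.
rewrite <- E; field.
Qed.

Lemma half_shift (L : C -> Prop) (h z : C) : is_lattice L -> half_period L h ->
  (L (z + h) <-> L (z - h)).
Proof.
intros HL [_ [H2 _]]; replace (z + h) with (z - h + (h + h)) by ring; now apply lat_add_iff.
Qed.

Lemma wp_half_shift (L : C -> Prop) (h z : C) : is_lattice L -> half_period L h -> ~ L (z - h) ->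
  wp L (z + h) = wp L (z - h).
Proof.
intros HL [_ [H2 _]] Hz; replace (z + h) with (z - h + (h + h)) by ring; now apply wp_periodic.
Qed.

(** Translation by [h] exchanges the two factors, so the product is elliptic for the larger lattice
    [adjoin L h]. At 0 the double pole of one factor meets the double zero of the other, whose
    coefficient is [3 eis 4 h], half the second derivative of [wp] at [h]. *)
Lemma half_product (L : C -> Prop) (h z : C) : is_lattice L -> half_period L h ->
  ~ L z -> ~ L (z - h) -> (wp L (z - h) - wp L h) * (wp L z - wp L h) = 3 * eis L 4 h.
Proof.
intros HL Hh Hz Hzh; rewrite <- wp_half_shift by auto.
assert (Hh' := Hh); destruct Hh' as [Nh [L2h LA]]; set (e := wp L h).
assert (Out : forall x, ~ adjoin L h x -> ~ L x /\ ~ L (x + h)).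
{ intros x Hx; rewrite half_shift by auto; unfold adjoin in Hx; tauto. }
apply (elliptic_const (adjoin L h) (fun z => (wp L (z + h) - e) * (wp L z - e))
  (fun z => (-2 * eis L 3 (z + h) - 0) * (wp L z - e) + (wp L (z + h) - e) * (-2 * eis L 3 z - 0))); auto.
- intros x Hx; destruct (Out x Hx) as [h1 h2]; split.
  + apply (cderiv_mult (fun z => wp L (z + h) - e) (fun z => wp L z - e));
      (apply cderiv_minus; [|apply cderiv_const]).
    * apply (cderiv_shift (wp L) h); now apply wp_cderiv.
    * now apply wp_cderiv.
  + assert (s1 : ccont (fun x => wp L (x + h)) x)
      by (eapply cderiv_cont, (cderiv_shift (wp L) h), wp_cderiv; auto).
    assert (s2 : ccont (fun x => eis L 3 (x + h)) x)
      by (eapply cderiv_cont, (cderiv_shift (eis L 3) h), eis_cderiv; auto).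
    assert (s3 := ccont_wp L x HL h1); assert (s4 := ccont_eis L 3 x HL ltac:(lia) h1).
    unfold ccont in *; clim_auto.
- intros x w Hx Hw; destruct (Out x Hx) as [h1 h2].
  replace (x + w + h) with (x + h + w) by ring.
  destruct Hw as [Hw|Hw].
  + now rewrite (wp_periodic L (x + h) w), (wp_periodic L x w).
  + assert (h3 : ~ L (x - h)) by now rewrite <- half_shift.
    replace (x + h + w) with (x + (w - h + (h + h))) by ring.
    replace (x + w) with (x + h + (w - h)) by ring.
    rewrite (wp_periodic L x), (wp_periodic L (x + h)) by (auto; now apply lat_add); ring.
- destruct (laurent_functions L HL) as [A [B [E [r [Hr [HA [_ [_ H]]]]]]]].
  destruct (wp_taylor L h HL Nh) as [K [r' [Hr' T]]].
  set (D := fun x => (wp L (x + h) - e - 3 * x ^ 2 * eis L 4 h) * / x ^ 2).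
  assert (HD : clim 0 D 0).
  { apply (clim_remainder (fun x => wp L (x + h) - e - 3 * x ^ 2 * eis L 4 h) K r' 2); auto.
    intros x [_ Hx]; destruct (T x Hx) as [_ B'].
    rewrite (half_eis3 L h HL Hh) in B'.
    replace (x + h) with (h + x) by ring.
    replace (wp L (h + x) - e - 3 * x ^ 2 * eis L 4 h) with
      (wp L (h + x) - wp L h + 2 * x * 0 - 3 * x ^ 2 * eis L 4 h) by (unfold e; ring).
    exact B'. }
  (* The first factor is [x^2 (d + 3 eis 4 h)], the second [x^-2] times the remaining bracket. *)
  pose (Q := fun x a d : C => (d + 3 * eis L 4 h) * (1 +
    x * x * x * x * (3 * gsum L 4 + 5 * gsum L 6 * (x * x) + a * (x * x)) - e * (x * x))).
  apply clim_ext with (fun x => Q x (A x) (D x)) r; auto.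
  { intros x; replace (x - 0) with x by ring; intros Hx.
    destruct (H x Hx) as [n [_ [-> _]]]; unfold Q, D; field; auto. }
  replace (3 * eis L 4 h) with (Q 0 0 0) by (unfold Q; ring).
  unfold Q; clim_auto.
- unfold adjoin; tauto.
Qed.

(** * Sums over cosets of the lattice *)

Lemma coset_nonzero (L : C -> Prop) (h v : C) : is_lattice L -> ~ L h -> L (v - h) -> v <> 0.
Proof.
intros HL Hh Hv E; apply Hh; rewrite <- (lat_opp_iff L h HL).
replace (- h) with (v - h) by (rewrite E; ring); auto.
Qed.

Lemma has_sum_coset (L : C -> Prop) (h : C) (f : C -> C) (l : C) :
  has_sum L (fun w => f (w + h)) l -> has_sum (fun v => L (v - h)) f l.
Proof.
intros H; apply has_sum_ext with (fun v => f (v - h + h)).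
- intros w _; f_equal; ring.
- apply (has_sum_reindex _ L (fun v => v - h) (fun w => w + h) (fun w => f (w + h))); auto.
  + intros v Hv; now replace (v + h - h) with v by ring.
  + intros; ring.
  + intros; ring.
Qed.

(** In the difference the corrections [- / w ^ 2] of the two functions cancel, and the terms of
    [wp L h], taken at [- h] by evenness, become the corrections [- / v ^ 2] of the coset. *)
Lemma wp_coset_sum (L : C -> Prop) (h z : C) : is_lattice L -> ~ L h -> ~ L (z - h) ->
  has_sum (fun v => L (v - h)) (fun v => / (z - v) ^ 2 - / v ^ 2) (wp L (z - h) - wp L h).
Proof.
intros HL Hh Hz; apply has_sum_coset.
assert (Hn : ~ L (- h)) by now rewrite lat_opp_iff.
rewrite <- (wp_even L h) by auto.
apply has_sum_ext with (2 := has_sum_minus _ _ _ _ _ (wp_has_sum L (z - h) HL Hz)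
  (wp_has_sum L (- h) HL Hn)).
intros w _; replace ((- h - w) ^ 2) with ((w + h) ^ 2) by ring.
replace (z - (w + h)) with (z - h - w) by ring; ring.
Qed.

Lemma gsum_adjoin (L : C -> Prop) (h : C) (n : nat) : is_lattice L -> ~ L h ->
  is_lattice (adjoin L h) -> (3 <= n)%nat -> gsum (adjoin L h) n = gsum L n + eis L n h.
Proof.
intros HL Hh HA Hn.
apply has_sum_unique with (1 := gsum_has_sum _ n HA Hn).
apply has_sum_union with (D1 := nonzero_points L) (D2 := fun v => L (v - h)).
- intros w; unfold nonzero_points, adjoin; split.
  + tauto.
  + intros [[h1 h2]|h1]; split; auto; now apply coset_nonzero with L h.
- intros w [h1 _] h2; apply Hh; replace h with (w - (w - h)) by ring; now apply lat_sub.
- now apply gsum_has_sum.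
- apply has_sum_coset.
  apply has_sum_ext with (2 := has_sum_opp_reindex _ _ _ (fun w => lat_opp L w HL)
    (eis_has_sum L n h HL Hn Hh)).
  intros w _; do 2 f_equal; ring.
Qed.

(** Homogeneity of degree -2 turns [4 * wp L (2 * z)] into the sum over all [v] with [2 * v] in [L],
    and these [v] form the four cosets of [0], [a], [b], [a + b]. *)
Lemma wp_double_sum (a b z : C) : R_independent (2 * a) (2 * b) ->
  let L := lattice (2 * a) (2 * b) in ~ L (2 * z) ->
  4 * wp L (2 * z) = wp L z + (wp L (z - a) - wp L a) + (wp L (z - b) - wp L b)
    + (wp L (z - (a + b)) - wp L (a + b)).
Proof.
intros Hi L Hz; assert (HL : is_lattice L) by (now exists (2 * a), (2 * b)).
destruct (half_periods a b Hi) as [Ha [Hb Hc]]; fold L in Ha, Hb, Hc.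
assert (T : forall h, half_period L h -> L (z - h) -> False).
{ intros h [_ [h2 _]] h1; apply Hz; replace (2 * z) with (z - h + (z - h) + (h + h)) by ring.
  apply lat_add; auto; now apply lat_add. }
assert (Nz : ~ L z).
{ intros h1; apply Hz; replace (2 * z) with (z + z) by ring; now apply lat_add. }
assert (C0 : RtoC 2 <> 0) by (apply RtoC_neq; lra).
assert (S1 : has_sum (fun v => L (2 * v)) (fun v => / (z - v) ^ 2 - / v ^ 2) (4 * wp L (2 * z))).
{ apply has_sum_ext with (fun v => 4 * (/ (2 * z - 2 * v) ^ 2 - / (2 * v) ^ 2)).
  - intros v Lv.
    assert (n : z - v <> 0) by (intros E; apply Hz; replace z with (z - v + v) by ring;
      rewrite E; now replace (2 * (0 + v)) with (2 * v) by ring).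
    replace (2 * z - 2 * v) with (2 * (z - v)) by ring.
    replace (/ (2 * (z - v)) ^ 2) with (/ 4 * / (z - v) ^ 2)
      by (replace (RtoC 4) with (RtoC 2 * 2) by (rewrite <- RtoC_mult; f_equal; lra); field; auto).
    destruct (Ceq_dec v 0) as [->|nv].
    + replace (RtoC 0 ^ 2) with (RtoC 0) by ring.
      replace ((2 * 0) ^ 2) with (RtoC 0) by ring.
      rewrite Cinv_0; set (y := / (z - 0) ^ 2); field.
    + replace (/ (2 * v) ^ 2) with (/ 4 * / v ^ 2)
        by (replace (RtoC 4) with (RtoC 2 * 2) by (rewrite <- RtoC_mult; f_equal; lra); field; auto).
      field; auto.
  - apply has_sum_scal.
    apply (has_sum_reindex _ L (fun v => 2 * v) (fun w => w / 2) (fun w => / (2 * z - w) ^ 2 - / w ^ 2)).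
    + auto.
    + intros v Hv; now replace (2 * (v / 2)) with v by (field; auto).
    + intros; field; auto.
    + intros; field; auto.
    + now apply wp_has_sum. }
apply has_sum_unique with (1 := S1); clear S1.
assert (Tc : forall h, half_period L h -> forall v, L v -> L (v - h) -> False).
{ intros h [h1 _] v h2 h3; apply h1; replace h with (v - (v - h)) by ring; now apply lat_sub. }
assert (Tcc : forall h k, ~ L (h - k) -> forall v, L (v - h) -> L (v - k) -> False).
{ intros h k Hhk v h1 h2; apply Hhk; replace (h - k) with (v - k - (v - h)) by ring; now apply lat_sub. }
assert (Nab : ~ L (b - a)).
{ intros h1; apply (proj1 Hc); replace (a + b) with (b - a + (2 * a)) by ring.
  apply lat_add; auto; exists 1%Z, 0%Z; ring. }
apply has_sum_union with (D1 := fun v => L v \/ L (v - a) \/ L (v - b)) (D2 := fun v => L (v - (a + b))).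
- intros v; split.
  + intros Lv; destruct (half_cases L a b v eq_refl Lv) as [?|[?|[?|?]]]; tauto.
  + assert (D : forall h, half_period L h -> L (v - h) -> L (2 * v)).
    { intros h [_ [h2 _]] h1; replace (2 * v) with (v - h + (v - h) + (h + h)) by ring.
      apply lat_add; auto; now apply lat_add. }
    intros [[Lv|[Lv|Lv]]|Lv]; eauto.
    replace (2 * v) with (v + v) by ring; now apply lat_add.
- intros v [Lv|[Lv|Lv]] Lc.
  + now apply (Tc (a + b) Hc v).
  + apply (Tcc a (a + b)) with v; auto.
    replace (a - (a + b)) with (- b) by ring; rewrite lat_opp_iff; auto; apply Hb.
  + apply (Tcc b (a + b)) with v; auto.
    replace (b - (a + b)) with (- a) by ring; rewrite lat_opp_iff; auto; apply Ha.
- apply has_sum_union with (D1 := fun v => L v \/ L (v - a)) (D2 := fun v => L (v - b)).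
  + intros; tauto.
  + intros v [Lv|Lv] Lb; [now apply (Tc b Hb v)|].
    apply (Tcc b a Nab v); auto.
  + apply has_sum_union with (D1 := L) (D2 := fun v => L (v - a)).
    * tauto.
    * intros v; apply (Tc a Ha).
    * now apply wp_has_sum.
    * apply wp_coset_sum; auto; [apply Ha | intros h1; now apply (T a)].
  + apply wp_coset_sum; auto; [apply Hb | intros h1; now apply (T b)].
- apply wp_coset_sum; auto; [apply Hc | intros h1; now apply (T (a + b))].
Qed.

(** * Doubling, and the lattice as a function of its invariants *)

Definition cubic (g2 g3 x : C) : C := 4 * x ^ 3 - g2 * x - g3.

Definition discr (g2 g3 : C) : C := g2 ^ 3 - 27 * g3 ^ 2.

(** The abscissa of the double of a point on the curve [y^2 = 4 x^3 - g2 x - g3]. *)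
Definition dbl (g2 g3 x : C) : C := ((x ^ 2 + g2 / 4) ^ 2 + 2 * g3 * x) / cubic g2 g3 x.

(** The roots of the cubic are the values at half periods, whose doubles are poles. *)
Definition dbl_opt (g2 g3 : C) (o : option C) : option C :=
  match o with
  | None => None
  | Some x => if Ceq_dec (cubic g2 g3 x) 0 then None else Some (dbl g2 g3 x)
  end.

Lemma Cmult_integral_contra (x y : C) : x * y = 0 -> x <> 0 -> y = 0.
Proof.
intros E n; replace y with (/ x * (x * y)) by (field; auto); rewrite E; ring.
Qed.

Lemma g2_gsum (L : C -> Prop) : invariant_g2 L = 60 * gsum L 4.
Proof. reflexivity. Qed.

Lemma g3_gsum (L : C -> Prop) : invariant_g3 L = 140 * gsum L 6.
Proof. reflexivity. Qed.

Lemma wp_half_cubic (L : C -> Prop) (h : C) : is_lattice L -> half_period L h ->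
  cubic (invariant_g2 L) (invariant_g3 L) (wp L h) = 0.
Proof.
intros HL Hh; assert (E := eis3_wp L h HL (proj1 Hh)).
rewrite (half_eis3 L h HL Hh) in E.
unfold cubic; rewrite g2_gsum, g3_gsum.
replace (4 * wp L h ^ 3 - 60 * gsum L 4 * wp L h - 140 * gsum L 6) with
  (4 * (wp L h * wp L h * wp L h - 15 * gsum L 4 * wp L h - 35 * gsum L 6)) by ring.
rewrite <- E; ring.
Qed.

(** [12 * eis 4 h] is the derivative of the cubic at its root [wp h]; if it vanished the root would
    be double and the discriminant zero. *)
Lemma half_eis4_neq0 (L : C -> Prop) (h : C) : is_lattice L -> half_period L h ->
  discr (invariant_g2 L) (invariant_g3 L) <> 0 -> 3 * eis L 4 h <> 0.
Proof.
intros HL Hh HD E; apply HD.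
assert (E3 := wp_half_cubic L h HL Hh).
rewrite (eis4_wp L h HL (proj1 Hh)) in E.
unfold cubic in E3; set (e := wp L h) in *.
assert (E2 : invariant_g2 L = 12 * (e * e)).
{ rewrite g2_gsum; replace (60 * gsum L 4) with (12 * (e * e) - 4 * (3 * (e * e - 5 * gsum L 4))) by ring.
  rewrite E; ring. }
assert (E3' : invariant_g3 L = - (8 * (e * e * e))).
{ replace (invariant_g3 L) with (4 * e ^ 3 - invariant_g2 L * e -
    (4 * e ^ 3 - invariant_g2 L * e - invariant_g3 L)) by ring.
  rewrite E3, E2; ring. }
unfold discr; rewrite E2, E3'; ring.
Qed.

(** Otherwise [half_product] would apply with a vanishing factor and a nonzero right-hand side. This
    replaces a count of the zeros of [wp - wp h]. *)
Lemma wp_eq_half (L : C -> Prop) (h z : C) : is_lattice L -> half_period L h ->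
  discr (invariant_g2 L) (invariant_g3 L) <> 0 -> ~ L z -> wp L z = wp L h -> L (z - h).
Proof.
intros HL Hh HD Hz E; apply NNPP; intros n.
apply (half_eis4_neq0 L h HL Hh HD); rewrite <- (half_product L h z) by auto.
rewrite E; ring.
Qed.

(** Divided differences: dividing the differences of the equations by [e1 - e2] and [e1 - e3] gives
    [A] and [B], and the difference of these divided by [e2 - e3] gives the sum of the roots. *)
Lemma cubic_vieta (g2 g3 e1 e2 e3 : C) : e1 <> e2 -> e1 <> e3 -> e2 <> e3 ->
  cubic g2 g3 e1 = 0 -> cubic g2 g3 e2 = 0 -> cubic g2 g3 e3 = 0 ->
  e3 = - e1 - e2 /\ g2 = 4 * (e1 ^ 2 + e1 * e2 + e2 ^ 2) /\ g3 = - (4 * (e1 * e2 * (e1 + e2))).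
Proof.
intros n12 n13 n23 h1 h2 h3; unfold cubic in *.
assert (A : 4 * (e1 ^ 2 + e1 * e2 + e2 ^ 2) - g2 = 0).
{ apply Cmult_integral_contra with (e1 - e2); [|now apply Cminus_eq_contra].
  replace ((e1 - e2) * (4 * (e1 ^ 2 + e1 * e2 + e2 ^ 2) - g2)) with
    ((4 * e1 ^ 3 - g2 * e1 - g3) - (4 * e2 ^ 3 - g2 * e2 - g3)) by ring.
  rewrite h1, h2; ring. }
assert (B : 4 * (e1 ^ 2 + e1 * e3 + e3 ^ 2) - g2 = 0).
{ apply Cmult_integral_contra with (e1 - e3); [|now apply Cminus_eq_contra].
  replace ((e1 - e3) * (4 * (e1 ^ 2 + e1 * e3 + e3 ^ 2) - g2)) with
    ((4 * e1 ^ 3 - g2 * e1 - g3) - (4 * e3 ^ 3 - g2 * e3 - g3)) by ring.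
  rewrite h1, h3; ring. }
assert (D : e1 + e2 + e3 = 0).
{ apply Cmult_integral_contra with (4 * (e2 - e3)).
  - replace (4 * (e2 - e3) * (e1 + e2 + e3)) with ((4 * (e1 ^ 2 + e1 * e2 + e2 ^ 2) - g2) -
      (4 * (e1 ^ 2 + e1 * e3 + e3 ^ 2) - g2)) by ring.
    rewrite A, B; ring.
  - apply Cmult_neq_0; [apply RtoC_neq; lra | now apply Cminus_eq_contra]. }
assert (E2 : g2 = 4 * (e1 ^ 2 + e1 * e2 + e2 ^ 2)) by (symmetry; now apply Ceq_minus).
split; [|split]; auto.
- replace e3 with (e1 + e2 + e3 - e1 - e2) by ring; rewrite D; ring.
- replace g3 with (4 * e1 ^ 3 - g2 * e1 - (4 * e1 ^ 3 - g2 * e1 - g3)) by ring.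
  rewrite h1, E2; ring.
Qed.

Lemma half_basis (L : C -> Prop) : is_lattice L ->
  exists a b, R_independent (2 * a) (2 * b) /\ L = lattice (2 * a) (2 * b).
Proof.
intros [w1 [w2 [Hi E]]]; exists (w1 / 2), (w2 / 2).
replace (2 * (w1 / 2)) with w1 by field; replace (2 * (w2 / 2)) with w2 by field; auto.
Qed.

Lemma half_values (a b : C) : R_independent (2 * a) (2 * b) ->
  let L := lattice (2 * a) (2 * b) in
  let g2 := invariant_g2 L in let g3 := invariant_g3 L in
  discr g2 g3 <> 0 ->
  let e1 := wp L a in let e2 := wp L b in let e3 := wp L (a + b) in
  e3 = - e1 - e2 /\ g2 = 4 * (e1 ^ 2 + e1 * e2 + e2 ^ 2) /\ g3 = - (4 * (e1 * e2 * (e1 + e2))).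
Proof.
intros Hi L g2 g3 HD e1 e2 e3; assert (HL : is_lattice L) by (now exists (2 * a), (2 * b)).
destruct (half_periods a b Hi) as [Ha [Hb Hc]]; fold L in Ha, Hb, Hc.
assert (D : forall h k, half_period L h -> half_period L k -> ~ L (k - h) -> wp L k <> wp L h).
{ intros h k Hh Hk n E; apply n, wp_eq_half; auto; apply Hk. }
assert (Na : ~ L (- a)) by (rewrite lat_opp_iff; auto; apply Ha).
assert (Nb : ~ L (- b)) by (rewrite lat_opp_iff; auto; apply Hb).
apply cubic_vieta.
- apply D; auto; intros h; apply (proj1 Hc); replace (a + b) with (a - b + (b + b)) by ring.
  apply lat_add; auto; apply Hb.
- apply D; auto; now replace (a - (a + b)) with (- b) by ring.
- apply D; auto; now replace (b - (a + b)) with (- a) by ring.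
- now apply wp_half_cubic.
- now apply wp_half_cubic.
- now apply wp_half_cubic.
Qed.

Lemma cubic_factor (e1 e2 x : C) :
  cubic (4 * (e1 ^ 2 + e1 * e2 + e2 ^ 2)) (- (4 * (e1 * e2 * (e1 + e2)))) x =
  4 * ((x - e1) * ((x - e2) * (x - (- e1 - e2)))).
Proof. unfold cubic; ring. Qed.

(** The residue [3 e^2 - q] is the constant [3 eis 4 h] of [half_product] at the half period with
    value [e], since [g2 = 4 q]. In this form [dbl] matches [wp_double_sum] term by term and is
    visibly close to [x / 4] at infinity. *)
Lemma dbl_partial_fractions (e1 e2 x : C) :
  let e3 := - e1 - e2 in let q := e1 ^ 2 + e1 * e2 + e2 ^ 2 in
  x - e1 <> 0 -> x - e2 <> 0 -> x - e3 <> 0 ->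
  4 * dbl (4 * q) (- (4 * (e1 * e2 * (e1 + e2)))) x =
  x + (3 * e1 ^ 2 - q) / (x - e1) + (3 * e2 ^ 2 - q) / (x - e2) + (3 * e3 ^ 2 - q) / (x - e3).
Proof.
intros e3 q n1 n2 n3; unfold dbl, q; rewrite cubic_factor; fold e3.
assert (E : forall A B, 4 * B <> 0 -> 4 * (A / (4 * B)) = A / B).
{ intros A B h; field; intros E; apply h; rewrite E; ring. }
rewrite E by (repeat apply Cmult_neq_0; auto; apply RtoC_neq; lra).
unfold e3 in *; field; auto.
Qed.

(** By [half_product] each shifted term of [wp_double_sum] is a simple fraction in [wp L z], and the
    four together are the partial fractions of [dbl]. When [2 * z] is a pole but [z] is not, [z] is
    a half period up to [L] and [wp L z] a root of the cubic. *)
Lemma wp_double (L : C -> Prop) (z : C) : is_lattice L ->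
  discr (invariant_g2 L) (invariant_g3 L) <> 0 ->
  wp_lattice L (2 * z) = dbl_opt (invariant_g2 L) (invariant_g3 L) (wp_lattice L z).
Proof.
intros HL HD; destruct (half_basis L HL) as [a [b [Hi EL]]].
assert (V := half_values a b Hi); rewrite <- EL in V; destruct (V HD) as [V1 [V2 V3]]; clear V.
destruct (half_periods a b Hi) as [Ha [Hb Hc]]; rewrite <- EL in Ha, Hb, Hc.
set (e1 := wp L a) in *; set (e2 := wp L b) in *.
destruct (classic (L z)) as [Hz|Hz].
{ rewrite !wp_lattice_in; auto; replace (2 * z) with (z + z) by ring; now apply lat_add. }
rewrite (wp_lattice_out L z) by auto; simpl.
assert (R : forall h, half_period L h -> L (z - h) -> wp L z = wp L h).
{ intros h Hh h1; replace z with (h + (z - h)) by ring; apply wp_periodic; auto; apply Hh. }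
assert (FX : cubic (invariant_g2 L) (invariant_g3 L) (wp L z) =
  4 * ((wp L z - e1) * ((wp L z - e2) * (wp L z - (- e1 - e2)))))
  by (rewrite V2, V3; apply cubic_factor).
destruct (classic (L (2 * z))) as [H2|H2].
- rewrite wp_lattice_in by auto.
  destruct (Ceq_dec (cubic (invariant_g2 L) (invariant_g3 L) (wp L z)) 0) as [|n]; [easy|].
  elim n; destruct (half_cases L a b z EL H2) as [h|[h|[h|h]]]; [easy| | |].
  + rewrite (R a Ha h); now apply wp_half_cubic.
  + rewrite (R b Hb h); now apply wp_half_cubic.
  + rewrite (R _ Hc h); now apply wp_half_cubic.
- assert (T : forall h, half_period L h -> ~ L (z - h)).
  { intros h [_ [h2 _]] h1; apply H2; replace (2 * z) with (z - h + (z - h) + (h + h)) by ring.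
    apply lat_add; auto; now apply lat_add. }
  assert (N : forall h, half_period L h -> wp L z - wp L h <> 0 /\
    wp L (z - h) - wp L h = (3 * wp L h ^ 2 - invariant_g2 L / 4) / (wp L z - wp L h)).
  { intros h Hh; assert (n : wp L z - wp L h <> 0).
    { intros E; apply (T h Hh), wp_eq_half; auto; now apply Ceq_minus. }
    split; auto.
    replace (wp L (z - h) - wp L h) with ((wp L (z - h) - wp L h) * (wp L z - wp L h) / (wp L z - wp L h))
      by (field; auto).
    rewrite half_product, (eis4_wp L h HL (proj1 Hh)), g2_gsum; auto; field; auto. }
  destruct (N a Ha) as [n1 E1]; destruct (N b Hb) as [n2 E2]; destruct (N (a + b) Hc) as [n3 E3].
  rewrite V1 in n3, E3; fold e1 in n1, E1; fold e2 in n2, E2.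
  destruct (Ceq_dec (cubic (invariant_g2 L) (invariant_g3 L) (wp L z)) 0) as [E|n].
  { rewrite FX in E; exfalso; revert E.
    repeat apply Cmult_neq_0; auto; apply RtoC_neq; lra. }
  rewrite wp_lattice_out by auto; f_equal.
  assert (S := wp_double_sum a b z Hi); rewrite <- EL in S; specialize (S H2).
  rewrite V1 in S; fold e1 in S; fold e2 in S; rewrite E1, E2, E3 in S.
  replace (wp L (2 * z)) with (4 * wp L (2 * z) / 4) by field.
  rewrite S.
  replace (dbl (invariant_g2 L) (invariant_g3 L) (wp L z)) with
    (4 * dbl (invariant_g2 L) (invariant_g3 L) (wp L z) / 4) by field.
  f_equal; rewrite V2, V3.
  assert (P := dbl_partial_fractions e1 e2 (wp L z) n1 n2 n3); cbv zeta in P.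
  rewrite P; field; auto.
Qed.

(** By partial fractions [4 (D x - D y)] is [x - y] times 1 minus three fractions. At distance at
    least [s] from the roots these have total modulus at most 1, so the factor is at most 2. *)
Lemma dbl_contract (e1 e2 : C) : exists R0, (0 <= R0)%R /\ forall x y,
  (R0 <= Cmod x)%R -> (R0 <= Cmod y)%R ->
  let q := e1 ^ 2 + e1 * e2 + e2 ^ 2 in
  let D := dbl (4 * q) (- (4 * (e1 * e2 * (e1 + e2)))) in
  (Cmod (D x - D y) <= Cmod (x - y) / 2)%R.
Proof.
set (e3 := - e1 - e2); set (q := e1 ^ 2 + e1 * e2 + e2 ^ 2).
set (c := fun e => 3 * e ^ 2 - q).
set (s := (1 + Cmod (c e1) + Cmod (c e2) + Cmod (c e3))%R).
assert (p1 := Cmod_ge_0 (c e1)); assert (p2 := Cmod_ge_0 (c e2)); assert (p3 := Cmod_ge_0 (c e3)).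
assert (q1 := Cmod_ge_0 e1); assert (q2 := Cmod_ge_0 e2); assert (q3 := Cmod_ge_0 e3).
assert (Hs : (1 <= s)%R) by (unfold s; lra).
exists (Cmod e1 + Cmod e2 + Cmod e3 + s)%R; split; [lra|].
intros x y Hx Hy q' D.
assert (F : forall e u, (Cmod e <= Cmod e1 + Cmod e2 + Cmod e3)%R ->
  (Cmod e1 + Cmod e2 + Cmod e3 + s <= Cmod u)%R -> (s <= Cmod (u - e))%R /\ u - e <> 0).
{ intros e u he hu; assert (t := Cmod_triangle (u - e) e).
  replace (u - e + e) with u in t by ring; split; [lra|]; apply Cmod_gt_0; lra. }
destruct (F e1 x ltac:(lra) Hx) as [x1 nx1]; destruct (F e2 x ltac:(lra) Hx) as [x2 nx2].
destruct (F e3 x ltac:(lra) Hx) as [x3 nx3].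
destruct (F e1 y ltac:(lra) Hy) as [y1 ny1]; destruct (F e2 y ltac:(lra) Hy) as [y2 ny2].
destruct (F e3 y ltac:(lra) Hy) as [y3 ny3].
assert (E : 4 * (D x - D y) = (x - y) * (1 - (c e1 / ((x - e1) * (y - e1)) +
  (c e2 / ((x - e2) * (y - e2)) + c e3 / ((x - e3) * (y - e3)))))).
{ replace (4 * (D x - D y)) with (4 * D x - 4 * D y) by ring.
  assert (P : forall u, u - e1 <> 0 -> u - e2 <> 0 -> u - e3 <> 0 ->
    4 * D u = u + c e1 / (u - e1) + c e2 / (u - e2) + c e3 / (u - e3))
    by exact (dbl_partial_fractions e1 e2).
  rewrite !P by auto.
  generalize (c e1) (c e2) (c e3); intros c1 c2 c3; field; repeat split; auto. }
assert (G : forall e, (s <= Cmod (x - e))%R -> (s <= Cmod (y - e))%R ->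
  (Cmod (c e / ((x - e) * (y - e))) <= Cmod (c e) / s)%R).
{ intros e h1 h2; unfold Cdiv; rewrite Cmod_mult, Cmod_inv_all, Cmod_mult.
  apply Rdiv_le_compat; auto using Cmod_ge_0; try lra; apply Rle_refl || nra. }
assert (B : (Cmod (1 - (c e1 / ((x - e1) * (y - e1)) +
  (c e2 / ((x - e2) * (y - e2)) + c e3 / ((x - e3) * (y - e3))))) <= 2)%R).
{ eapply Rle_trans; [apply (Cmod_triangle 1 (- _))|]; rewrite Cmod_opp, Cmod_1.
  assert (T : (Cmod (c e1) / s + (Cmod (c e2) / s + Cmod (c e3) / s) <= 1)%R).
  { apply Rmult_le_reg_r with s; [lra|].
    replace ((Cmod (c e1) / s + (Cmod (c e2) / s + Cmod (c e3) / s)) * s)%R with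
      (Cmod (c e1) + Cmod (c e2) + Cmod (c e3))%R by (field; lra).
    unfold s; lra. }
  assert (t1 := Cmod_triangle (c e1 / ((x - e1) * (y - e1)))
    (c e2 / ((x - e2) * (y - e2)) + c e3 / ((x - e3) * (y - e3)))).
  assert (t2 := Cmod_triangle (c e2 / ((x - e2) * (y - e2))) (c e3 / ((x - e3) * (y - e3)))).
  assert (G1 := G e1 x1 y1); assert (G2 := G e2 x2 y2); assert (G3 := G e3 x3 y3); lra. }
assert (N : (4 * Cmod (D x - D y) <= Cmod (x - y) * 2)%R).
{ rewrite <- Cmod_nat_scal, E, Cmod_mult by lra.
  apply Rmult_le_compat_l; auto using Cmod_ge_0. }
lra.
Qed.

Lemma wp_near_zero (L : C -> Prop) : is_lattice L -> exists B r, (0 <= B)%R /\ (0 < r)%R /\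
  forall z, (0 < Cmod z < r)%R -> ~ L z /\ (Cmod (wp L z - / z ^ 2) <= B)%R.
Proof.
intros HL; destruct (wp_laurent L HL) as [K [r [Hr H]]].
assert (P4 := Cmod_ge_0 (gsum L 4)); assert (P6 := Cmod_ge_0 (gsum L 6)).
assert (PK := Rabs_pos K); assert (PK' := Rle_abs K).
exists (Rabs K + 3 * Cmod (gsum L 4) + 5 * Cmod (gsum L 6))%R, (Rmin r 1); split; [lra|].
split; [apply Rmin_glb_lt; lra|]; intros z [h1 h2].
assert (h3 := Rlt_le_trans _ _ _ h2 (Rmin_l _ _)); assert (h4 := Rlt_le_trans _ _ _ h2 (Rmin_r _ _)).
destruct (H z (conj h1 h3)) as [_ [Lz E]]; split; auto.
assert (Pow : forall n, (0 <= Cmod z ^ n <= 1)%R).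
{ intros n; split; [apply pow_le; lra|]; rewrite <- (pow1 n); apply pow_incr; lra. }
replace (wp L z - / z ^ 2) with ((wp L z - / z ^ 2 - 3 * gsum L 4 * z ^ 2 - 5 * gsum L 6 * z ^ 4)
  + (3 * (gsum L 4 * z ^ 2) + 5 * (gsum L 6 * z ^ 4))) by ring.
eapply Rle_trans; [apply Cmod_triangle|].
eapply Rle_trans; [apply Rplus_le_compat; [apply E | apply Cmod_triangle]|].
rewrite !Cmod_nat_scal, !Cmod_mult, !Cmod_pow by lra.
assert (A5 := Pow 5%nat); assert (A2 := Pow 2%nat); assert (A4 := Pow 4%nat).
set (t5 := (Cmod z ^ 5)%R) in *; set (t2 := (Cmod z ^ 2)%R) in *; set (t4 := (Cmod z ^ 4)%R) in *.
nra.
Qed.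

Lemma half_pow_small (eps : R) : (0 < eps)%R -> exists n : nat, ((/ 2) ^ n < eps)%R.
Proof.
intros He; destruct (pow_lt_1_zero (/ 2) ltac:(rewrite Rabs_right; lra) eps He) as [N HN].
exists N; specialize (HN N (Nat.le_refl N)); rewrite Rabs_right in HN; auto.
apply Rle_ge, pow_le; lra.
Qed.

(* Near [0] the difference of the two functions is bounded, and the doubling
   formula halves it at each step, so that it vanishes; doubling again
   propagates the equality to the whole plane. *)
Lemma lattice_from_invariants (L L' : C -> Prop) : is_lattice L -> is_lattice L' ->
  invariant_g2 L = invariant_g2 L' -> invariant_g3 L = invariant_g3 L' ->
  discr (invariant_g2 L) (invariant_g3 L) <> 0 -> L = L'.
Proof.
intros HL HL' E2 E3 HD.
assert (HD' : discr (invariant_g2 L') (invariant_g3 L') <> 0) by (now rewrite <- E2, <- E3).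
assert (DL := fun z => wp_double L z HL HD); assert (DL' := fun z => wp_double L' z HL' HD').
rewrite <- E2, <- E3 in DL'.
set (g2 := invariant_g2 L) in *; set (g3 := invariant_g3 L) in *.
assert (Hcon : exists R0, (0 <= R0)%R /\ forall x y, (R0 <= Cmod x)%R -> (R0 <= Cmod y)%R ->
  (Cmod (dbl g2 g3 x - dbl g2 g3 y) <= Cmod (x - y) / 2)%R).
{ destruct (half_basis L HL) as [a [b [Hi EL]]].
  assert (V := half_values a b Hi); rewrite <- EL in V; destruct (V HD) as [_ [V2 V3]].
  unfold g2, g3; rewrite V2, V3; apply dbl_contract. }
destruct Hcon as [R0 [PR0 Hcon]].
destruct (wp_near_zero L HL) as [B [r [PB [Hr H]]]].
destruct (wp_near_zero L' HL') as [B' [r' [PB' [Hr' H']]]].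
(* For [|z| < / T] the modulus of [/ z ^ 2] is at least [T], so both functions, within [B] and [B']
   of it, lie in the region of contraction. *)
set (T := (R0 + B + B' + 1)%R).
set (r0 := Rmin (/ T) (Rmin r r')).
assert (HT : (0 < / T)%R) by (apply Rinv_0_lt_compat; unfold T; lra).
assert (Hr0 : (0 < r0)%R) by (repeat apply Rmin_glb_lt; auto).
assert (Near : forall z, (0 < Cmod z < r0)%R -> ~ L z /\ ~ L' z /\
  (Cmod (wp L z - wp L' z) <= B + B')%R /\ (R0 <= Cmod (wp L z))%R /\ (R0 <= Cmod (wp L' z))%R).
{ intros z [h1 h2].
  assert (k0 := Rlt_le_trans _ _ _ h2 (Rmin_l _ _)).
  assert (k1 := Rlt_le_trans _ _ _ h2 (Rle_trans _ _ _ (Rmin_r _ _) (Rmin_l _ _))).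
  assert (k2 := Rlt_le_trans _ _ _ h2 (Rle_trans _ _ _ (Rmin_r _ _) (Rmin_r _ _))).
  destruct (H z (conj h1 k1)) as [n b]; destruct (H' z (conj h1 k2)) as [n' b'].
  assert (Big : (T <= Cmod (/ z ^ 2))%R).
  { rewrite Cmod_inv_all, Cmod_pow.
    assert (t : (T <= / Cmod z)%R).
    { rewrite <- (Rinv_inv T); apply Rinv_le_contravar; lra. }
    replace (/ Cmod z ^ 2)%R with (/ Cmod z * / Cmod z)%R by (field; lra).
    unfold T in *; nra. }
  split; [|split; [|split; [|split]]]; auto.
  - replace (wp L z - wp L' z) with ((wp L z - / z ^ 2) + - (wp L' z - / z ^ 2)) by ring.
    eapply Rle_trans; [apply Cmod_triangle|]; rewrite Cmod_opp; lra.
  - assert (t := Cmod_triangle (wp L z) (- (wp L z - / z ^ 2))); rewrite Cmod_opp in t.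
    replace (wp L z + - (wp L z - / z ^ 2)) with (/ z ^ 2) in t by ring; unfold T in Big; lra.
  - assert (t := Cmod_triangle (wp L' z) (- (wp L' z - / z ^ 2))); rewrite Cmod_opp in t.
    replace (wp L' z + - (wp L' z - / z ^ 2)) with (/ z ^ 2) in t by ring; unfold T in Big; lra. }
assert (Dbl : forall K, is_lattice K -> (forall z, wp_lattice K (2 * z) = dbl_opt g2 g3 (wp_lattice K z)) ->
  forall z, ~ K z -> ~ K (2 * z) -> wp K (2 * z) = dbl g2 g3 (wp K z)).
{ intros K HK D z h1 h2; specialize (D z); rewrite !wp_lattice_out in D by auto; unfold dbl_opt in D.
  destruct (Ceq_dec (cubic g2 g3 (wp K z)) 0); [discriminate | congruence]. }
assert (Half : forall z, Cmod (z / 2) = (Cmod z / 2)%R).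
{ intros z; unfold Cdiv; rewrite Cmod_mult, Cmod_inv_all, Cmod_R, Rabs_right; lra. }
assert (Step : forall z, (0 < Cmod z < r0)%R ->
  (Cmod (wp L z - wp L' z) <= Cmod (wp L (z / 2) - wp L' (z / 2)) / 2)%R).
{ intros z Hz; destruct (Near z Hz) as [n [n' _]].
  destruct (Near (z / 2)) as [m [m' [_ [c c']]]]; [rewrite Half; lra|].
  assert (Ez : 2 * (z / 2) = z) by field.
  assert (A := Dbl L HL DL (z / 2) m); assert (A' := Dbl L' HL' DL' (z / 2) m').
  rewrite Ez in A, A'; rewrite A, A' by auto; now apply Hcon. }
assert (Iter : forall n z, (0 < Cmod z < r0)%R ->
  (Cmod (wp L z - wp L' z) <= (B + B') * (/ 2) ^ n)%R).
{ induction n as [|n IH]; intros z Hz.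
  - simpl; destruct (Near z Hz) as [_ [_ [h _]]]; lra.
  - eapply Rle_trans; [apply Step; auto|].
    specialize (IH (z / 2)); rewrite Half in IH; specialize (IH ltac:(lra)); simpl; lra. }
assert (Loc : forall z : C, (Cmod z < r0)%R -> wp_lattice L z = wp_lattice L' z).
{ intros z Hz; destruct (Ceq_dec z 0) as [->|nz].
  - rewrite !wp_lattice_in; auto; now apply lat_0.
  - assert (Pz : (0 < Cmod z)%R) by now apply Cmod_gt_0.
    destruct (Near z (conj Pz Hz)) as [n [n' _]].
    rewrite !wp_lattice_out by auto; f_equal; apply Ceq_minus, Cmod_eq_0, cond_eq.
    intros eps He; rewrite Rminus_0_r, Rabs_right by (apply Rle_ge, Cmod_ge_0).
    destruct (half_pow_small (eps / (B + B' + 1))) as [k Hk]; [apply Rdiv_lt_0_compat; lra|].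
    eapply Rle_lt_trans; [apply (Iter k); auto|].
    assert (Pk : (0 < (/ 2) ^ k)%R) by (apply pow_lt; lra).
    apply Rlt_le_trans with ((B + B' + 1) * (/ 2) ^ k)%R; [nra|].
    replace eps with ((B + B' + 1) * (eps / (B + B' + 1)))%R by (field; lra).
    apply Rmult_le_compat_l; lra. }
assert (Glob : forall n z, (Cmod z * (/ 2) ^ n < r0)%R -> wp_lattice L z = wp_lattice L' z).
{ induction n as [|n IH]; intros z Hz.
  - apply Loc; simpl in Hz; lra.
  - replace z with (2 * (z / 2)) by field.
    rewrite DL, DL'; f_equal; apply IH; rewrite Half; simpl in Hz; lra. }
assert (All : forall z, wp_lattice L z = wp_lattice L' z).
{ intros z; assert (Pz := Cmod_ge_0 z).
  destruct (half_pow_small (r0 / (Cmod z + 1))) as [k Hk]; [apply Rdiv_lt_0_compat; lra|].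
  apply (Glob k).
  assert (Pk : (0 < (/ 2) ^ k)%R) by (apply pow_lt; lra).
  apply Rlt_le_trans with ((Cmod z + 1) * (/ 2) ^ k)%R; [nra|].
  replace r0 with ((Cmod z + 1) * (r0 / (Cmod z + 1)))%R by (field; lra).
  apply Rmult_le_compat_l; lra. }
(* Each lattice is the set of poles of its function. *)
apply set_ext; intros z; split; intros Hz; apply NNPP; intros n; specialize (All z).
- rewrite (wp_lattice_in L), (wp_lattice_out L') in All by auto; discriminate.
- rewrite (wp_lattice_in L'), (wp_lattice_out L) in All by auto; discriminate.
Qed.

(** * The Landen transformation *)

Lemma has_sum_conj (D : C -> Prop) (f : C -> C) (l : C) :
  has_sum D f l -> has_sum D (fun w => Cconj (f w)) (Cconj l).
Proof.
intros H eps He; destruct (H eps He) as [A [HA HB]]; exists A; split; auto.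
intros B h1 h2 h3.
replace (list_sum (fun w => Cconj (f w)) B) with (Cconj (list_sum f B)).
- rewrite <- Cminus_conj, Cmod_conj; auto.
- clear; induction B as [|b B IH]; simpl.
  + apply Ceq_ReIm; unfold Re, Im; simpl; ring.
  + now rewrite Cplus_conj, IH.
Qed.

Lemma Cinv_conj_all (x : C) : Cconj (/ x) = / Cconj x.
Proof.
destruct (Ceq_dec x 0) as [->|n]; [|now apply Cinv_conj].
replace (Cconj 0) with (RtoC 0) by (apply Ceq_ReIm; unfold Re, Im; simpl; ring).
rewrite Cinv_0; apply Ceq_ReIm; unfold Re, Im; simpl; ring.
Qed.

Lemma wp_conj (L : C -> Prop) (z : C) : is_lattice L -> (forall w, L w -> L (Cconj w)) -> ~ L z ->
  wp L (Cconj z) = Cconj (wp L z).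
Proof.
intros HL Hc Hz.
assert (Hz' : ~ L (Cconj z)) by (intros h; apply Hz; rewrite <- (Cconj_conj z); auto).
apply has_sum_unique with (1 := wp_has_sum L (Cconj z) HL Hz').
apply has_sum_ext with (fun w => Cconj (/ (z - Cconj w) ^ 2 - / Cconj w ^ 2)).
- intros w _; rewrite Cminus_conj, !Cinv_conj_all, !Cpow_conj, Cminus_conj, Cconj_conj; auto.
- apply (has_sum_reindex L L Cconj Cconj (fun w => Cconj (/ (z - w) ^ 2 - / w ^ 2))); auto using Cconj_conj.
  now apply has_sum_conj, wp_has_sum.
Qed.

(** * Rescaling: the set of [z] with [L (c * z)] is [L] divided by [c] *)

Lemma lat_scale (L : C -> Prop) (c : C) : is_lattice L -> c <> 0 -> is_lattice (fun z => L (c * z)).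
Proof.
intros [w1 [w2 [Hi ->]]] Hc; exists (w1 / c), (w2 / c); split.
- intros a b E; apply Hi.
  replace (a * w1 + b * w2) with (c * (a * (w1 / c) + b * (w2 / c))) by (field; auto).
  rewrite E; ring.
- apply set_ext; intros z; split; intros [m [n E]]; exists m, n.
  + replace z with (c * z / c) by (field; auto); rewrite E; field; auto.
  + rewrite E; field; auto.
Qed.

Lemma gsum_scale (L : C -> Prop) (c : C) (n : nat) : is_lattice L -> c <> 0 -> (3 <= n)%nat ->
  gsum (fun z => L (c * z)) n = c ^ n * gsum L n.
Proof.
intros HL Hc Hn.
apply has_sum_unique with (1 := gsum_has_sum _ n (lat_scale L c HL Hc) Hn).
apply has_sum_ext with (fun w => c ^ n * / (c * w) ^ n).
- intros w [_ Hw]; rewrite Cpow_mult_l; field; split; now apply Cpow_nz.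
- apply has_sum_scal.
  apply (has_sum_reindex _ (nonzero_points L) (fun w => c * w) (fun v => v / c) (fun w => / w ^ n)).
  + intros w [h1 h2]; split; auto; now apply Cmult_neq_0.
  + intros v [h1 h2]; split; [now replace (c * (v / c)) with v by (field; auto)|].
    intros E; apply h2; replace v with (c * (v / c)) by (field; auto); rewrite E; ring.
  + intros; field; auto.
  + intros; field; auto.
  + now apply gsum_has_sum.
Qed.

Lemma wp_lattice_scale (L : C -> Prop) (c z : C) : is_lattice L -> c <> 0 ->
  wp_lattice (fun z => L (c * z)) z = sphere_scale (c ^ 2) (wp_lattice L (c * z)).
Proof.
intros HL Hc; assert (HL' := lat_scale L c HL Hc).
destruct (classic (L (c * z))) as [Hz|Hz].
- now rewrite !wp_lattice_in.
- rewrite (wp_lattice_out _ _ HL' Hz), (wp_lattice_out _ _ HL Hz); simpl; f_equal.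
  apply has_sum_unique with (1 := wp_has_sum _ z HL' Hz).
  replace (c * (c * 1)) with (c ^ 2) by ring.
  apply has_sum_ext with (fun w => c ^ 2 * (/ (c * z - c * w) ^ 2 - / (c * w) ^ 2)).
  + assert (S : forall x, c ^ 2 * / (c * x) ^ 2 = / x ^ 2).
    { intros x; destruct (Ceq_dec x 0) as [->|n]; [|field; auto].
      replace ((c * 0) ^ 2) with (RtoC 0) by ring; replace (RtoC 0 ^ 2) with (RtoC 0) by ring.
      rewrite Cinv_0; ring. }
    intros w _; rewrite <- (S (z - w)), <- (S w).
    replace (c * z - c * w) with (c * (z - w)) by ring; ring.
  + apply has_sum_scal.
    apply (has_sum_reindex _ L (fun w => c * w) (fun v => v / c) (fun w => / (c * z - w) ^ 2 - / w ^ 2)).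
    * auto.
    * intros v Hv; now replace (c * (v / c)) with v by (field; auto).
    * intros; field; auto.
    * intros; field; auto.
    * now apply wp_has_sum.
Qed.

(** A period carries the pole 0 to a pole, and the poles are exactly the points of [L]. *)
Lemma periods_lattice (p : C -> option C) (L : C -> Prop) (w1 w2 : C) : is_lattice L ->
  (forall z, p z = wp_lattice L z) -> fundamental_periods p w1 w2 -> lattice w1 w2 = L.
Proof.
intros HL Hp [_ H]; apply set_ext; intros w; rewrite <- H; unfold is_period; split.
- intros Hw; specialize (Hw 0); rewrite !Hp, (wp_lattice_in L 0) in Hw by now apply lat_0.
  apply NNPP; intros n; rewrite wp_lattice_out in Hw; auto; [discriminate|].
  now replace (0 + w) with w by ring.
- intros Lw z; rewrite !Hp; destruct (classic (L z)) as [Hz|Hz].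
  + rewrite !wp_lattice_in; auto; now apply lat_add.
  + rewrite !wp_lattice_out; auto; [|now rewrite lat_add_iff]; now rewrite wp_periodic.
Qed.

(* On the imaginary axis [wp] is real and tends to [-oo] at [0]; below the
   half period it avoids the three half-period values, so none of the real
   roots of the cubic lies below [wp omega']. *)
Lemma wp_imaginary_half_min (x y t : R) : (0 < x)%R -> (0 < y)%R ->
  let a := RtoC x in let b := Ci * RtoC y in let L := lattice (2 * a) (2 * b) in
  R_independent (2 * a) (2 * b) ->
  discr (invariant_g2 L) (invariant_g3 L) <> 0 ->
  cubic (invariant_g2 L) (invariant_g3 L) t = 0 ->
  Im (wp L b) = 0%R /\ (Re (wp L b) <= t)%R.
Proof.
intros Hx Hy a b L Hi HD Ht.
assert (HL : is_lattice L) by (now exists (2 * a), (2 * b)).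
destruct (half_periods a b Hi) as [Ha [Hb Hc]]; fold L in Ha, Hb, Hc.
assert (Coord : forall s : R, Ci * RtoC s = RtoC 0 * (2 * a) + RtoC (s / (2 * y)) * (2 * b)).
{ intros s; unfold b; rewrite RtoC_div, RtoC_mult by lra; field; apply RtoC_neq; lra. }
assert (Small : forall s, (0 < s <= y)%R -> (0 < s / (2 * y) <= / 2)%R).
{ intros s Hs; split; [apply Rdiv_lt_0_compat; lra|].
  apply Rmult_le_reg_r with (2 * y)%R; [lra|]; field_simplify; lra. }
assert (Out : forall s, (0 < s <= y)%R -> ~ L (Ci * s)).
{ intros s Hs; rewrite Coord; apply not_lattice_coords; auto; right; intros n En.
  specialize (Small s Hs); rewrite En in Small.
  assert (0 < n)%Z by (apply lt_IZR; lra); assert (n < 1)%Z by (apply lt_IZR; lra); lia. }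
assert (Hconj : forall w, L w -> L (Cconj w)).
{ intros w [m [n ->]]; exists m, (- n)%Z; rewrite opp_IZR, RtoC_opp; unfold a, b.
  apply Ceq_ReIm; unfold Re, Im; simpl; ring. }
assert (Real : forall s, (0 < s <= y)%R -> Im (wp L (Ci * s)) = 0%R).
(* Conjugation sends [Ci * s] to its opposite, and [wp] is even. *)
{ intros s Hs; assert (E := wp_conj L (Ci * s) HL Hconj (Out s Hs)).
  replace (Cconj (Ci * s)) with (- (Ci * s)) in E
    by (apply Ceq_ReIm; unfold Re, Im; simpl; ring).
  rewrite wp_even in E by auto; apply (f_equal Im) in E; rewrite im_conj in E; lra. }
split; [apply Real; lra|].
apply Rnot_lt_le; intros Hlt.
destruct (wp_near_zero L HL) as [B [r [PB [Hr HB]]]].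
set (T := (B + Rabs t + 1)%R).
assert (PT := Rabs_pos t).
(* At [Ci * s1] the function is within [B] of [- / s1^2 <= - T], hence below [t]. *)
set (s1 := Rmin (y / 2) (Rmin (r / 2) (/ T))).
assert (HT : (1 <= T)%R) by (unfold T; lra).
assert (HTi : (0 < / T)%R) by (apply Rinv_0_lt_compat; lra).
assert (Ps1 : (0 < s1)%R) by (repeat apply Rmin_glb_lt; lra).
assert (s1y : (s1 <= y / 2)%R) by apply Rmin_l.
assert (s1r : (s1 <= r / 2)%R) by (eapply Rle_trans; [apply Rmin_r | apply Rmin_l]).
assert (s1T : (s1 <= / T)%R) by (eapply Rle_trans; [apply Rmin_r | apply Rmin_r]).
set (f := fun s : R => (Re (wp L (Ci * s)) - t)%R).
assert (F1 : (f s1 < 0)%R).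
{ assert (Cm : Cmod (Ci * s1) = s1) by (rewrite Cmod_mult, Cmod_Ci, Cmod_R, Rabs_right; lra).
  destruct (HB (Ci * s1)) as [_ h]; [rewrite Cm; lra|].
  assert (h' := Rle_trans _ _ _ (re_le_Cmod _) h).
  replace (/ (Ci * s1) ^ 2) with (RtoC (- (/ s1 * / s1))) in h'.
  2:{ assert (Rn : RtoC s1 <> 0) by (apply RtoC_neq; lra).
      replace ((Ci * s1) ^ 2) with (- (RtoC s1 * RtoC s1))
        by (apply Ceq_ReIm; unfold Re, Im; simpl; ring).
      rewrite RtoC_opp, RtoC_mult, RtoC_inv by lra; field; auto. }
  assert (Ti : (T <= / s1)%R) by (rewrite <- (Rinv_inv T); now apply Rinv_le_contravar).
  assert (h2 : (T * T <= / s1 * / s1)%R) by nra.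
  apply Rabs_le_between in h'.
  assert (h3 := Rle_abs (- t)); rewrite Rabs_Ropp in h3.
  replace (Re (wp L (Ci * s1) - RtoC (- (/ s1 * / s1)))) with
    (Re (wp L (Ci * s1)) + / s1 * / s1)%R in h' by (unfold Re; simpl; ring).
  unfold f; assert (T <= T * T)%R by nra; unfold T in *; lra. }
assert (F2 : (0 < f y)%R) by (unfold f; fold b; lra).
destruct (IVT_interv f s1 y) as [s [Hs Es]]; auto; try lra.
{ intros s Hs; apply continuity_pt_filterlim.
  assert (Hs' : (0 < s <= y)%R) by lra.
  assert (d : curve_deriv (fun s : R => wp L (0 + s * Ci)) s (-2 * eis L 3 (0 + s * Ci) * Ci)).
  { apply (curve_deriv_comp (wp L) (fun s : R => 0 + s * Ci)); [apply curve_deriv_line|].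
    apply wp_cderiv; auto; replace (0 + s * Ci) with (Ci * s) by ring; auto. }
  apply (ex_derive_continuous f).
  exists (Re (-2 * eis L 3 (0 + s * Ci) * Ci) - 0)%R.
  apply is_derive_ext with (fun s : R => (Re (wp L (0 + s * Ci)) - t)%R).
  { intros u; unfold f; now replace (0 + u * Ci) with (Ci * u) by ring. }
  apply (is_derive_minus (fun s : R => Re (wp L (0 + s * Ci))) (fun _ => t));
    [apply d | apply (is_derive_const (K := R_AbsRing) (V := R_NormedModule))]. }
assert (Hs' : (0 < s <= y)%R) by lra.
assert (Sy : (s < y)%R).
{ destruct Hs' as [_ [h|h]]; auto; rewrite h in Es; lra. }
assert (Ew : wp L (Ci * s) = t).
{ apply Ceq_ReIm; [change (Re (wp L (Ci * s)) = t); unfold f in Es; lra | rewrite Real; auto]. }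
destruct (half_values a b Hi HD) as [V1 [V2 V3]]; fold L in V1, V2, V3.
rewrite V2, V3, cubic_factor, <- V1 in Ht.
(* As a root of the cubic, [t] is also the value at a half period [h]. Then [Ci * s] would be
   congruent to [h], which the strict bound [s < y] excludes. *)
assert (Root : exists h, half_period L h /\ (h = a \/ h = b \/ h = a + b) /\ RtoC t = wp L h).
{ apply NNPP; intros n; revert Ht.
  repeat apply Cmult_neq_0; [apply RtoC_neq; lra | | |]; apply Cminus_eq_contra; intros E; apply n.
  - now exists a; auto.
  - now exists b; auto.
  - now exists (a + b); auto. }
destruct Root as [h [Hh [Eh Et]]]; rewrite <- Ew in Et.
apply (wp_eq_half L h (Ci * s) HL Hh HD (Out s Hs')) in Et.
assert (P := Small s Hs').
assert (Q : (s / (2 * y) < / 2)%R).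
{ apply Rmult_lt_reg_r with (2 * y)%R; [lra|]; field_simplify; lra. }
assert (Ea : forall u : C, u = RtoC (/ 2) * (2 * u)).
{ intros u; rewrite RtoC_inv by lra; field. }
revert Et; rewrite Coord.
destruct Eh as [-> | [-> | ->]].
- replace (RtoC 0 * (2 * a) + RtoC (s / (2 * y)) * (2 * b) - a) with
    (RtoC (- / 2) * (2 * a) + RtoC (s / (2 * y)) * (2 * b))
    by (rewrite (Ea a) at 3; rewrite RtoC_opp; ring).
  apply not_lattice_coords; auto; left; apply neg_half_not_int.
- replace (RtoC 0 * (2 * a) + RtoC (s / (2 * y)) * (2 * b) - b) with
    (RtoC 0 * (2 * a) + RtoC (s / (2 * y) - / 2) * (2 * b))
    by (rewrite (Ea b) at 3; rewrite RtoC_minus; ring).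
  apply not_lattice_coords; auto; right; intros n En.
  assert (n < 0)%Z by (apply lt_IZR; lra); assert (-1 < n)%Z by (apply lt_IZR; simpl; lra); lia.
- replace (RtoC 0 * (2 * a) + RtoC (s / (2 * y)) * (2 * b) - (a + b)) with
    (RtoC (- / 2) * (2 * a) + RtoC (s / (2 * y) - / 2) * (2 * b))
    by (rewrite (Ea a) at 3; rewrite (Ea b) at 3; rewrite RtoC_opp, RtoC_minus; ring).
  apply not_lattice_coords; auto; left; apply neg_half_not_int.
Qed.

Lemma discr_mu (mu : R) :
  discr (RtoC (4 / 3 - mu ^ 2)) (RtoC (8 / 27 - 1 / 3 * mu ^ 2)) = RtoC (mu ^ 4 * (1 - mu ^ 2)).
Proof.
unfold discr.
rewrite <- !RtoC_pow, <- RtoC_mult, <- RtoC_minus; f_equal; field.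
Qed.

Theorem theorem7
  (kappa lambda : R)
  (Hkappa : (0 < kappa < 1)%R)
  (Hlambda : lambda = sqrt (1 - kappa ^ 2))
  (p_kappa p_lambda : C -> option C)
  (Hp_kappa : is_wp_invariants (RtoC (4 / 3 - kappa ^ 2))
                (RtoC (8 / 27 - 1 / 3 * kappa ^ 2)) p_kappa)
  (Hp_lambda : is_wp_invariants (RtoC (4 / 3 - lambda ^ 2))
                 (RtoC (8 / 27 - 1 / 3 * lambda ^ 2)) p_lambda)
  (omega omega' : C)
  (Hperiods : fundamental_periods p_kappa (2 * omega) (2 * omega'))
  (Homega : strictly_positive omega)
  (Homega' : strictly_positive (- Ci * omega')) :
  forall z : C,
    wp_half_periods omega (1 / 2 * omega') z =
    sphere_scale (-2) (p_lambda (RtoC (sqrt 2) * Ci * z)).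
Proof.
intros z.
assert (Hk2 : (0 < kappa ^ 2 < 1)%R) by (simpl; nra).
assert (Hl2 : (lambda ^ 2 = 1 - kappa ^ 2)%R) by (rewrite Hlambda, pow2_sqrt; lra).
destruct Hp_kappa as [u1 [u2 [Hu [Eg2 [Eg3 Epk]]]]].
destruct Hp_lambda as [v1 [v2 [Hv [Fg2 [Fg3 Epl]]]]].
set (M := lattice v1 v2) in *.
assert (HM : is_lattice M) by now exists v1, v2.
assert (EL : lattice (2 * omega) (2 * omega') = lattice u1 u2).
{ apply (periods_lattice p_kappa); auto; now exists u1, u2. }
rewrite <- EL in Eg2, Eg3.
destruct Hperiods as [Hi _].
set (L := lattice (2 * omega) (2 * omega')) in *.
assert (HL : is_lattice L) by now exists (2 * omega), (2 * omega').
destruct (half_periods omega omega' Hi) as [_ [Hb _]]; fold L in Hb.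
assert (HD : discr (invariant_g2 L) (invariant_g3 L) <> 0).
{ rewrite Eg2, Eg3, discr_mu; apply RtoC_neq, Rgt_not_eq, Rmult_lt_0_compat; [|lra].
  apply pow_lt; lra. }
assert (He : wp L omega' = RtoC (- (1 / 3))).
{ assert (Root := wp_half_cubic L omega' HL Hb).
  destruct Homega as [Io Po]; destruct Homega' as [Io' Po'].
  assert (Eo : omega = RtoC (Re omega)) by (apply Ceq_ReIm; simpl; auto).
  assert (Eo' : omega' = Ci * RtoC (Im omega')).
  { unfold Re, Im in *; simpl in *; apply Ceq_ReIm; unfold Re, Im; simpl; lra. }
  assert (Po2 : (0 < Im omega')%R) by (unfold Re, Im in *; simpl in *; lra).
  destruct (wp_imaginary_half_min (Re omega) (Im omega') (- (1 / 3)) Po Po2) as [k1 k2];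
    rewrite <- ?Eo, <- ?Eo'; auto.
  { fold L; rewrite Eg2, Eg3; unfold cubic.
    rewrite <- RtoC_pow, <- !RtoC_mult, <- !RtoC_minus; f_equal; field. }
  rewrite <- Eo, <- Eo' in k1, k2; fold L in k1, k2.
  set (t := Re (wp L omega')) in *.
  assert (Et : wp L omega' = RtoC t) by (apply Ceq_ReIm; auto).
  rewrite Et in Root |- *; f_equal.
  rewrite Eg2, Eg3 in Root; unfold cubic in Root.
  rewrite <- RtoC_pow, <- !RtoC_mult, <- !RtoC_minus in Root; apply RtoC_inj in Root.
  (* A root of the second factor satisfies [4 (t - 1/6)^2 = 1 - kappa^2 < 1], whereas [t <= -1/3]
     makes the left side at least 1. *)
  assert (Fact : ((t + 1 / 3) * (4 * (t - 1 / 6) ^ 2 - 1 + kappa ^ 2) = 0)%R)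
    by (rewrite <- Root; field).
  apply Rmult_integral in Fact; destruct Fact as [h|h]; [lra|].
  assert (1 / 4 <= (t - 1 / 6) ^ 2)%R by (simpl; nra); lra. }
(* [e^2 - g2 / 12] with [e = -1/3]; the term [1/9] cancels. Then [eis 6] is [3 e / 5] times this,
   because [eis 3] vanishes at the half period. *)
assert (E4 : eis L 4 omega' = RtoC (kappa ^ 2 / 12)).
{ rewrite eis4_wp, He by (auto; apply Hb).
  replace (5 * gsum L 4) with (invariant_g2 L / 12) by (rewrite g2_gsum; field).
  rewrite Eg2, <- RtoC_div, <- RtoC_mult, <- RtoC_minus by lra; f_equal; field. }
assert (E6 : eis L 6 omega' = RtoC (- (kappa ^ 2 / 60))).
{ rewrite eis6_wp, half_eis3, E4, He by (auto; apply Hb).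
  rewrite <- !RtoC_mult, <- RtoC_plus, <- RtoC_div by lra; f_equal; field. }
set (c := RtoC (sqrt 2) * Ci).
assert (Ec : c ^ 2 = RtoC (-2)).
{ replace (c ^ 2) with (RtoC (sqrt 2) ^ 2 * (Ci * Ci)) by (unfold c; ring).
  rewrite <- RtoC_pow, pow2_sqrt by lra.
  apply Ceq_ReIm; unfold Re, Im; simpl; ring. }
assert (Hc : c <> 0).
{ intros E; assert (E' : RtoC (-2) = 0) by (rewrite <- Ec, E; ring).
  apply RtoC_inj in E'; lra. }
assert (EA : lattice (2 * omega) (2 * (1 / 2 * omega')) = adjoin L omega').
{ replace (2 * (1 / 2 * omega')) with omega' by field.
  unfold L; rewrite (lattice_swap (2 * omega) (2 * omega')), adjoin_lattice; apply lattice_swap. }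
assert (HA : is_lattice (adjoin L omega')) by apply Hb.
(* Adding 60 times [E4] gives [4/3 + 4 kappa^2], and adding 140 times [E6] gives
   [8/27 - 8/3 kappa^2]. In terms of [lambda] these are 4 and -8 times the invariants of [p_lambda],
   and 4 and -8 are [c^4] and [c^6]. *)
assert (G2 : invariant_g2 (adjoin L omega') = RtoC (4 * (4 / 3 - lambda ^ 2))).
{ rewrite g2_gsum, gsum_adjoin by (auto; try lia; apply Hb).
  rewrite Cmult_plus_distr_l, <- g2_gsum, Eg2, E4, Hl2, <- RtoC_mult, <- RtoC_plus; f_equal; field. }
assert (G3 : invariant_g3 (adjoin L omega') = RtoC (- (8 * (8 / 27 - 1 / 3 * lambda ^ 2)))).
{ rewrite g3_gsum, gsum_adjoin by (auto; try lia; apply Hb).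
  rewrite Cmult_plus_distr_l, <- g3_gsum, Eg3, E6, Hl2, <- RtoC_mult, <- RtoC_plus; f_equal; field. }
assert (EM : adjoin L omega' = (fun z => M (c * z))).
{ apply lattice_from_invariants; auto.
  - now apply lat_scale.
  - rewrite G2, g2_gsum, gsum_scale by (auto; lia).
    replace (60 * (c ^ 4 * gsum M 4)) with (c ^ 2 * c ^ 2 * (60 * gsum M 4)) by ring.
    rewrite <- g2_gsum, Fg2, Ec, <- !RtoC_mult; f_equal; ring.
  - rewrite G3, g3_gsum, gsum_scale by (auto; lia).
    replace (140 * (c ^ 6 * gsum M 6)) with (c ^ 2 * c ^ 2 * c ^ 2 * (140 * gsum M 6)) by ring.
    rewrite <- g3_gsum, Fg3, Ec, <- !RtoC_mult; f_equal; ring.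
  - rewrite G2, G3.
    (* The discriminant has weight 12 and [c^12 = 64]. *)
    replace (discr (RtoC (4 * (4 / 3 - lambda ^ 2))) (RtoC (- (8 * (8 / 27 - 1 / 3 * lambda ^ 2)))))
      with (64 * discr (RtoC (4 / 3 - lambda ^ 2)) (RtoC (8 / 27 - 1 / 3 * lambda ^ 2)))
      by (unfold discr; rewrite RtoC_opp, !(RtoC_mult 4), !(RtoC_mult 8); ring).
    rewrite discr_mu, <- RtoC_mult; apply RtoC_neq, Rgt_not_eq.
    replace (lambda ^ 4)%R with (lambda ^ 2 * lambda ^ 2)%R by ring; rewrite Hl2.
    assert (0 < (1 - kappa ^ 2) * (1 - kappa ^ 2))%R by nra; nra. }
unfold wp_half_periods; rewrite EA, EM, wp_lattice_scale, Ec by auto.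
now rewrite Epl.
Qed.
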